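(* Let $m\ge 1$ be an integer, $\mathbf p=(p_1,\dots,p_m)\in[1,+\infty]^m$, $1\le s\le q\le+\infty$ and $\rho>0$. Put $\left|\frac1{\mathbf p}\right|=\frac1{p_1}+\dots+\frac1{p_m}$. Assume that either $q\ge 2$, or $q<2$ and $\left|\frac1{\mathbf p}\right|<\frac12$. Assume moreover that \[ \frac1\lambda:=\frac12+\frac1s-\frac1{\min\{q,2\}}-\left|\frac1{\mathbf p}\right|>0 . \] Then the following are equivalent: (1) there exists $C>0$ such that, for every continuous $m$-linear operator $A:X_{p_1}\times\dots\times X_{p_m}\to X_s$, \[ \left(\sum_{i_1,\dots,i_m=1}^{+\infty}\|A(e_{i_1},\dots,e_{i_m})\|_{\ell_q}^{\rho}\right)^{1/\rho}\le C\|A\| ; \] (2) $\displaystyle \frac m\rho\le\frac1\lambda+\frac{m-1}{\max\{\lambda,s,2\}}$.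
   Context: Scalars are $\mathbb K=\mathbb R$ or $\mathbb C$. For $1\le p<+\infty$, $X_p:=\ell_p$, and $X_\infty:=c_0$ (with the sup norm); $(e_i)_{i\ge1}$ denotes the canonical unit vectors. Convention: $1/\infty=0$. Since $s\le q$, elements of $X_s$ belong to $\ell_q$ and $\|\cdot\|_{\ell_q}$ is their $\ell_q$-norm. $\|A\|$ is the usual norm of a multilinear operator, i.e. the supremum of $\|A(x^{(1)},\dots,x^{(m)})\|_{X_s}$ over $x^{(j)}$ in the closed unit ball of $X_{p_j}$. *)

(* Defs.v *)
From HB Require Import structures.
From mathcomp Require Import all_boot all_order all_algebra.
From mathcomp Require Import complex.
From mathcomp Require Import all_classical all_reals all_analysis.

Set Implicit Arguments.
Unset Strict Implicit.
Unset Printing Implicit Defensive.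

Import Order.TTheory GRing.Theory Num.Theory.
Import numFieldNormedType.Exports.

Local Open Scope classical_set_scope.
Local Open Scope ring_scope.

Variant scalar_field := RealScalars | ComplexScalars.

Definition scalars (R : realType) (F : scalar_field) : numFieldType :=
  match F with
  | RealScalars => R
  | ComplexScalars => R[i]
  end.

(* The norm of the numFieldType R[i] takes its values in R[i]; the modulus
   below is R-valued for both scalar fields. *)
Definition modulus (R : realType) (F : scalar_field) : scalars R F -> R :=
  match F with
  | RealScalars => fun x : R => `|x|
  | ComplexScalars => fun z : R[i] => ComplexField.Normc.normc z
  end.

Section SequenceSpaces.
Context {R : realType} (F : scalar_field).
Local Notation K := (scalars R F).

(* For p = +oo, [Lnorm] is the essential supremum for the counting measure,
   i.e. the sup norm. *)
Definition lnorm (p : \bar R) (x : nat -> K) : \bar R :=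
  Lnorm (@counting nat R) p (fun n => (modulus (x n))%:E).

(* X_p : c_0 when p = +oo, and l_p otherwise. *)
Definition seq_space (p : \bar R) : set (nat -> K) :=
  match p with
  | +oo%E => [set x | modulus (x n) @[n --> \oo] --> (0 : R)]
  | _ => [set x | (lnorm p x < +oo)%E]
  end.

Definition unit_seq (i : nat) : nat -> K := fun n => (n == i)%:R.

Context (m : nat) (p : 'I_m -> \bar R) (s : \bar R).
Implicit Types A : ('I_m -> nat -> K) -> (nat -> K).

Definition prod_space : set ('I_m -> nat -> K) :=
  [set x | forall j, seq_space (p j) (x j)].

(* An operator X_(p_1) x ... x X_(p_m) -> X_s is represented by a function on
   all families of sequences; only its values on [prod_space] matter. *)
Definition maps_into A : Prop := forall x, prod_space x -> seq_space s (A x).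

Definition multilinear_on A : Prop :=
  forall x (j : 'I_m) (a : K) (u v : nat -> K),
    prod_space x -> seq_space (p j) u -> seq_space (p j) v ->
    A (dfwith x j (fun n => a * u n + v n)) =
    (fun n => a * A (dfwith x j u) n + A (dfwith x j v) n).

Definition continuous_on A : Prop :=
  forall x, prod_space x -> forall eps : R, 0 < eps ->
  exists2 delta : R, 0 < delta &
    forall y, prod_space y ->
      (forall j, (lnorm (p j) (fun n => y j n - x j n)%R
         < delta%:E)%E) ->
      (lnorm s (fun n => A y n - A x n)%R < eps%:E)%E.

Definition continuous_multilinear A : Prop :=
  [/\ maps_into A, multilinear_on A & continuous_on A].

Definition opnorm A : \bar R :=
  ereal_sup [set lnorm s (A x) | x in
    [set x | prod_space x /\ forall j, (lnorm (p j) (x j) <= 1)%E]].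

(* (sum_(i_1,...,i_m) ||A(e_(i_1),...,e_(i_m))||_q ^ rho) ^ (1/rho) *)
Definition coef_norm (q : \bar R) (rho : R) A : \bar R :=
  ((\esum_(i in [set: {ffun 'I_m -> nat}])
      (lnorm q (A (fun j => unit_seq (i j))) `^ rho)) `^ rho^-1)%E.

End SequenceSpaces.

(* 1/p as a real number, with 1/oo = 0. *)
Definition inv_exp {R : realType} (p : \bar R) : R := fine p^-1.

(* Main.v *)
Require Import Defs.
From HB Require Import structures.
From mathcomp Require Import all_boot all_order all_algebra.
From mathcomp Require Import complex.
From mathcomp Require Import all_classical all_reals all_analysis.
From mathcomp Require Import ring lra.

(* (1) => (2): the inequality is tested on diagonal operators, and on operators
   whose coefficients are random signs carried by all of the m + 1 indices, by
   the m input indices, or by one input and the output index.  An exponential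
   moment bound over a finite grid approximating the l_2 balls
   (Kahane-Salem-Zygmund) makes the norm of some +-1 form on l_2 x ... x l_2
   at most C n^(1/2+dl) for every dl > 0, and Hoelder's inequality passes from
   l_p to l_2.

   (2) => (1): let a(i, j) be finitely many coefficients of an operator of norm
   1, or their real or imaginary parts.  As (+-w_k(l)^(1/p_k))_l is in the unit
   ball of l_(p_k) when sum w_k <= 1, the array
   b(i, j) = a(i, j) prod_k w_k(i_k)^(1/p_k) satisfies
   sum_j |sum_i +-b(i, j)|^s <= 1 for all products of signs of the i_k.
   Khinchine's inequality for Walsh polynomials of degree m + 1, together with
   Minkowski and Hoelder, yields inequalities of Bennett-Carl type in mixed
   norms for b, uniformly in the weights.  The
   weights are then removed one at a time, each removal lowering the reciprocal
   of the exponent by 2/p_k (for squared coefficients), and Blei's inequality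
   interpolates between the mixed norms which remain.  The passage to infinitely
   many coefficients is by monotone approximation. *)

Set Implicit Arguments.
Unset Strict Implicit.
Unset Printing Implicit Defensive.

Import Order.TTheory GRing.Theory Num.Theory.
Import numFieldNormedType.Exports.

Local Open Scope ring_scope.

(** * Inequalities for sums of real powers *)

(** The threshold 2 in the maximum of (2) comes from removing the weights. Khinchine's inequality
    produces mixed norms with an inner l_2 sum over the remaining inputs. They survive the growth of
    the outer exponent as long as it is at most 2; beyond 2 only the plain sum over all indices is
    kept, and Blei's interpolation no longer enters. These are the regimes 1/lambda >= 1/2 and
    1/lambda < 1/2; s disappears from the maximum because s <= lambda. The inequalities must hold
    for all weights at once: the weight that is extremal for one variable depends on the
    coefficients and on the weights still present. In the necessity part only exponents of n are
    compared, so the logarithm lost in the union bound over the grid can be absorbed into n^dl, and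
    dl then tends to 0. *)

Section RealInequalities.
Context {R : realType}.
Implicit Types (x y t : R).

Lemma powRV x t : 0 <= x -> x^-1 `^ t = (x `^ t)^-1.
Proof. by move=> x0; rewrite -powR_inv1// -powRrM mulN1r powRN. Qed.

Lemma le_powR x y t : 0 <= t -> 0 <= x -> x <= y -> x `^ t <= y `^ t.
Proof.
move=> t0 x0 xy; apply: ge0_ler_powR; rewrite ?nnegrE//.
exact: le_trans xy.
Qed.

Lemma powR_le1 x t : 0 <= t -> 0 <= x -> x <= 1 -> x `^ t <= 1.
Proof. by move=> t0 x0 x1; apply: le_trans (le_powR t0 x0 x1) _; rewrite powR1. Qed.

Lemma powR_prod (I : finType) (P : pred I) (h : I -> R) t :
  (forall i, 0 <= h i) ->
  (\prod_(i | P i) h i) `^ t = \prod_(i | P i) h i `^ t.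
Proof.
move=> h0; suff [] : 0 <= \prod_(i | P i) h i /\
  (\prod_(i | P i) h i) `^ t = \prod_(i | P i) h i `^ t by [].
elim/big_rec2 : _ => [|i x y _ [y0 <-]]; first by rewrite powR1.
by rewrite mulr_ge0// powRM.
Qed.

Lemma weighted_amgm (I : finType) (w a : I -> R) :
  (forall i, 0 <= w i) -> \sum_i w i = 1 -> (forall i, 0 <= a i) ->
  \prod_i a i `^ w i <= \sum_i w i * a i.
Proof.
move=> w0 w1 a0.
have [/existsP[i /andP[/eqP ai0 wi0]]|] :=
  boolP [exists i, (a i == 0) && (w i != 0)].
  rewrite (bigD1 i)//= ai0 powR0// mul0r; apply: sumr_ge0 => j _.
  exact: mulr_ge0.
rewrite negb_exists => /forallP h.
(* A factor with weight 0 equals 1 even if a i = 0; putting 1 in its place makes all logarithms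
   meaningful. *)
pose b i := if w i == 0 then 1 else a i.
have b_gt0 i : 0 < b i.
  rewrite /b; case: ifPn => // wi0; have := h i.
  by rewrite negb_and wi0 orbF lt0r a0 andbT.
have -> : \prod_i a i `^ w i = \prod_i b i `^ w i.
  by apply: eq_bigr => i _; rewrite /b; case: eqP => // ->; rewrite !powRr0.
have -> : \sum_i w i * a i = \sum_i w i * b i.
  by apply: eq_bigr => i _; rewrite /b; case: eqP => // ->; rewrite !mul0r.
set G := \prod_i _.
have G_gt0 : 0 < G by apply: prodr_gt0 => i _; exact: powR_gt0.
have GE : G = expR (\sum_i w i * ln (b i)).
  rewrite expR_sum; apply: eq_bigr => i _.
  by rewrite /powR gt_eqF.
have lnG : ln G = \sum_i w i * ln (b i) by rewrite GE expRK.
(* This is 1 + u <= exp u at u = ln (b i / G). Summed over i the logarithms cancel, since ln G is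
   their weighted mean. *)
have tang i : w i * (1 + (ln (b i) - ln G)) * G <= w i * b i.
  rewrite -mulrA ler_wpM2l// -ler_pdivlMr//.
  have -> : b i / G = expR (ln (b i) - ln G).
    by rewrite expRD expRN !lnK ?posrE.
  exact: expR_ge1Dx.
apply: le_trans (ler_sum _ (fun i _ => tang i)).
rewrite -mulr_suml; under eq_bigr do rewrite mulrDr mulr1 mulrBr.
rewrite big_split/= w1 sumrB -lnG -mulr_suml w1 mul1r subrr addr0.
by rewrite mul1r.
Qed.

Lemma powR_young x y t : 0 <= x -> 0 <= y -> 0 <= t <= 1 ->
  x `^ t * y `^ (1 - t) <= t * x + (1 - t) * y.
Proof.
move=> x0 y0 /andP[t0 t1].
have := @weighted_amgm bool (fun b => if b then t else 1 - t)
  (fun b => if b then x else y).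
rewrite !big_bool/=; apply; last by case.
  by case; rewrite // subr_ge0.
by rewrite addrC subrK.
Qed.

(** Young's inequality for a i / A and b i / B, summed. The endpoints t = 0 and t = 1 are treated
    apart because 0 to the power 0 is 1. *)
Lemma hoelder_sum (I : finType) (P : pred I) (a b : I -> R) t :
  (forall i, 0 <= a i) -> (forall i, 0 <= b i) -> 0 <= t <= 1 ->
  \sum_(i | P i) a i `^ t * b i `^ (1 - t) <=
  (\sum_(i | P i) a i) `^ t * (\sum_(i | P i) b i) `^ (1 - t).
Proof.
move=> a0 b0 /andP[t0 t1].
set A := \sum_(i | P i) a i; set B := \sum_(i | P i) b i.
have A0 : 0 <= A by exact: sumr_ge0.
have B0 : 0 <= B by exact: sumr_ge0.
have [->|tn0] := eqVneq t 0.
  rewrite subr0 powRr0 mul1r powRr1//; apply: ler_sum => i _.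
  by rewrite powRr0 mul1r powRr1.
have [->|tn1] := eqVneq t 1.
  rewrite subrr powRr0 mulr1 powRr1//; apply: ler_sum => i _.
  by rewrite powRr0 mulr1 powRr1.
have t1n0 : 1 - t != 0 by rewrite subr_eq0 eq_sym.
have [A00|An0] := eqVneq A 0.
  rewrite big1 ?mulr_ge0 ?powR_ge0// => i Pi.
  have /eqP := A00; rewrite psumr_eq0// => /allP/(_ i).
  by rewrite mem_index_enum Pi => /(_ isT)/eqP->; rewrite powR0// mul0r.
have [B00|Bn0] := eqVneq B 0.
  rewrite big1 ?mulr_ge0 ?powR_ge0// => i Pi.
  have /eqP := B00; rewrite psumr_eq0// => /allP/(_ i).
  by rewrite mem_index_enum Pi => /(_ isT)/eqP->; rewrite powR0// mulr0.
have A_gt0 : 0 < A by rewrite lt0r An0.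
have B_gt0 : 0 < B by rewrite lt0r Bn0.
have AB : 0 < A `^ t * B `^ (1 - t) by rewrite mulr_gt0 ?powR_gt0.
rewrite -[leRHS]mul1r -ler_pdivrMr// mulr_suml.
apply: (@le_trans _ _ (\sum_(i | P i) (t * (a i / A) + (1 - t) * (b i / B)))); last first.
  rewrite big_split/= -!mulr_sumr -!mulr_suml -/A -/B !divff// !mulr1.
  by rewrite addrC subrK.
apply: ler_sum => i _.
apply: le_trans (powR_young _ _ _); rewrite ?divr_ge0 ?t0//.
by rewrite !powRM ?invr_ge0// !powRV// mulrACA invfM.
Qed.

Lemma sumr_ge_term (I : finType) (P : pred I) (a : I -> R) i :
  (forall i, 0 <= a i) -> P i -> a i <= \sum_(j | P j) a j.
Proof.
move=> a0 Pi; rewrite (bigD1 i)//= lerDl; exact: sumr_ge0.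
Qed.

Lemma sum_powR_le (I : finType) (P : pred I) (a : I -> R) t :
  (forall i, 0 <= a i) -> 1 <= t ->
  \sum_(i | P i) a i `^ t <= (\sum_(i | P i) a i) `^ t.
Proof.
move=> a0 t1; have t0 : 0 < t by exact: lt_le_trans t1.
rewrite -[leRHS](@mulr_powRB1 _ _ t)//; last exact: sumr_ge0.
rewrite mulr_suml; apply: ler_sum => i Pi.
rewrite -(@mulr_powRB1 _ _ t)//; apply: ler_wpM2l => //.
rewrite ge0_ler_powR ?nnegrE ?subr_ge0//; first exact: sumr_ge0.
exact: sumr_ge_term.
Qed.

(** Write V^t = V V^(t-1) for the inner sums V and apply Hoelder for each j: this gives S <= D
    S^(1-1/t), and S^(1-1/t) cancels. *)
Lemma minkowski_sum (I J : finType) (v : I -> J -> R) t :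
  (forall i j, 0 <= v i j) -> 1 <= t ->
  \sum_i (\sum_j v i j) `^ t <= (\sum_j (\sum_i v i j `^ t) `^ t^-1) `^ t.
Proof.
move=> v0 t1; have t0 : 0 < t by exact: lt_le_trans t1.
pose V i := \sum_j v i j.
have V0 i : 0 <= V i by exact: sumr_ge0.
set D := \sum_j (\sum_i v i j `^ t) `^ t^-1.
have D0 : 0 <= D by apply: sumr_ge0 => j _; exact: powR_ge0.
pose S := \sum_i V i `^ t; rewrite -/S.
have S0 : 0 <= S by apply: sumr_ge0 => j _; exact: powR_ge0.
have ti : 0 <= t^-1 <= 1 by rewrite invr_ge0 ltW//= invf_le1.
have key : S <= D * S `^ (1 - t^-1).
  have -> : S <= D * S `^ (1 - t^-1) =
      (\sum_j \sum_i v i j * V i `^ (t - 1) <= D * S `^ (1 - t^-1)).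
    congr (_ <= _); rewrite exchange_big/=; apply: eq_bigr => i _.
    by rewrite -mulr_suml -/(V i) mulr_powRB1.
  rewrite mulr_suml; apply: ler_sum => j _.
  apply: le_trans (hoelder_sum _ _ _ ti); last 2 first.
  - by move=> i; exact: powR_ge0.
  - by move=> i; exact: powR_ge0.
  apply: ler_sum => i _; rewrite -!powRrM divff ?gt_eqF// powRr1//.
  by rewrite mulrBr mulr1 divff ?gt_eqF.
have [->|Sn0] := eqVneq S 0; first exact: powR_ge0.
have S_gt0 : 0 < S by rewrite lt0r Sn0.
have : S `^ t^-1 <= D.
  rewrite -(@ler_pM2r _ (S `^ (1 - t^-1))) ?powR_gt0// -powRD; last by rewrite Sn0 implybT.
  by rewrite addrC subrK powRr1.
move=> /(ge0_ler_powR (ltW t0)); rewrite !nnegrE => /(_ (powR_ge0 _ _) D0).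
by rewrite -powRrM mulVf ?gt_eqF// powRr1.
Qed.

(** The powers w^(1/p) of such weights fill the nonnegative part of the unit ball of l_p for finite
    p, and are constantly 1 for 1/p = 0. *)
Definition simplex (T : finType) (w : T -> R) :=
  (forall i, 0 <= w i) /\ \sum_i w i <= 1.

(** The converse of Hoelder's inequality: an extremal weight exhibits the l_a' norm of G. *)
Lemma remove_weight (T : finType) (G : T -> R) (a a' e : R) :
  0 < a -> 0 < a' -> a'^-1 = a^-1 - e -> (forall i, 0 <= G i) ->
  (forall w, simplex w -> \sum_i (G i * w i `^ e) `^ a <= 1) ->
  \sum_i G i `^ a' <= 1.
Proof.
move=> a_gt0 a'_gt0 aa' G0 H.
set S := \sum_i _.
have S0 : 0 <= S by apply: sumr_ge0 => i _; exact: powR_ge0.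
have [->//|Sn0] := eqVneq S 0.
have S_gt0 : 0 < S by rewrite lt0r Sn0.
have ea : e * a = 1 - a / a'.
  by rewrite aa' mulrBr divff ?gt_eqF// opprB addrC subrK mulrC.
(* The hypothesis for w = G^a' / S, which turns Hoelder's inequality into an
   equality, reads S^(a/a') <= 1. *)
have sw : simplex (fun i => G i `^ a' / S).
  split; first by move=> i; rewrite divr_ge0 ?powR_ge0.
  by rewrite -mulr_suml divff.
have := H _ sw.
have -> : \sum_i (G i * (G i `^ a' / S) `^ e) `^ a = S `^ (a / a').
  transitivity (\sum_i G i `^ a' * S `^ (- (e * a))).
    apply: eq_bigr => i _.
    rewrite !powRM ?powR_ge0 ?invr_ge0// ?mulr_ge0 ?powR_ge0 ?invr_ge0//.
    rewrite -!powRrM powRV// -powRN mulrA; congr (_ * _).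
    have [->|Gn0] := eqVneq (G i) 0.
      by rewrite powR0 ?gt_eqF// mul0r powR0 ?gt_eqF.
    rewrite -powRD; last by rewrite Gn0 implybT.
    by congr (_ `^ _); rewrite ea mulrBr mulr1 mulrCA divff ?gt_eqF// mulr1 addrC subrK.
  rewrite -mulr_suml -/S ea opprB -[X in X * _]powRr1// -powRD ?Sn0 ?implybT//.
  by congr (_ `^ _); ring.
move=> h; rewrite leNgt; apply/negP => S1.
have : 1 < S `^ (a / a').
  apply: (@le_lt_trans _ _ (1 `^ (a / a'))); first by rewrite powR1.
  by apply: gt0_ltr_powR; rewrite ?nnegrE ?divr_gt0.
by rewrite ltNge h.
Qed.

(** The weight belongs to the inner variable, so no single weight is extremal for all rows. The
    column bound provides one weight, and also controls the sum of f C^(a'-1) with which the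
    weighted sum is interpolated. The interpolation parameter is nonnegative because a' <= 1. *)
Lemma remove_weight_row (K L : finType) (f : K -> L -> R) (a a' e : R) :
  0 < a -> a <= a' -> a' <= 1 -> a'^-1 = a^-1 - e ->
  (forall k l, 0 <= f k l) ->
  (forall w, simplex w -> \sum_k (\sum_l f k l * w l `^ e) `^ a <= 1) ->
  \sum_l (\sum_k f k l) `^ a' <= 1 ->
  \sum_k (\sum_l f k l) `^ a' <= 1.
Proof.
move=> a_gt0 aa' a'1 ea f0 H1 H2.
have a'_gt0 : 0 < a' by exact: lt_le_trans aa'.
have [a0 a'0] : 0 <= a /\ 0 <= a' by rewrite !ltW.
(* For a = 1 also a' = 1 and e = 0, and the quotient [th] below would be 0 / 0. *)
have [a1|an1] := eqVneq a 1.
  have a'E : a' = 1 by apply/eqP; rewrite eq_le a'1 -a1.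
  move: ea; rewrite a'E a1 invr1 => /eqP; rewrite -subr_eq0 opprB addrC subrK.
  move=> /eqP e0; move: H2; rewrite a'E.
  under eq_bigr do rewrite powRr1 ?sumr_ge0//.
  by under [X in _ -> X <= _]eq_bigr do rewrite powRr1 ?sumr_ge0//; rewrite exchange_big.
have a_lt1 : a < 1 by rewrite lt_neqAle an1 (le_trans aa').
pose C l := \sum_k f k l.
have C0 l : 0 <= C l by exact: sumr_ge0.
(* With C the column sums and w = C^a', Hoelder's inequality splits f as
   (f w^e)^th * (f C^(a'-1))^(1-th); this th makes the powers of C cancel. *)
pose th := (a'^-1 - 1) / (a^-1 - 1).
have d_gt0 : 0 < a^-1 - 1 by rewrite subr_gt0 invf_gt1.
have n_ge0 : 0 <= a'^-1 - 1 by rewrite subr_ge0 invf_ge1.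
have th0 : 0 <= th by rewrite divr_ge0// ltW.
have th1 : th <= 1 by rewrite ler_pdivrMr// mul1r lerD2r lef_pV2.
have sw : simplex (fun l => C l `^ a').
  by split=> // l; exact: powR_ge0.
pose S k := \sum_l f k l * (C l `^ a') `^ e.
pose T k := \sum_l f k l * C l `^ (a' - 1).
have S0 k : 0 <= S k by apply: sumr_ge0 => l _; rewrite mulr_ge0 ?powR_ge0.
have T0 k : 0 <= T k by apply: sumr_ge0 => l _; rewrite mulr_ge0 ?powR_ge0.
have fC k l : C l = 0 -> f k l = 0.
  move=> /eqP; rewrite psumr_eq0// => /allP/(_ k).
  by rewrite mem_index_enum => /(_ isT)/eqP.
have thE : a' * e * th = (1 - a') * (1 - th).
  have -> : e = (a^-1 - 1) - (a'^-1 - 1) by rewrite ea; ring.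
  have -> : 1 - a' = a' * (a'^-1 - 1) by rewrite mulrBr divff ?gt_eqF// mulr1.
  rewrite /th; move: d_gt0 => /lt0r_neq0; set d := _ - 1 => d0.
  by field; rewrite d0 gt_eqF.
have RE k : \sum_l f k l <= S k `^ th * T k `^ (1 - th).
  apply: le_trans (hoelder_sum _ _ _ _); rewrite ?th0//; last 2 first.
  - by move=> l; rewrite mulr_ge0 ?powR_ge0.
  - by move=> l; rewrite mulr_ge0 ?powR_ge0.
  apply: ler_sum => l _; have [Cl0|Cn0] := eqVneq (C l) 0.
    by rewrite fC// mulr_ge0 ?powR_ge0.
  rewrite !powRM ?powR_ge0// mulrACA -powRD; last first.
    by rewrite addrC subrK oner_eq0.
  rewrite addrC subrK powRr1// -!powRrM -powRD ?Cn0 ?implybT//.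
  by rewrite mulrA thE -mulrDl addrC [a' - 1 + _](_ : _ = 0) ?mul0r ?powRr0 ?mulr1//; ring.
have : \sum_k T k <= 1.
  rewrite exchange_big/= (le_trans _ H2)//; apply: ler_sum => l _.
  by rewrite -mulr_suml -/(C l) mulr_powRB1.
move=> HT.
have HS : \sum_k S k `^ a <= 1 := H1 _ sw.
(* Once [RE] is raised to the power a', the exponents of S^a and T add up to 1, so Young's
   inequality separates the two sums. *)
have rE : th * a' / a + (1 - th) * a' = 1.
  have -> : th * a' / a + (1 - th) * a' = a' * (th * (a^-1 - 1) + 1) by ring.
  by rewrite /th divfK ?gt_eqF// subrK divff ?gt_eqF.
clearbody th S T.
apply: (@le_trans _ _ (\sum_k (th * a' / a * S k `^ a + (1 - th) * a' * T k))).
  apply: ler_sum => k _.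
  apply: (@le_trans _ _ ((S k `^ th * T k `^ (1 - th)) `^ a')).
    by apply: le_powR (RE k); [exact: ltW|exact: sumr_ge0].
  rewrite powRM; [|exact: powR_ge0|exact: powR_ge0].
  rewrite -!powRrM.
  have -> : (1 - th) * a' = 1 - th * a' / a by lra.
  have -> : S k `^ (th * a') = (S k `^ a) `^ (th * a' / a).
    by rewrite -powRrM; congr (_ `^ _); field; rewrite gt_eqF.
  apply: powR_young; rewrite ?powR_ge0//.
  rewrite divr_ge0 ?mulr_ge0//=.
  suff : 0 <= (1 - th) * a' by lra.
  by rewrite mulr_ge0 ?subr_ge0.
rewrite big_split/= -!mulr_sumr -[leRHS]rE lerD//.
  by rewrite ler_piMr// divr_ge0 ?mulr_ge0.
by rewrite ler_piMr// mulr_ge0 ?subr_ge0// ltW.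
Qed.

End RealInequalities.

(** * Blei's and Khinchine's inequalities *)

Section Blei.
Context {R : realType}.

(** The value of t is the one for which f^t = G^t Q^(1-t), where G is the geometric mean over k of f
    r_k^(a-1) and Q is the product of the r_k^a: all powers of the r_k cancel. The sum over i of f
    r_k^(a-1) is the sum of r_k^a over the values of i k, and the sum of Q is the product of these
    sums, so each is at most 1. *)
Lemma blei (K T : finType) (f : {ffun K -> T} -> R) (a t : R) :
  (0 < #|K|)%N -> 0 < a -> a <= 1 -> 0 < t ->
  #|K|%:R / t = a^-1 + (#|K|%:R - 1) ->
  (forall i, 0 <= f i) ->
  (forall k, \sum_l (\sum_(i : {ffun K -> T} | i k == l) f i) `^ a <= 1) ->
  \sum_i f i `^ t <= 1.
Proof.
move=> K0 a_gt0 a1 t_gt0 mt f0 H.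
set m := #|K|%:R : R; have m_gt0 : 0 < m by rewrite ltr0n.
have m1 : 1 <= m by rewrite ler1n.
have [a0 t0 m0] : [/\ 0 <= a, 0 <= t & 0 <= m] by rewrite !ltW.
have t1 : t <= 1.
  have : m <= m / t by rewrite mt -/m; have : 1 <= a^-1 by [rewrite invf_ge1]; lra.
  by rewrite ler_pdivlMr// ger_pMr.
pose r k l := \sum_(i : {ffun K -> T} | i k == l) f i.
have r0 k l : 0 <= r k l by exact: sumr_ge0.
have fr i k : f i <= r k (i k).
  by apply: (@sumr_ge_term _ _ (fun j : {ffun K -> T} => j k == i k) f i f0) => /=.
have expE : (a - 1) * (m^-1 * t) + a * (1 - t) = 0.
  have -> : (a - 1) * (m^-1 * t) + a * (1 - t) =
     a * t / m * (m / t - (a^-1 + (m - 1))) .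
    by field; rewrite !gt_eqF.
  by rewrite /m mt subrr mulr0.
pose Q (i : {ffun K -> T}) := \prod_k r k (i k) `^ a.
pose P (i : {ffun K -> T}) := \sum_k m^-1 * (f i * r k (i k) `^ (a - 1)).
have key i : f i `^ t <= t * P i + (1 - t) * Q i.
  have Q0 : 0 <= Q i by apply: prodr_ge0 => k _; exact: powR_ge0.
  have P0 : 0 <= P i.
    by apply: sumr_ge0 => k _; rewrite mulr_ge0 ?invr_ge0// mulr_ge0 ?powR_ge0.
  have [fi0|fi_neq0] := eqVneq (f i) 0.
    by rewrite fi0 powR0 ?gt_eqF// addr_ge0// mulr_ge0// subr_ge0.
  have fi_gt0 : 0 < f i by rewrite lt0r fi_neq0 f0.
  have r_gt0 k : 0 < r k (i k) by exact: lt_le_trans (fr i k).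
  pose G := \prod_k (f i * r k (i k) `^ (a - 1)) `^ m^-1.
  have GP : G <= P i.
    apply: weighted_amgm => [k||k]; rewrite ?invr_ge0//.
    - by rewrite sumr_const -mulr_natl divff ?gt_eqF.
    - by rewrite mulr_ge0 ?powR_ge0.
  have G0 : 0 <= G by apply: prodr_ge0 => k _; exact: powR_ge0.
  apply: (@le_trans _ _ (t * G + (1 - t) * Q i)); last first.
    by rewrite lerD2r ler_wpM2l.
  apply: le_trans (powR_young G0 Q0 _); rewrite ?t0//.
  have -> : f i `^ t = \prod_(k : K) (f i `^ (m^-1 * t)).
    rewrite prodr_const -powR_mulrn ?powR_ge0// -powRrM.
    by congr (_ `^ _); rewrite -/m mulrAC mulVf ?mul1r ?gt_eqF.
  rewrite /G /Q !powR_prod; last 2 first.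
  - by move=> k; exact: powR_ge0.
  - by move=> k; exact: powR_ge0.
  rewrite -big_split/=; apply: ler_prod => k _; rewrite powR_ge0/=.
  rewrite -!powRrM powRM ?powR_ge0// -mulrA -powRrM -powRD; last first.
    by rewrite (gt_eqF (r_gt0 k)) implybT.
  by rewrite expE powRr0 mulr1.
apply: le_trans (ler_sum _ (fun i _ => key i)) _.
rewrite big_split/= -!mulr_sumr.
have -> : \sum_i P i = \sum_k m^-1 * \sum_l r k l `^ a.
  rewrite /P exchange_big/=; apply: eq_bigr => k _; rewrite -mulr_sumr.
  congr (_ * _); rewrite (partition_big (fun i : {ffun K -> T} => i k) predT)//=.
  apply: eq_bigr => l _; rewrite -mulr_powRB1// /r -/(r k l) [in RHS]mulr_suml.
  by apply: eq_bigr => i /eqP ->.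
have -> : \sum_i Q i = \prod_k \sum_l r k l `^ a.
  by rewrite bigA_distr_bigA.
have le1 : \sum_k m^-1 * \sum_l r k l `^ a <= 1.
  apply: (@le_trans _ _ (\sum_(k : K) m^-1)).
    by apply: ler_sum => k _; rewrite ler_piMr ?invr_ge0//; exact: H.
  by rewrite sumr_const -mulr_natl divff ?gt_eqF.
have le2 : \prod_k \sum_l r k l `^ a <= 1.
  by apply: prodr_ile1 => k _; rewrite H andbT sumr_ge0// => l _; exact: powR_ge0.
move: le1 le2; set A := \sum_k _; set B := \prod_k _ => le1 le2.
have e1 : t * A <= t by rewrite ler_piMr.
have e2 : (1 - t) * B <= 1 - t by rewrite ler_piMr// subr_ge0.
by lra.
Qed.

End Blei.

(** * Walsh polynomials: fourth moments and Khinchine's inequality *)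

Section Bonami.
Context {R : realType} (T : finType).
Implicit Types (e : {ffun T -> bool}) (S A : {set T}) (c : {set T} -> R).

Definition rademacher e (t : T) : R := (-1) ^+ e t.
Definition walsh S e : R := \prod_(t in S) rademacher e t.
Definition walsh_sum c e : R := \sum_S c S * walsh S e.
Definition avg (g : {ffun T -> bool} -> R) : R :=
  (\sum_e g e) / #|{: {ffun T -> bool}}|%:R.

Lemma card_signs_gt0 : 0 < #|{: {ffun T -> bool}}|%:R :> R.
Proof. by rewrite ltr0n; apply/card_gt0P; exists [ffun=> true]. Qed.

Lemma avgD g h : avg (fun e => g e + h e) = avg g + avg h.
Proof. by rewrite /avg big_split/= mulrDl. Qed.

Lemma avgZ (a : R) g : avg (fun e => a * g e) = a * avg g.
Proof. by rewrite /avg -mulr_sumr mulrA. Qed.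

Lemma avg_cst (a : R) : avg (fun=> a) = a.
Proof. by rewrite /avg sumr_const -[a *+ _]mulr_natr mulfK// gt_eqF// card_signs_gt0. Qed.

Lemma avg_le g h : (forall e, g e <= h e) -> avg g <= avg h.
Proof.
move=> gh; rewrite ler_pM2r ?invr_gt0 ?card_signs_gt0//.
by apply: ler_sum => e _.
Qed.

Lemma eq_avg g h : g =1 h -> avg g = avg h.
Proof. by move=> gh; congr (_ / _); apply: eq_bigr => e _. Qed.

Lemma avg_sum (I : finType) (P : pred I) (g : I -> {ffun T -> bool} -> R) :
  avg (fun e => \sum_(i | P i) g i e) = \sum_(i | P i) avg (g i).
Proof. by rewrite /avg exchange_big/= mulr_suml. Qed.

Definition flip (t : T) e : {ffun T -> bool} :=
  [ffun u => (u == t) (+) e u].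

Lemma flipK t : involutive (flip t).
Proof. by move=> e; apply/ffunP => u; rewrite !ffunE addbA addbb. Qed.

Lemma rademacher_flip t e : rademacher (flip t e) t = - rademacher e t.
Proof. by rewrite /rademacher ffunE eqxx/= signrN. Qed.

Lemma walsh_flip t S e : t \notin S -> walsh S (flip t e) = walsh S e.
Proof.
move=> tS; apply: eq_bigr => u uS; rewrite /rademacher ffunE.
by have [ut|] := eqVneq u t; first by rewrite -ut uS in tS.
Qed.

(** Flipping the sign at t is a bijection of the sign space which negates the integrand. *)
Lemma avg_flip t g : (forall e, g (flip t e) = g e) ->
  avg (fun e => rademacher e t * g e) = 0.
Proof.
move=> gt; have /eqP : avg (fun e => rademacher e t * g e) =
    - avg (fun e => rademacher e t * g e).
  rewrite /avg -mulNr; congr (_ / _).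
  rewrite [LHS](reindex_inj (can_inj (flipK t)))/= -sumrN.
  by apply: eq_bigr => e _; rewrite rademacher_flip gt mulNr.
by rewrite eq_sym eqNr => /eqP.
Qed.

Lemma rademacher_sqr e t : rademacher e t ^+ 2 = 1.
Proof. exact: sqrr_sign. Qed.

(** Lagrange's identity: the difference of the two sides is half the double sum of the squares (a i
    b j - a j b i)^2. *)
Lemma cauchy_schwarz_sum (I : finType) (a b : I -> R) :
  (\sum_i a i * b i) ^+ 2 <= (\sum_i a i ^+ 2) * (\sum_i b i ^+ 2).
Proof.
have : 0 <= \sum_i \sum_j (a i * b j - a j * b i) ^+ 2.
  by apply: sumr_ge0 => i _; apply: sumr_ge0 => j _; exact: sqr_ge0.
have -> : \sum_i \sum_j (a i * b j - a j * b i) ^+ 2 =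
  2 * ((\sum_i a i ^+ 2) * (\sum_i b i ^+ 2) - (\sum_i a i * b i) ^+ 2).
  transitivity (\sum_i \sum_j (a i ^+ 2 * b j ^+ 2) +
    \sum_i \sum_j (b i ^+ 2 * a j ^+ 2) -
    2 * \sum_i \sum_j ((a i * b i) * (a j * b j))).
    rewrite mulr_sumr -big_split -sumrB/=; apply: eq_bigr => i _.
    rewrite mulr_sumr -big_split -sumrB/=; apply: eq_bigr => j _; ring.
  by rewrite -!big_distrlr/=; ring.
by rewrite pmulr_rge0// subr_ge0.
Qed.

Lemma walsh_setU1 t S e : t \notin S -> walsh (t |: S) e = rademacher e t * walsh S e.
Proof. by move=> tS; rewrite /walsh big_setU1. Qed.

(** Both families of coefficients are set to 0 on the sets containing t, so the two sums do not
    depend on the sign at t and the induction of [bonami] can drop t. *)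
Lemma walsh_sum_split t c e :
  walsh_sum c e = walsh_sum (fun S => if t \in S then 0 else c S) e +
    rademacher e t * walsh_sum (fun S => if t \in S then 0 else c (t |: S)) e.
Proof.
rewrite /walsh_sum (bigID (fun S => t \in S))/= addrC; congr (_ + _).
  rewrite [RHS](bigID (fun S => t \in S))/= [X in _ = X + _]big1 ?add0r.
    by apply: eq_bigr => S /negbTE->.
  by move=> S ->; rewrite mul0r.
rewrite mulr_sumr [RHS](bigID (fun S => t \in S))/= [X in _ = X + _]big1 ?add0r.
  rewrite (reindex_onto (fun S => t |: S) (fun S => S :\ t))/=; last first.
    by move=> S tS; rewrite finset.setD1K.
  apply: eq_big => [S|S /andP[_ /eqP eqS]].
    rewrite finset.setU11/=; apply/eqP/idP => [<-|tS]; first by rewrite !inE eqxx.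
    by rewrite finset.setU1K.
  have tS : t \notin S by rewrite -eqS !inE eqxx.
  by rewrite (negbTE tS) walsh_setU1//; ring.
by move=> S ->; rewrite mul0r mulr0.
Qed.

Lemma sumsq_split t c :
  \sum_S c S ^+ 2 = \sum_(S : {set T}) (if t \in S then 0 else c S) ^+ 2 +
    \sum_(S : {set T}) (if t \in S then 0 else c (t |: S)) ^+ 2.
Proof.
rewrite (bigID (fun S => t \in S))/= addrC; congr (_ + _).
  rewrite [RHS](bigID (fun S => t \in S))/= [X in _ = X + _]big1 ?add0r.
    by apply: eq_bigr => S /negbTE->.
  by move=> S ->; rewrite expr0n.
rewrite [RHS](bigID (fun S => t \in S))/= [X in _ = X + _]big1 ?add0r.
  rewrite (reindex_onto (fun S => t |: S) (fun S => S :\ t))/=; last first.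
    by move=> S tS; rewrite finset.setD1K.
  apply: eq_big => [S|S /andP[_ /eqP eqS]].
    rewrite finset.setU11/=; apply/eqP/idP => [<-|tS]; first by rewrite !inE eqxx.
    by rewrite finset.setU1K.
  have tS : t \notin S by rewrite -eqS !inE eqxx.
  by rewrite (negbTE tS).
by move=> S ->; rewrite expr0n.
Qed.

(* Induction on A: if t is in A then X = U + rV with U and V independent of the
   sign r of t, the odd powers of r average to 0, and V has degree d - 1. *)
Lemma bonami d c A : (forall S, c S != 0 -> (S \subset A) && (#|S| <= d)%N) ->
  avg (fun e => walsh_sum c e ^+ 2) = \sum_S c S ^+ 2 /\
  avg (fun e => walsh_sum c e ^+ 4) <= 9 ^+ d * (\sum_S c S ^+ 2) ^+ 2.
Proof.
have [n] := ubnP #|A|; elim: n A d c => // n IH A d c An cA.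
have [A0|[t tA]] := finset.set_0Vmem A.
  have c0 S : S != finset.set0 -> c S = 0.
    move=> S0; apply/eqP; apply/negPn/negP => /cA /andP[+ _].
    by rewrite A0 finset.subset0 (negbTE S0).
  have X e : walsh_sum c e = c finset.set0.
    rewrite /walsh_sum (bigD1 finset.set0)//= big1 ?addr0 => [|S /c0->]; last by rewrite mul0r.
    by rewrite /walsh big_set0 mulr1.
  have -> : \sum_S c S ^+ 2 = c finset.set0 ^+ 2.
    by rewrite (bigD1 finset.set0)//= big1 ?addr0 => [//|S /c0->]; rewrite expr0n.
  rewrite (eq_avg (fun e => congr1 (fun x => x ^+ 2) (X e))) avg_cst.
  rewrite (eq_avg (fun e => congr1 (fun x => x ^+ 4) (X e))) avg_cst.
  split => //; rewrite -exprM ler_peMl ?exprn_even_ge0// exprn_ege1//.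
  by rewrite ler1n.
pose cU S := if t \in S then 0 else c S.
pose cV S := if t \in S then 0 else c (t |: S).
pose U := walsh_sum cU; pose V := walsh_sum cV; pose r e := rademacher e t.
have XE e : walsh_sum c e = U e + r e * V e by exact: walsh_sum_split.
have UF e : U (flip t e) = U e.
  by apply: eq_bigr => S _; rewrite /cU; case: ifPn => [|tS]; rewrite ?mul0r ?walsh_flip.
have VF e : V (flip t e) = V e.
  by apply: eq_bigr => S _; rewrite /cV; case: ifPn => [|tS]; rewrite ?mul0r ?walsh_flip.
have cUA S : cU S != 0 -> (S \subset A :\ t) && (#|S| <= d)%N.
  rewrite /cU; case: ifPn => [_|tS /cA/andP[SA Sd]]; first by rewrite eqxx.
  by rewrite Sd andbT finset.subsetD1 SA.
have cVA S : cV S != 0 -> (S \subset A :\ t) && (#|S| < d)%N.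
  rewrite /cV; case: ifPn => [_|tS /cA/andP[SA Sd]]; first by rewrite eqxx.
  rewrite finset.cardsU1 tS add1n in Sd; rewrite Sd andbT finset.subsetD1 tS andbT.
  by apply: fintype.subset_trans SA; exact: finset.subsetUr.
have A'n : (#|A :\ t| < n)%N by rewrite (finset.cardsD1 t A) tA ltnS in An.
set u := \sum_S cU S ^+ 2; set v := \sum_S cV S ^+ 2.
have u0 : 0 <= u by apply: sumr_ge0 => S _; exact: sqr_ge0.
have v0 : 0 <= v by apply: sumr_ge0 => S _; exact: sqr_ge0.
have cE : \sum_S c S ^+ 2 = u + v by exact: sumsq_split.
have [U2 U4] := IH _ _ _ A'n cUA; rewrite -/u in U2 U4.
(* For d = 0 no set satisfies [#|S| < d], so V = 0 and the value 0 of [d.-1] is only a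
   placeholder. *)
have cVA' S : cV S != 0 -> (S \subset A :\ t) && (#|S| <= d.-1)%N.
  by move=> /cVA/andP[-> Sd]; rewrite -ltnS (ltn_predK Sd).
have [V2 V4] := IH _ _ _ A'n cVA'; rewrite -/v in V2 V4.
split.
  rewrite (eq_avg (h := fun e => U e ^+ 2 + (r e * (2 * U e * V e) + V e ^+ 2))).
    by rewrite avgD avgD avg_flip ?add0r ?U2 ?V2 ?cE// => e; rewrite UF VF.
  by move=> e; rewrite XE; have := rademacher_sqr e t; rewrite -/(r e) => r2; ring: r2.
rewrite (eq_avg (h := fun e => U e ^+ 4 + (r e * (4 * U e ^+ 3 * V e + 4 * U e * V e ^+ 3)
   + (6 * (U e ^+ 2 * V e ^+ 2) + V e ^+ 4)))); last first.
  move=> e; rewrite XE; have := rademacher_sqr e t; rewrite -/(r e) => r2.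
  by ring: r2.
rewrite avgD avgD avgD avg_flip ?add0r ?avgZ; last by move=> e; rewrite UF VF.
have UV : (avg (fun e => U e ^+ 2 * V e ^+ 2)) ^+ 2 <=
    avg (fun e => U e ^+ 4) * avg (fun e => V e ^+ 4).
  rewrite /avg expr_div_n mulf_div -expr2 ler_pM2r ?invr_gt0 ?exprn_gt0 ?card_signs_gt0//.
  apply: le_trans (cauchy_schwarz_sum _ _) _.
  by rewrite le_eqVlt; apply/orP; left; apply/eqP; congr (_ * _); apply: eq_bigr => e _; rewrite -exprM.
move: UV; set x := avg _; set y := avg (fun e => V e ^+ 4) => UV.
have x0 : 0 <= x.
  by apply: divr_ge0 => //; apply: sumr_ge0 => e _; rewrite mulr_ge0 ?sqr_ge0.
have y0 : 0 <= y.
  by apply: divr_ge0 => //; apply: sumr_ge0 => e _; exact: exprn_even_ge0.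
rewrite cE; case: d cA cUA cVA cVA' U4 V4 => [|d] cA cUA cVA cVA' U4 V4.
  have v00 : v = 0.
    by apply: big1 => S _; apply/eqP; rewrite sqrf_eq0; apply/negPn/negP => /cVA/andP[].
  have y00 : y = 0.
    by apply/eqP; rewrite eq_le y0 (le_trans V4)//= v00 expr0n mulr0.
  have x00 : x = 0.
    by apply/eqP; rewrite -sqrf_eq0 eq_le sqr_ge0 (le_trans UV)//= y00 mulr0.
  by rewrite x00 y00 v00 mulr0 !addr0.
rewrite /= in V4; set k := 9 ^+ d in V4.
have k0 : 0 <= k by exact: exprn_ge0.
(* Cauchy-Schwarz and both induction bounds. The coefficient 6 of x turns this into 18 k u v, the
   cross term of 9 k (u + v)^2: this is the origin of the base 9. *)
have x3 : x <= 3 * k * u * v.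
  rewrite -ler_sqr ?nnegrE//; last by rewrite !mulr_ge0.
  apply: le_trans UV _.
  have -> : (3 * k * u * v) ^+ 2 = (9 ^+ d.+1 * u ^+ 2) * (k * v ^+ 2).
    by rewrite (exprS 9) -/k; ring.
  apply: ler_pM => //.
  by apply: divr_ge0 => //; apply: sumr_ge0 => e _; exact: exprn_even_ge0.
rewrite (exprS 9) -/k in U4 *.
have : 0 <= k * v ^+ 2 by rewrite mulr_ge0 ?sqr_ge0.
have {}U4 : avg (fun e => U e ^+ 4) <= 9 * k * u ^+ 2 := U4.
have {}V4 : y <= k * v ^+ 2 := V4.
move: U4; set z := avg _ => U4 kv.
apply: (@le_trans _ _ (9 * k * u ^+ 2 + (6 * (3 * k * u * v) + k * v ^+ 2))).
  by rewrite lerD// lerD// ler_wpM2l.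
by rewrite sqrrD; lra.
Qed.

(** The fourth moment prevents the mean of X^2 from being carried by the few signs for which |X| is
    large, so the mean of |X| controls it. *)
Lemma khinchine_L1 d c : (forall S, c S != 0 -> (#|S| <= d)%N) ->
  Num.sqrt (\sum_S c S ^+ 2) <= 3 * 3 ^+ d * avg (fun e => `|walsh_sum c e|).
Proof.
move=> cd; have [|EX2 EX4] := @bonami d c (finset.setTfor T).
  by move=> S /cd; rewrite finset.subsetT.
move: EX2 EX4; set V := \sum_S c S ^+ 2 => EX2 EX4.
have V0 : 0 <= V by apply: sumr_ge0 => S _; exact: sqr_ge0.
set M := avg _.
have M0 : 0 <= M by rewrite divr_ge0// sumr_ge0.
have [->|Vn0] := eqVneq V 0; first by rewrite sqrtr0 mulr_ge0// mulr_ge0// exprn_ge0.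
have V_gt0 : 0 < V by rewrite lt0r Vn0.
set w := Num.sqrt V; have w_gt0 : 0 < w by rewrite sqrtr_gt0.
have VE : V = w ^+ 2 by rewrite sqr_sqrtr.
set k := 3 ^+ d : R; have k_gt0 : 0 < k by exact: exprn_gt0.
have k2 : 9 ^+ d = k ^+ 2 :> R by rewrite /k exprAC; congr (_ ^+ _); ring.
set s := 2 * k * w; have s_gt0 : 0 < s by rewrite !mulr_gt0.
(* Averaging this truncation bounds V by s E|X| + E X^4 / s^2 <= s E|X| + V / 4. *)
have pw (x : R) : x ^+ 2 <= s * `|x| + (s ^+ 2)^-1 * x ^+ 4.
  have [xs|sx] := leP `|x| s.
    rewrite -real_normK ?num_real// (@le_trans _ _ (s * `|x|))//.
      by rewrite expr2 ler_wpM2r.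
    by rewrite lerDl mulr_ge0 ?invr_ge0 ?sqr_ge0// exprn_even_ge0.
  rewrite (@le_trans _ _ ((s ^+ 2)^-1 * x ^+ 4))//; last by rewrite lerDr mulr_ge0// ltW.
  rewrite ler_pdivlMl ?exprn_gt0// (_ : x ^+ 4 = x ^+ 2 * x ^+ 2); last by ring.
  rewrite ler_wpM2r ?sqr_ge0// -[x ^+ 2]real_normK ?num_real//.
  by rewrite ler_sqr ?nnegrE// ltW.
have := avg_le (fun e => pw (walsh_sum c e)).
rewrite EX2 avgD !avgZ -/M => h.
have : V <= s * M + (s ^+ 2)^-1 * (9 ^+ d * V ^+ 2).
  by apply: le_trans h _; rewrite lerD2l ler_wpM2l// invr_ge0 sqr_ge0.
have -> : (s ^+ 2)^-1 * (9 ^+ d * V ^+ 2) = w ^+ 2 / 4.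
  by rewrite k2 VE /s; field; rewrite !gt_eqF.
rewrite VE /s => h2.
(* What remains is (3/4) w^2 <= 2 k w M; the constant 8/3 is rounded up to 3. *)
have : w * (3 * w) <= w * (8 * k * M) by nra.
by rewrite ler_pM2l// => h3; have : 0 <= k * M by [rewrite mulr_ge0// ltW]; lra.
Qed.

(** Distinct indices have distinct monomials, so each [c' S] has at most one summand and the sums of
    squares agree. *)
Lemma khinchine (I : finType) (P : pred I) (mon : I -> {set T}) (c : I -> R) d :
  {in P &, injective mon} -> (forall i, P i -> (#|mon i| <= d)%N) ->
  Num.sqrt (\sum_(i | P i) c i ^+ 2) <=
  3 * 3 ^+ d * avg (fun e => `|\sum_(i | P i) c i * walsh (mon i) e|).
Proof.
move=> inj md; pose c' S := \sum_(i | P i && (mon i == S)) c i.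
have := @khinchine_L1 d c'.
have -> : \sum_S c' S ^+ 2 = \sum_(i | P i) c i ^+ 2.
  rewrite [RHS](partition_big mon predT)//=; apply: eq_bigr => S _.
  have [i /andP[Pi /eqP iS]|h] := pickP (fun i => P i && (mon i == S)).
    have uniqi j : P j && (mon j == S) = (j == i).
      apply/andP/eqP => [[Pj /eqP jS]|->]; last by rewrite Pi iS.
      by apply: inj => //; rewrite iS jS.
    by rewrite /c' !(eq_bigl _ _ uniqi) !big_pred1_eq.
  by rewrite /c' !big_pred0// expr0n.
have -> : avg (fun e => `|walsh_sum c' e|) =
    avg (fun e => `|\sum_(i | P i) c i * walsh (mon i) e|).
  apply: eq_avg => e; congr `|_|.
  rewrite [RHS](partition_big mon predT)//=; apply: eq_bigr => S _.
  by rewrite mulr_suml; apply: eq_bigr => i /andP[_ /eqP->].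
apply=> S; rewrite /c' => c'0.
have [i /andP[Pi /eqP <-]|h] := pickP (fun i => P i && (mon i == S)).
  exact: md.
by rewrite big_pred0// eqxx in c'0.
Qed.

End Bonami.

(** * Removal of the weights *)

Section Chain.
Context {R : realType} (K T : finType).
Variables (H : {ffun K -> T} -> R) (ex : K -> R).
Hypothesis H0 : forall i, 0 <= H i.
Hypothesis ex0 : forall k, 0 <= ex k.

Implicit Types (S : {set K}) (w : K -> T -> R) (i : {ffun K -> T}) (v : T -> R).

Definition weight (S : {set K}) (w : K -> T -> R) (i : {ffun K -> T}) : R :=
  \prod_(k | k \notin S) w k (i k) `^ ex k.

(* In the application ex k = 2 / p_k.  S is the set of the variables whose weight
   has been removed. *)
Definition mixed_sum (S : {set K}) (a : R) :=
  forall w : K -> T -> R, (forall k, simplex (w k)) -> forall k,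
  \sum_l (\sum_(i : {ffun K -> T} | i k == l) H i * weight S w i) `^ a <= 1.

Definition full_sum (S : {set K}) (a : R) :=
  forall w : K -> T -> R, (forall k, simplex (w k)) ->
  \sum_i (H i * weight S w i) `^ a <= 1.

Lemma weight_ge0 S w i : 0 <= weight S w i.
Proof. by apply: prodr_ge0 => k _; exact: powR_ge0. Qed.

Lemma weight_upd S w v k0 i : k0 \notin S ->
  weight S (fun k => if k == k0 then v else w k) i =
  weight (k0 |: S) w i * v (i k0) `^ ex k0.
Proof.
move=> kS; rewrite /weight (bigD1 k0)//= eqxx mulrC; congr (_ * _).
apply: eq_big => [k|k /andP[_ /negbTE->]//].
by rewrite !inE negb_or andbC.
Qed.

Lemma simplex_upd (w : K -> T -> R) (v : T -> R) k0 :
  (forall k, simplex (w k)) -> simplex v ->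
  forall k, simplex (if k == k0 then v else w k).
Proof. by move=> sw sv k; case: eqP. Qed.

(** If the outer index is that of k0 itself, the weight is constant on each inner sum and can be
    pulled out. *)
Lemma mixed_direct S k0 (b : R) : k0 \notin S -> 0 < b -> 0 < b - ex k0 ->
  mixed_sum S b^-1 -> forall w : K -> T -> R, (forall k, simplex (w k)) ->
  \sum_l (\sum_(i : {ffun K -> T} | i k0 == l) H i * weight (k0 |: S) w i)
    `^ (b - ex k0)^-1 <= 1.
Proof.
move=> kS b0 b'0 M w sw.
apply: (@remove_weight _ _ _ b^-1 _ (ex k0)); rewrite ?invr_gt0// ?invrK//.
  by move=> l; apply: sumr_ge0 => i _; rewrite mulr_ge0 ?weight_ge0.
move=> v sv; have := M _ (simplex_upd k0 sw sv) k0.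
apply: le_trans; rewrite le_eqVlt; apply/orP; left; apply/eqP.
apply: eq_bigr => l _; congr (_ `^ _); rewrite mulr_suml.
by apply: eq_bigr => i /eqP il; rewrite weight_upd// il mulrA.
Qed.

(** For k other than k0 the weight varies inside the inner sum. Grouping that sum by the value at k0
    gives the array of [remove_weight_row], whose column bound is the case k = k0. *)
Lemma mixed_step S k0 (b : R) : k0 \notin S -> 1 <= b - ex k0 ->
  mixed_sum S b^-1 -> mixed_sum (k0 |: S) (b - ex k0)^-1.
Proof.
move=> kS b'1 M w sw k.
have b1 : 1 <= b by rewrite (le_trans b'1)// gerBl.
have b0 : 0 < b by exact: lt_le_trans b1.
have b'0 : 0 < b - ex k0 by exact: lt_le_trans b'1.
have [->|kk0] := eqVneq k k0; first exact: mixed_direct.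
pose f l l' := \sum_(i : {ffun K -> T} | (i k == l) && (i k0 == l')) H i * weight (k0 |: S) w i.
have f0 l l' : 0 <= f l l'.
  by apply: sumr_ge0 => i _; rewrite mulr_ge0 ?weight_ge0.
have fr l : \sum_(i : {ffun K -> T} | i k == l) H i * weight (k0 |: S) w i = \sum_l' f l l'.
  by rewrite (partition_big (fun i : {ffun K -> T} => i k0) predT).
under eq_bigr do rewrite fr.
apply: (@remove_weight_row _ _ _ _ b^-1 _ (ex k0)); rewrite ?invr_gt0// ?invrK//.
- by rewrite lef_pV2 ?posrE// gerBl.
- by rewrite invf_le1.
- move=> v sv; have := M _ (simplex_upd k0 sw sv) k.
  apply: le_trans; rewrite le_eqVlt; apply/orP; left; apply/eqP.
  apply: eq_bigr => l _; congr (_ `^ _).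
  rewrite [RHS](partition_big (fun i : {ffun K -> T} => i k0) predT)//=.
  apply: eq_bigr => l' _; rewrite mulr_suml.
  by apply: eq_bigr => i /andP[_ /eqP il]; rewrite weight_upd// il mulrA.
- apply: le_trans (mixed_direct kS b0 b'0 M sw).
  rewrite le_eqVlt; apply/orP; left; apply/eqP.
  apply: eq_bigr => l' _; congr (_ `^ _).
  rewrite [RHS](partition_big (fun i : {ffun K -> T} => i k) predT)//=.
  by apply: eq_bigr => l _; apply: eq_bigl => i; rewrite andbC.
Qed.

(** Here the new exponent is at least 1, out of reach of [remove_weight_row]. But then a power of an
    inner sum dominates the sum of the powers, so the single mixed norm with outer index k0 controls
    the full sum. *)
Lemma cross_step S k0 (b : R) : k0 \notin S -> 1 <= b -> 0 < b - ex k0 ->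
  b - ex k0 <= 1 ->
  mixed_sum S b^-1 -> full_sum (k0 |: S) (b - ex k0)^-1.
Proof.
move=> kS b1 b'0 b'1 M w sw.
have b0 : 0 < b by exact: lt_le_trans b1.
apply: le_trans (mixed_direct kS b0 b'0 M sw).
rewrite (partition_big (fun i : {ffun K -> T} => i k0) predT)//=.
apply: ler_sum => l _; apply: sum_powR_le; last by rewrite invf_ge1.
by move=> i; rewrite mulr_ge0 ?weight_ge0.
Qed.

(** The weight is removed from the norms [G l] of the slices with i k0 = l. Inside a slice the
    exponent grows, which only decreases the norm. *)
Lemma full_step S k0 (b : R) : k0 \notin S -> 0 < b -> 0 < b - ex k0 ->
  full_sum S b^-1 -> full_sum (k0 |: S) (b - ex k0)^-1.
Proof.
move=> kS b0 b'0 M w sw.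
pose g i := H i * weight (k0 |: S) w i.
have g0 i : 0 <= g i by rewrite mulr_ge0 ?weight_ge0.
pose G l := (\sum_(i : {ffun K -> T} | i k0 == l) g i `^ b^-1) `^ b.
have s0 l : 0 <= \sum_(i : {ffun K -> T} | i k0 == l) g i `^ b^-1.
  by apply: sumr_ge0 => i _; exact: powR_ge0.
have HG : \sum_l G l `^ (b - ex k0)^-1 <= 1.
  apply: (@remove_weight _ _ _ b^-1 _ (ex k0)); rewrite ?invr_gt0// ?invrK//.
    by move=> l; exact: powR_ge0.
  move=> v sv; have := M _ (simplex_upd k0 sw sv).
  apply: le_trans; rewrite le_eqVlt; apply/orP; left; apply/eqP.
  rewrite [RHS](partition_big (fun i : {ffun K -> T} => i k0) predT)//=.
  apply: eq_bigr => l _; rewrite powRM ?powR_ge0// -[G l `^ _]powRrM divff ?gt_eqF// powRr1//.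
  rewrite mulr_suml; apply: eq_bigr => i /eqP il.
  by rewrite weight_upd// il mulrA -/(g i) [RHS]powRM ?powR_ge0.
apply: le_trans HG.
rewrite (partition_big (fun i : {ffun K -> T} => i k0) predT)//=.
apply: ler_sum => l _; rewrite -/(g _) -powRrM.
have -> : \sum_(i : {ffun K -> T} | i k0 == l) g i `^ (b - ex k0)^-1 =
          \sum_(i : {ffun K -> T} | i k0 == l) (g i `^ b^-1) `^ (b / (b - ex k0)).
  by apply: eq_bigr => i _; rewrite -powRrM mulrA mulVf ?mul1r ?gt_eqF.
apply: sum_powR_le; first by move=> i; exact: powR_ge0.
by rewrite ler_pdivlMr// mul1r gerBl.
Qed.

(** Invariant of the removal: mixed norms while the reciprocal exponent is at least 1, the full sum
    below 1. The reciprocal only decreases, so the regime changes at most once. *)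
Lemma chain (b : R) (S : {set K}) :
  (1 <= b -> mixed_sum finset.set0 b^-1) -> (b < 1 -> full_sum finset.set0 b^-1) ->
  0 < b - \sum_(k in S) ex k ->
  (1 <= b - \sum_(k in S) ex k -> mixed_sum S (b - \sum_(k in S) ex k)^-1) /\
  (b - \sum_(k in S) ex k < 1 -> full_sum S (b - \sum_(k in S) ex k)^-1).
Proof.
move=> M F; have [n] := ubnP #|S|; elim: n S => // n IH S Sn bS.
have [->|[k0 kS]] := finset.set_0Vmem S; first by rewrite big_set0 subr0.
have S'n : (#|S :\ k0| < n)%N by rewrite (finset.cardsD1 k0 S) kS ltnS in Sn.
have E : b - \sum_(k in S) ex k = (b - \sum_(k in S :\ k0) ex k) - ex k0.
  by rewrite (big_setD1 k0)//= opprD addrA addrAC.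
have ES : S = k0 |: (S :\ k0) by rewrite finset.setD1K.
have k0S' : k0 \notin S :\ k0 by rewrite !inE eqxx.
rewrite E in bS *; have {}IH := IH _ S'n.
move: bS IH k0S'; rewrite [in mixed_sum S]ES [in full_sum S]ES.
move: (S :\ k0) => S'; set b' := b - _ => bS IH k0S'.
have b'0 : 0 < b' by rewrite (lt_le_trans bS)// gerBl.
have {IH} [IHM IHF] := IH b'0.
split=> h.
  by apply: mixed_step => //; apply: IHM; rewrite (le_trans h)// gerBl.
have [b1|b1] := leP 1 b'; first by apply: cross_step (ltW h) (IHM b1).
by apply: full_step => //; exact: IHF.
Qed.

(** It is enough to reach some exponent u <= t, since then every H i is at most 1. If b' >= 1,
    Blei's inequality gives m/u = b' + m - 1; if b' < 1, the full sum gives u = 1/b'. These are the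
    two values of the minimum. *)
Lemma chain_blei (b t : R) : (0 < #|K|)%N ->
  (1 <= b -> mixed_sum finset.set0 b^-1) -> (b < 1 -> full_sum finset.set0 b^-1) ->
  0 < b - \sum_k ex k -> 0 < t ->
  #|K|%:R / t <= b - \sum_k ex k + (#|K|%:R - 1) * Num.min 1 (b - \sum_k ex k) ->
  \sum_i H i `^ t <= 1.
Proof.
move=> K0 M F; set b' := b - _ => b'0 t0 tb.
have b'E : b' = b - \sum_(k in finset.setTfor K) ex k.
  by congr (_ - _); apply: eq_bigl => k; rewrite inE.
have weightT w i : weight (finset.setTfor K) w i = 1.
  by rewrite /weight big1// => k; rewrite inE.
have := @chain b (finset.setTfor K) M F; rewrite -b'E => /(_ b'0)[M' F'].
set m := #|K|%:R in tb.
have m0 : 0 < m by rewrite ltr0n.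
have m1 : 1 <= m by rewrite ler1n.
suff [t0' t0'0 [t0't Ht]] : exists2 u : R, 0 < u & u <= t /\ \sum_i H i `^ u <= 1.
  apply: le_trans (Ht); apply: ler_sum => i _.
  have Hi1 : H i `^ t0' <= 1.
    apply: le_trans Ht.
    by apply: (@sumr_ge_term _ _ predT (fun i => H i `^ t0')) => // j; exact: powR_ge0.
  have [->|Hi0] := eqVneq (H i) 0; first by rewrite !powR0 ?gt_eqF.
  have Hi_gt0 : 0 < H i by rewrite lt0r Hi0 H0.
  apply: ger_powR => //; rewrite Hi_gt0/= leNgt; apply/negP => Hi.
  have := gt0_ltr_powR t0'0; move=> /(_ 1 (H i)); rewrite !nnegrE ler01 H0 powR1.
  by move=> /(_ isT isT Hi); rewrite ltNge Hi1.
(* All weights have been removed, so any point of the simplex can be inserted. *)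
have sw0 (k : K) : simplex (fun _ : T => 0 : R).
  by split=> //; rewrite big1.
have [b1|b1] := leP 1 b'.
  have bm : 0 < b' + (m - 1) by lra.
  exists (m / (b' + (m - 1))); first by rewrite divr_gt0.
  split.
    rewrite ler_pdivrMr// mulrC -ler_pdivrMr//.
    by move: tb; rewrite minEle b1 mulr1.
  apply: (@blei _ _ _ _ b'^-1) => //; rewrite ?invr_gt0 ?invf_le1 ?divr_gt0//.
    by rewrite invrK -/m invf_div mulrCA divff ?mulr1// gt_eqF.
  move=> k; have := M' b1 _ sw0 k; apply: le_trans.
  rewrite le_eqVlt; apply/orP; left; apply/eqP.
  apply: eq_bigr => l _; congr (_ `^ _).
  by apply: eq_bigr => i _; rewrite weightT mulr1.
exists b'^-1; first by rewrite invr_gt0.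
split.
  have : m / t <= m * b'.
    by move: tb; rewrite minEle (leNgt 1) b1/=; lra.
  by rewrite ler_pM2l// => h; rewrite -(invrK t) lef_pV2 ?posrE ?invr_gt0.
have := F' b1 _ sw0; apply: le_trans.
rewrite le_eqVlt; apply/orP; left; apply/eqP.
by apply: eq_bigr => i _; rewrite weightT mulr1.
Qed.

End Chain.

(** * Mixed-norm inequalities of Bennett-Carl type *)

Lemma avg_jensen {R : realType} (T : finType) (g : {ffun T -> bool} -> R) (s : R) :
  1 <= s -> (forall e, 0 <= g e) -> avg g `^ s <= avg (fun e => g e `^ s).
Proof.
move=> s1 g0; have s0 : 0 < s by exact: lt_le_trans s1.
rewrite /avg; set n := _%:R; have n0 : 0 < n by exact: card_signs_gt0.
have n0' : 0 <= n by exact: ltW.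
have si : 0 <= s^-1 <= 1 by rewrite invr_ge0 ltW//= invf_le1.
have := @hoelder_sum R _ predT (fun e => g e `^ s) (fun=> 1) s^-1 _ _ si.
have -> : \sum_(e : {ffun T -> bool}) (g e `^ s) `^ s^-1 * 1 `^ (1 - s^-1) = \sum_e g e.
  apply: eq_bigr => e _.
  by rewrite powR1 mulr1 -powRrM divff ?gt_eqF// powRr1.
have -> : \sum_(e : {ffun T -> bool}) (1 : R) = n by rewrite sumr_const.
set S := \sum_e _ `^ s; set A := \sum_e g e => /(_ (fun e => powR_ge0 _ _) (fun=> ler01)) h.
have S0 : 0 <= S by apply: sumr_ge0 => e _; exact: powR_ge0.
have A0 : 0 <= A by exact: sumr_ge0.
have : A `^ s <= (S `^ s^-1 * n `^ (1 - s^-1)) `^ s by apply: le_powR => //; exact: ltW.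
rewrite powRM ?powR_ge0// -!powRrM mulVf ?gt_eqF// powRr1// => h2.
rewrite powRM ?invr_ge0// powRV// ler_pdivrMr ?powR_gt0//.
apply: le_trans h2 _; rewrite -mulrA ler_wpM2l// le_eqVlt; apply/orP; left; apply/eqP.
rewrite mulrBl mul1r mulVf ?gt_eqF// powRB; last by rewrite (gt_eqF n0) implybT.
by rewrite powRr1// mulrC.
Qed.

Section Start.
Context {R : realType} (K T J : finType).
Variables (b : {ffun K -> T} -> J -> R) (s : R).
Hypothesis s1 : 1 <= s.
Hypothesis Hb : forall sg : K -> T -> bool,
  \sum_j `|\sum_i b i j * \prod_k (-1) ^+ sg k (i k)| `^ s <= 1.

Implicit Types (i : {ffun K -> T}) (e : {ffun (K * T) + J -> bool}).

(** The Khinchine constant in degree [#|K|.+1], reached when the output sign joins the input signs.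
    Dividing by it in [sq] makes the later bounds equal to 1. *)
Definition kh_cst : R := 3 * 3 ^+ #|K|.+1.

Lemma kh_cst_gt0 : 0 < kh_cst.
Proof. by rewrite mulr_gt0// exprn_gt0. Qed.

(* One sign per variable and index (inl), and one per output index (inr): the
   latter serve in [row_sums], where the output is tested against signs. *)
Definition mon i : {set (K * T) + J} := [set inl (k, i k) | k in K].

Lemma walsh_mon i e :
  walsh (R := R) (mon i) e = \prod_k (-1) ^+ e (inl (k, i k)).
Proof. by rewrite /walsh big_imset// => k k' _ _ []. Qed.

Lemma inr_mon i j : inr j \notin mon i.
Proof. by apply/negP => /imsetP[]. Qed.

Lemma card_mon i : #|mon i| = #|K|.
Proof. by rewrite card_imset// => k k' []. Qed.

Lemma mon_inj i i' : mon i = mon i' -> i = i'.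
Proof.
move=> ii'; apply/ffunP => k.
have : inl (k, i k) \in mon i' by rewrite -ii'; apply: imset_f.
by move=> /imsetP[k' _ [-> ->]].
Qed.

Definition sq i j : R := (b i j / kh_cst) ^+ 2.

Lemma sq_ge0 i j : 0 <= sq i j. Proof. exact: sqr_ge0. Qed.

Lemma sum_sqE (P : pred {ffun K -> T}) j :
  \sum_(i | P i) sq i j = (\sum_(i | P i) b i j ^+ 2) / kh_cst ^+ 2.
Proof. by rewrite mulr_suml; apply: eq_bigr => i _; rewrite /sq expr_div_n. Qed.

(** For each output j Khinchine's inequality bounds the l_2 norm of the coefficients by the mean of
    |X_j|, and Jensen's passes to |X_j|^s. The sum over j is then bounded for every choice of
    signs. *)
Lemma col_sums : \sum_j (\sum_i sq i j) `^ (s / 2) <= 1.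
Proof.
have k0 := kh_cst_gt0; have s0 : 0 < s by exact: lt_le_trans s1.
pose X j e : R := `|\sum_i b i j * walsh (mon i) e|.
have XH e : \sum_j X j e `^ s <= 1.
  apply: le_trans (Hb (fun k t => e (inl (k, t)))).
  rewrite le_eqVlt; apply/orP; left; apply/eqP; apply: eq_bigr => j _.
  by congr (`|_| `^ _); apply: eq_bigr => i _; rewrite walsh_mon.
have key j : (\sum_i sq i j) `^ (s / 2) <= avg (fun e => X j e `^ s).
  rewrite sum_sqE (mulrC s) powRrM; set B := \sum_i _.
  have B0 : 0 <= B by apply: sumr_ge0 => i _; exact: sqr_ge0.
  rewrite powR12_sqrt; last by rewrite divr_ge0 ?sqr_ge0.
  rewrite sqrtrM// sqrtrV ?sqr_ge0// sqrtr_sqr gtr0_norm//.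
  apply: le_trans (avg_jensen s1 _); last by move=> e; exact: normr_ge0.
  apply: le_powR; [exact: ltW|by rewrite divr_ge0 ?sqrtr_ge0// ltW|].
  rewrite ler_pdivrMr// mulrC.
  apply: (@khinchine _ _ _ predT) => [i i' _ _|i _]; first exact: mon_inj.
  by rewrite card_mon.
apply: le_trans (ler_sum _ (fun j _ => key j)) _.
rewrite -avg_sum -[leRHS](@avg_cst R ((K * T) + J)%type).
exact: avg_le.
Qed.

(** The vector v^(1-1/s) lies in the dual ball of l_s, so pairing the output with it, with any
    signs, gives at most 1. Khinchine's inequality bounds row l by the mean of |Y_l|, and the sum of
    the |Y_l| is again such a pairing. *)
Lemma row_sums (v : J -> R) k : simplex v ->
  \sum_l (\sum_j (\sum_(i : {ffun K -> T} | i k == l) sq i j) * v j `^ (2 - 2 / s)) `^ 2^-1 <= 1.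
Proof.
move=> [v0 v1].
have k0 := kh_cst_gt0; have s0 : 0 < s by exact: lt_le_trans s1.
have si : 0 <= s^-1 <= 1 by rewrite invr_ge0 ltW//= invf_le1.
pose c (x : {ffun K -> T} * J) := b x.1 x.2 * v x.2 `^ (1 - s^-1).
pose mr (x : {ffun K -> T} * J) := inr x.2 |: mon x.1.
have mr_inj : injective mr.
  move=> [i j] [i' j'] /= /setP h.
  have : inr j \in mr (i', j') by rewrite -h /mr !inE eqxx.
  rewrite !inE /= (negbTE (inr_mon _ _)) orbF => /eqP[jj'].
  rewrite jj'; congr pair; apply: mon_inj; apply/setP => x.
  have := h x; rewrite !inE jj'.
  by have [->|] := eqVneq x (inr j') => //=; rewrite !(negbTE (inr_mon _ _)).
pose Y l e : R := \sum_(x : {ffun K -> T} * J | x.1 k == l) c x * walsh (mr x) e.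
have YE l e : Y l e = \sum_j (v j `^ (1 - s^-1) * rademacher e (inr j)) *
    \sum_(i : {ffun K -> T} | i k == l) b i j * walsh (mon i) e.
  rewrite /Y; transitivity (\sum_(i : {ffun K -> T} | i k == l) \sum_j c (i, j) * walsh (mr (i, j)) e).
    by rewrite pair_big_dep/=; apply: eq_big => [[i j]|[i j] _]; rewrite ?andbT.
  rewrite exchange_big/=; apply: eq_bigr => j _; rewrite mulr_sumr.
  apply: eq_bigr => i _; rewrite /mr /c walsh_setU1 ?inr_mon//=; ring.
have key l : (\sum_j (\sum_(i : {ffun K -> T} | i k == l) sq i j) * v j `^ (2 - 2 / s)) `^ 2^-1 <= avg (fun e => `|Y l e|).
  have -> : \sum_j (\sum_(i : {ffun K -> T} | i k == l) sq i j) * v j `^ (2 - 2 / s) =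
     (\sum_(x : {ffun K -> T} * J | x.1 k == l) c x ^+ 2) / kh_cst ^+ 2.
    transitivity ((\sum_(i : {ffun K -> T} | i k == l) \sum_j c (i, j) ^+ 2) / kh_cst ^+ 2); last first.
      congr (_ / _).
      by rewrite pair_big_dep/=; apply: eq_big => [[i j]|[i j] _]; rewrite ?andbT.
    rewrite exchange_big/= mulr_suml; apply: eq_bigr => j _.
    rewrite sum_sqE mulrAC; congr (_ / _); rewrite mulr_suml; apply: eq_bigr => i _.
    rewrite /c/= exprMn; congr (_ * _).
    by rewrite -[RHS]powR_mulrn ?powR_ge0// -powRrM; congr (_ `^ _); ring.
  set B := \sum_(x | _) _.
  have B0 : 0 <= B by apply: sumr_ge0 => i _; exact: sqr_ge0.
  rewrite powR12_sqrt; last by rewrite divr_ge0 ?sqr_ge0.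
  rewrite sqrtrM// sqrtrV ?sqr_ge0// sqrtr_sqr gtr0_norm//.
  rewrite ler_pdivrMr// mulrC.
  apply: (@khinchine _ _ _ (fun x : {ffun K -> T} * J => x.1 k == l)) => [x y _ _|x _].
    exact: mr_inj.
  by rewrite finset.cardsU1 inr_mon card_mon.
apply: le_trans (ler_sum _ (fun l _ => key l)) _.
rewrite -avg_sum -[leRHS](@avg_cst R ((K * T) + J)%type).
apply: avg_le => e.
(* The signs of variable k are corrected by those of the Y_l, which turns the sum of the |Y_l| into
   one value of the form. *)
pose sg k' t := if k' == k then (Y t e < 0) (+) e (inl (k', t)) else e (inl (k', t)).
pose W j : R := \sum_i b i j * \prod_k' (-1) ^+ sg k' (i k').
have WE i : \prod_k' (-1) ^+ sg k' (i k') = (-1) ^+ (Y (i k) e < 0)%R * walsh (mon i) e :> R.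
  rewrite walsh_mon (bigD1 k)//= [in RHS](bigD1 k)//= mulrA; congr (_ * _).
    by rewrite /sg eqxx signr_addb.
  by apply: eq_bigr => k' /negbTE k'k; rewrite /sg k'k.
have -> : \sum_l `|Y l e| = \sum_j (v j `^ (1 - s^-1) * rademacher e (inr j)) * W j.
  transitivity (\sum_l (-1) ^+ (Y l e < 0)%R * Y l e).
    by apply: eq_bigr => l _; rewrite normrEsign mulrC.
  under eq_bigr do rewrite [X in _ * X]YE mulr_sumr.
  rewrite exchange_big/=; apply: eq_bigr => j _.
  under eq_bigr do rewrite mulrCA; rewrite -mulr_sumr; congr (_ * _).
  rewrite /W (partition_big (fun i : {ffun K -> T} => i k) predT)//=.
  apply: eq_bigr => l _; rewrite mulr_sumr; apply: eq_bigr => i /eqP il.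
  by rewrite WE il mulrCA.
apply: (@le_trans _ _ (\sum_j (`|W j| `^ s) `^ s^-1 * v j `^ (1 - s^-1))).
  apply: ler_sum => j _; apply: le_trans (ler_norm _) _.
  rewrite !normrM normr_sign mulr1 ger0_norm ?powR_ge0// mulrC.
  by rewrite -powRrM divff ?gt_eqF// powRr1.
apply: le_trans (hoelder_sum _ _ _ si) _ => //.
have le1 : \sum_j `|W j| `^ s <= 1 by exact: Hb.
case/andP: si => si0 si1.
rewrite mulr_ile1 ?powR_ge0// powR_le1 ?subr_ge0//; first by apply: sumr_ge0 => j _; exact: powR_ge0.
exact: sumr_ge0.
Qed.

(** The output weight of [row_sums] is removed, with [col_sums] as column bound; s <= 2 says that
    the new exponent s/2 is at most 1. *)
Lemma row_sums2 k : s <= 2 ->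
  \sum_l (\sum_(i : {ffun K -> T} | i k == l) \sum_j sq i j) `^ (s / 2) <= 1.
Proof.
move=> s2; have s0 : 0 < s by exact: lt_le_trans s1.
have := @remove_weight_row R _ _ (fun l j => \sum_(i : {ffun K -> T} | i k == l) sq i j)
  2^-1 (s / 2) (2 - 2 / s).
under [X in _ -> X <= _]eq_bigr do rewrite exchange_big/=.
apply => //.
- by rewrite ler_pdivlMr// mulVf.
- by rewrite ler_pdivrMr// mul1r.
- by rewrite invf_div invrK; lra.
- by move=> l j; apply: sumr_ge0 => i _; exact: sq_ge0.
- by move=> v sv; exact: row_sums.
- apply: le_trans col_sums; rewrite le_eqVlt; apply/orP; left; apply/eqP.
  apply: eq_bigr => j _; congr (_ `^ _).
  by rewrite [RHS](partition_big (fun i : {ffun K -> T} => i k) predT).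
Qed.

(** Minkowski's inequality interchanges the two norms in [col_sums]: the smaller exponent s moves
    inside. *)
Lemma full_sums2 : s <= 2 -> \sum_i (\sum_j sq i j `^ (s / 2)) `^ (2 / s) <= 1.
Proof.
move=> s2; have s0 : 0 < s by exact: lt_le_trans s1.
have := @minkowski_sum R _ _ (fun i j => sq i j `^ (s / 2)) (2 / s)
  (fun i j => powR_ge0 _ _).
rewrite ler_pdivlMr// mul1r => /(_ s2) h; apply: le_trans h _.
apply: powR_le1.
- by rewrite divr_ge0// ltW.
- by apply: sumr_ge0 => j _; exact: powR_ge0.
apply: le_trans col_sums; rewrite le_eqVlt; apply/orP; left; apply/eqP.
apply: eq_bigr => j _; rewrite invf_div; congr (_ `^ _); apply: eq_bigr => i _.
by rewrite -powRrM mulrA mulfVK ?divff ?gt_eqF// powRr1// sq_ge0.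
Qed.

(* Hoelder interpolation between [row_sums2] and [full_sums2]. *)
Lemma interp_sums (Q : R) k : s < 2 -> s <= Q -> Q <= 2 ->
  \sum_l (\sum_(i : {ffun K -> T} | i k == l) (\sum_j sq i j `^ (Q / 2)) `^ (2 / Q))
    `^ (1 + 2 / s - 2 / Q)^-1 <= 1.
Proof.
move=> s_lt2 sQ Q2; have s0 : 0 < s by exact: lt_le_trans s1.
have Q0 : 0 < Q by exact: lt_le_trans sQ.
pose y := (Q - s) / (2 - s).
have d0 : 0 < 2 - s by rewrite subr_gt0.
have y0 : 0 <= y by rewrite divr_ge0 ?subr_ge0// ltW.
have y1 : y <= 1 by rewrite ler_pdivrMr// mul1r lerD2r.
have yD : y * (2 - s) = Q - s by rewrite divfK ?gt_eqF.
clearbody y.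
have y1' : 0 <= 1 - y by rewrite subr_ge0.
have yE : y * 2 + (1 - y) * s = Q by lra.
have [s0' Q0'] : 0 <= s /\ 0 <= Q by rewrite !ltW.
(* Interpolation of the inner norms: 1/Q = th/2 + (1-th)/s. *)
pose th := 2 * y / Q.
have thE : 1 - th = s * (1 - y) / Q.
  rewrite /th -[X in X - _](@divff _ Q) ?gt_eqF// -[X in X / Q - _]yE.
  by field; rewrite gt_eqF.
have th0 : 0 <= th by rewrite divr_ge0 ?mulr_ge0.
have th1 : 0 <= 1 - th by rewrite thE divr_ge0 ?mulr_ge0.
have th01 : 0 <= th <= 1 by rewrite th0 -subr_ge0.
set be := (1 + 2 / s - 2 / Q); set a := be^-1.
have beE : be = (1 - th) + th * (2 / s).
  have -> : be = 1 + 2 * (Q - s) / (s * Q) by rewrite /be; field; rewrite !gt_eqF.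
  by rewrite -yD /th; field; rewrite !gt_eqF.
have be0 : 0 < be.
  have : 0 <= th * (2 / s - 1) by rewrite mulr_ge0// subr_ge0 ler_pdivlMr// mul1r ltW.
  by rewrite beE; lra.
have thy : th = y * (2 / Q) by rewrite /th; ring.
clearbody th.
pose W i := \sum_j sq i j; pose U i := (\sum_j sq i j `^ (s / 2)) `^ (2 / s).
have W0 i : 0 <= W i by apply: sumr_ge0 => j _; exact: sq_ge0.
have U0 i : 0 <= U i by exact: powR_ge0.
have hle i : (\sum_j sq i j `^ (Q / 2)) `^ (2 / Q) <= W i `^ th * U i `^ (1 - th).
  have -> : W i `^ th * U i `^ (1 - th) =
     (W i `^ y * (\sum_j sq i j `^ (s / 2)) `^ (1 - y)) `^ (2 / Q).
    rewrite [in RHS]powRM; [|exact: powR_ge0|exact: powR_ge0].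
    have -> : (W i `^ y) `^ (2 / Q) = W i `^ th by rewrite -powRrM -thy.
    suff E : 2 / s * (1 - th) = (1 - y) * (2 / Q) by rewrite /U -!powRrM E.
    by rewrite thE; field; rewrite !gt_eqF.
  apply: le_powR; first by rewrite divr_ge0// ltW.
    by apply: sumr_ge0 => j _; exact: powR_ge0.
  apply: le_trans (hoelder_sum _ _ _ _); rewrite ?y0//; last 2 first.
  - by move=> j; exact: sq_ge0.
  - by move=> j; exact: powR_ge0.
  apply: ler_sum => j _; have [->|sn0] := eqVneq (sq i j) 0.
    rewrite [leLHS]powR0 ?mulr_ge0 ?powR_ge0// gt_eqF// divr_gt0//.
  rewrite -powRrM -powRD ?sn0 ?implybT//.
  suff -> : Q / 2 = y + s / 2 * (1 - y) by [].
  by rewrite -yE; field.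
have a0 : 0 < a by rewrite invr_gt0.
pose A l := \sum_(i : {ffun K -> T} | i k == l) U i.
pose B l := \sum_(i : {ffun K -> T} | i k == l) W i.
have A0 l : 0 <= A l by exact: sumr_ge0.
have B0 l : 0 <= B l by exact: sumr_ge0.
have HA : \sum_l A l <= 1.
  apply: le_trans (full_sums2 (ltW s_lt2)).
  by rewrite [leRHS](partition_big (fun i : {ffun K -> T} => i k) predT).
have HB : \sum_l B l `^ (s / 2) <= 1 by exact: row_sums2 (ltW s_lt2).
(* Interpolation of the outer exponents: 1/a = th (2/s) + (1-th), between s/2 for B and 1 for A.
   Young's inequality needs the resulting shares [tau] and (1-th) a to add up to 1. *)
pose tau := th * a * (2 / s).
have tauE : 1 - tau = (1 - th) * a.
  have : be * a = 1 by rewrite divff// gt_eqF.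
  by rewrite beE /tau; lra.
have tau0 : 0 <= tau by rewrite mulr_ge0 ?divr_ge0 ?mulr_ge0// ltW.
have tau1 : 0 <= 1 - tau by rewrite tauE mulr_ge0// ltW.
apply: (@le_trans _ _ (\sum_l (tau * B l `^ (s / 2) + (1 - tau) * A l))).
  apply: ler_sum => l _.
  have tau01 : 0 <= tau <= 1 by rewrite tau0 -subr_ge0.
  apply: le_trans (powR_young (powR_ge0 _ _) (A0 l) tau01).
  have -> : (B l `^ (s / 2)) `^ tau * A l `^ (1 - tau) = (B l `^ th * A l `^ (1 - th)) `^ a.
    have E : s / 2 * tau = th * a by rewrite /tau; field; rewrite gt_eqF.
    rewrite [in RHS]powRM; [|exact: powR_ge0|exact: powR_ge0].
    by rewrite -!powRrM tauE E.
  apply: le_powR; first exact: ltW.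
    by apply: sumr_ge0 => i _; exact: powR_ge0.
  apply: le_trans (hoelder_sum _ _ _ th01) => //.
  by apply: ler_sum => i _.
rewrite big_split/= -!mulr_sumr.
have e1 : tau * (\sum_l B l `^ (s / 2)) <= tau by rewrite ler_piMr.
have e2 : (1 - tau) * (\sum_l A l) <= 1 - tau by rewrite ler_piMr.
by apply: le_trans (lerD e1 e2) _; rewrite addrC subrK.
Qed.

Lemma full_sums_large : 2 <= s -> \sum_i ((\sum_j sq i j `^ (s / 2)) `^ (2 / s)) `^ (s / 2) <= 1.
Proof.
move=> s2; have s0 : 0 < s by exact: lt_le_trans s1.
apply: le_trans col_sums.
have -> : \sum_i ((\sum_j sq i j `^ (s / 2)) `^ (2 / s)) `^ (s / 2) =
    \sum_i \sum_j sq i j `^ (s / 2).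
  apply: eq_bigr => i _; rewrite -powRrM mulrA mulfVK ?gt_eqF// divff// powRr1//.
  by apply: sumr_ge0 => j _; exact: powR_ge0.
rewrite exchange_big/=; apply: ler_sum => j _; apply: sum_powR_le.
  by move=> i; exact: sq_ge0.
by rewrite ler_pdivlMr// mul1r.
Qed.

End Start.

(** * The upper bound for finite real arrays *)

Section FiniteUpper.
Context {R : realType} (K T J : finType).
Variables (a : {ffun K -> T} -> J -> R) (s : R) (pi : K -> R).
Hypothesis s1 : 1 <= s.
Hypothesis pi0 : forall k, 0 <= pi k.
Hypothesis Ha : forall (w : K -> T -> R) (sg : K -> T -> bool),
  (forall k, simplex (w k)) ->
  \sum_j `|\sum_i a i j * \prod_k ((-1) ^+ sg k (i k) * w k (i k) `^ pi k)| `^ s <= 1.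

Let wt (w : K -> T -> R) (i : {ffun K -> T}) := \prod_k w k (i k) `^ pi k.
Let b w i j := a i j * wt w i.
Let ex k := 2 * pi k.

Let Hb w : (forall k, simplex (w k)) -> forall sg : K -> T -> bool,
  \sum_j `|\sum_i b w i j * \prod_k (-1) ^+ sg k (i k)| `^ s <= 1.
Proof.
move=> sw sg; apply: le_trans (Ha sg sw).
rewrite le_eqVlt; apply/orP; left; apply/eqP; apply: eq_bigr => j _.
congr (`|_| `^ _); apply: eq_bigr => i _.
by rewrite big_split/= /b mulrAC -mulrA.
Qed.

Let sq_weight w i j : sq (b w) i j = sq a i j * weight ex finset.set0 w i.
Proof.
rewrite /sq /b mulrAC exprMn; congr (_ * _).
rewrite /wt -prodrXl; apply: eq_big => [k|k _]; first by rewrite inE.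
by rewrite -powR_mulrn ?powR_ge0// -powRrM mulrC.
Qed.

(** The square of an l_Q norm over the outputs, so that it scales with the weights exactly as [sq]
    does. *)
Definition coef_size (Q : R) (i : {ffun K -> T}) : R :=
  (\sum_j sq a i j `^ (Q / 2)) `^ (2 / Q).

Let coef_size_weight Q w i : 0 < Q ->
  (\sum_j sq (b w) i j `^ (Q / 2)) `^ (2 / Q) =
  coef_size Q i * weight ex finset.set0 w i.
Proof.
move=> Q0; under eq_bigr do rewrite sq_weight powRM ?sq_ge0 ?weight_ge0//.
rewrite -mulr_suml powRM ?powR_ge0//; last first.
  by apply: sumr_ge0 => j _; exact: powR_ge0.
rewrite -[X in _ * X]powRrM mulrA mulfVK ?gt_eqF// divff// ?gt_eqF// .
by rewrite powRr1// weight_ge0.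
Qed.

Lemma finite_upper (Q rho : R) : (0 < #|K|)%N ->
  (s < 2 /\ s <= Q <= 2) \/ (2 <= s /\ Q = s) -> 0 < rho ->
  let be := 2^-1 + s^-1 - (Num.min Q 2)^-1 - \sum_k pi k in
  0 < be -> #|K|%:R / rho <= be + (#|K|%:R - 1) * Num.min 2^-1 be ->
  \sum_i (\sum_j `|a i j / kh_cst K| `^ Q) `^ (rho / Q) <= 1.
Proof.
move=> K0 sQ rho0 be be0 hrho.
have s0 : 0 < s by exact: lt_le_trans s1.
have Q0 : 0 < Q by case: sQ => [[_ /andP[sQ _]]|[_ ->//]]; exact: lt_le_trans sQ.
(* The reciprocal exponent, for squared coefficients, before any weight is removed: that of
   [interp_sums] if s < 2, and 2/s if s >= 2. *)
pose B := 1 + 2 / s - 2 / Num.min Q 2.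
have BE : B - \sum_k ex k = 2 * be by rewrite -mulr_sumr /B /be; lra.
have := @chain_blei R K T (coef_size Q) ex (fun i => powR_ge0 _ _) _ B (rho / 2) K0.
rewrite BE => h.
have -> : \sum_i (\sum_j `|a i j / kh_cst K| `^ Q) `^ (rho / Q) =
    \sum_i coef_size Q i `^ (rho / 2).
  apply: eq_bigr => i _; rewrite /coef_size -powRrM; congr (_ `^ _).
    apply: eq_bigr => j _; rewrite /sq -[in RHS]real_normK ?num_real//.
    by rewrite -powR_mulrn// -powRrM mulrCA divff// mulr1.
  by field; rewrite gt_eqF.
apply: h.
- by move=> k; rewrite mulr_ge0.
- case: sQ => [[s2 /andP[sQ Q2]] _ w sw k|[s2 QE] B1 w sw k].
    have := interp_sums s1 (Hb sw) k s2 sQ Q2.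
    rewrite /B (min_idPl Q2); under eq_bigr do under eq_bigr do rewrite coef_size_weight//.
    by [].
  (* For s >= 2 one has B = 2/s <= 1, so B >= 1 forces s = 2; at exponent 1 the mixed sum is the
     full sum. *)
  have BE1 : B = 1.
    apply/eqP; rewrite eq_le B1 andbT /B (min_idPr _) ?QE// -addrA gerDl subr_le0.
    by rewrite divff// ler_pdivrMr// mul1r.
  have s2' : s = 2.
    by move: BE1; rewrite /B (min_idPr _) ?QE// => E; apply: invr_inj; lra.
  have := full_sums_large s1 (Hb sw) s2.
  rewrite BE1 invr1 s2' divff// => h.
  apply: le_trans h.
  rewrite [leRHS](partition_big (fun i : {ffun K -> T} => i k) predT)//=.
  apply: ler_sum => l _; rewrite powRr1; last first.
    by apply: sumr_ge0 => i _; rewrite mulr_ge0 ?powR_ge0 ?weight_ge0.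
  apply: ler_sum => i _.
  by rewrite -coef_size_weight// QE s2' divff// [leRHS]powRr1 ?powR_ge0.
- case: sQ => [[s2 /andP[sQ Q2]] B1|[s2 QE] B1 w sw].
    move: B1; rewrite ltNge /B (min_idPl Q2) -addrA lerDl subr_ge0.
    by rewrite ler_pM2l// lef_pV2 ?posrE// sQ.
  have := full_sums_large s1 (Hb sw) s2.
  rewrite {1}(_ : B^-1 = s / 2); last first.
    by rewrite /B (min_idPr _) ?QE// divff// addrAC subrr add0r invf_div.
  have E i : (\sum_j sq (b w) i j `^ (s / 2)) `^ (2 / s) =
      coef_size Q i * weight ex finset.set0 w i.
    by rewrite -QE; exact: coef_size_weight.
  by under eq_bigr do rewrite E.
- by rewrite mulr_gt0.
- by rewrite divr_gt0.
- rewrite invf_div mulrCA.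
  apply: (@le_trans _ _ (2 * (be + (#|K|%:R - 1) * Num.min 2^-1 be))).
    by rewrite ler_pM2l.
  rewrite mulrDr lerD2l mulrCA le_eqVlt; apply/orP; left; apply/eqP.
  congr (_ * _); rewrite !minEle -(@ler_pM2l _ 2 _ 2^-1)// divff//.
  by case: ifP => // _; rewrite divff.
Qed.

End FiniteUpper.

(** * Scalars and sequence norms *)

Section Scalars.
Context {R : realType} (F : scalar_field).
Local Notation K := (scalars R F).

(** Real scalars get imaginary part 0, so that one argument by parts serves both fields. *)
Definition part (b : bool) : K -> R :=
  match F return scalars R F -> R with
  | RealScalars => fun x => if b then 0 else x
  | ComplexScalars => fun z : R[i] => if b then complex.Im z else complex.Re z
  end.

Definition of_real : R -> K :=
  match F return R -> scalars R F with
  | RealScalars => id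
  | ComplexScalars => fun r => Complex r 0
  end.

Definition conjugate : K -> K :=
  match F return scalars R F -> scalars R F with
  | RealScalars => id
  | ComplexScalars => fun z : R[i] => conjc z
  end.

Definition of_parts (x y : R) : K :=
  match F return scalars R F with
  | RealScalars => x
  | ComplexScalars => Complex x y
  end.

Lemma partD b : {morph part b : x y / x + y}.
Proof.
by rewrite /part; case: F => [x y|[a c] [a' c']]; case: b => //=; rewrite addr0.
Qed.

Lemma part0 b : part b 0 = 0.
Proof. by rewrite /part; case: F; case: b. Qed.

Lemma part_sum b (I : Type) (r : seq I) (P : pred I) (f : I -> K) :
  part b (\sum_(i <- r | P i) f i) = \sum_(i <- r | P i) part b (f i).
Proof. exact: (big_morph _ (partD b) (part0 b)). Qed.

Lemma of_realM : {morph of_real : x y / x * y}.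
Proof.
rewrite /of_real; case: F => //= x y.
by apply/eqP; rewrite eq_complex/= !mulr0 mul0r addr0 subr0 !eqxx.
Qed.

Lemma of_real1 : of_real 1 = 1.
Proof. by rewrite /of_real; case: F. Qed.

Lemma of_real0 : of_real 0 = 0.
Proof. by rewrite /of_real; case: F. Qed.

Lemma of_real_prod (I : Type) (r : seq I) (P : pred I) (f : I -> R) :
  of_real (\prod_(i <- r | P i) f i) = \prod_(i <- r | P i) of_real (f i).
Proof. exact: (big_morph _ of_realM of_real1). Qed.

Lemma part_of_realM b r x : part b (of_real r * x) = r * part b x.
Proof.
rewrite /part /of_real; case: F x => [x|[a c]]; case: b => //=; rewrite ?mulr0//.
  by rewrite mul0r addr0.
by rewrite mul0r subr0.
Qed.

Lemma modulus_ge0 (x : K) : 0 <= modulus x.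
Proof.
move: x; rewrite /modulus; case: F => [x|[a c]] /=; first exact: normr_ge0.
exact: sqrtr_ge0.
Qed.

Lemma modulusM (x y : K) : modulus (x * y) = modulus x * modulus y.
Proof.
move: x y; rewrite /modulus; case: F => [x y|x y]; first exact: normrM.
exact: ComplexField.Normc.normcM.
Qed.

Lemma modulusD (x y : K) : modulus (x + y) <= modulus x + modulus y.
Proof.
move: x y; rewrite /modulus; case: F => [x y|x y]; first exact: ler_normD.
exact: le_normcD.
Qed.

Lemma modulus_of_real r : modulus (of_real r) = `|r|.
Proof.
by rewrite /modulus /of_real; case: F => //=; rewrite expr0n addr0 sqrtr_sqr.
Qed.

Lemma modulus0 : modulus (0 : K) = 0.
Proof. by rewrite -of_real0 modulus_of_real normr0. Qed.

Lemma modulus1 : modulus (1 : K) = 1.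
Proof. by rewrite -of_real1 modulus_of_real normr1. Qed.

Lemma modulus_eq0 (x : K) : modulus x = 0 -> x = 0.
Proof.
move: x; rewrite /modulus; case: F => [x|x]; first by move/eqP; rewrite normr_eq0 => /eqP.
exact: ComplexField.Normc.eq0_normc.
Qed.

Lemma modulus_prod (I : Type) (r : seq I) (P : pred I) (f : I -> K) :
  modulus (\prod_(i <- r | P i) f i) = \prod_(i <- r | P i) modulus (f i).
Proof. exact: (big_morph _ modulusM modulus1). Qed.

Lemma modulus_sum (I : Type) (r : seq I) (P : pred I) (f : I -> K) :
  modulus (\sum_(i <- r | P i) f i) <= \sum_(i <- r | P i) modulus (f i).
Proof.
elim/big_rec2 : _ => [|i y1 y2 _ h]; first by rewrite modulus0.
by apply: le_trans (modulusD _ _) _; rewrite lerD2l.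
Qed.

Lemma part_le_modulus b (x : K) : `|part b x| <= modulus x.
Proof.
move: x; rewrite /modulus /part; case: F => [x|[a c]]; case: b => //=.
- by rewrite normr0.
- rewrite -sqrtr_sqr; apply: ler_wsqrtr.
  by rewrite lerDr sqr_ge0.
- rewrite -sqrtr_sqr; apply: ler_wsqrtr.
  by rewrite lerDl sqr_ge0.
Qed.

Lemma modulus_le_parts (x : K) : modulus x <= `|part false x| + `|part true x|.
Proof.
move: x; rewrite /modulus /part; case: F => [x|[a c]] /=.
  by rewrite normr0 addr0.
rewrite -[leRHS]ger0_norm ?addr_ge0// -sqrtr_sqr; apply: ler_wsqrtr.
rewrite sqrrD !real_normK ?num_real// -addrA lerD2l lerDr mulrn_wge0//.
Qed.

Lemma mulr_conjugate (x : K) : x * conjugate x = of_real (modulus x ^+ 2).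
Proof.
move: x; rewrite /modulus /conjugate /of_real; case: F => [x|[a c]] /=.
  by rewrite real_normK ?num_real// expr2.
rewrite sqr_sqrtr ?addr_ge0 ?sqr_ge0//.
apply/eqP; rewrite eq_complex/=; apply/andP; split; apply/eqP; ring.
Qed.

Lemma modulus_conjugate (x : K) : modulus (conjugate x) = modulus x.
Proof.
move: x; rewrite /modulus /conjugate; case: F => [x|[a c]] //=.
by rewrite sqrrN.
Qed.

Lemma part_of_parts b x y : `|part b (of_parts x y)| <= if b then `|y| else `|x|.
Proof. by rewrite /part /of_parts; case: F; case: b => /=; rewrite ?normr0. Qed.

Lemma partN b (x : K) : part b (- x) = - part b x.
Proof. by move: x; rewrite /part; case: F => [x|[a c]]; case: b => //=; rewrite oppr0. Qed.

End Scalars.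

Section Lnorms.
Context {R : realType} (F : scalar_field).
Local Notation K := (scalars R F).
Implicit Types (x : nat -> K) (p : \bar R).

(** The bound M on the norm, read off the first n coordinates without limits or extended reals; the
    default case is meant for p = +oo. *)
Definition lnorm_bound p x (M : R) (n : nat) : Prop :=
  match p with
  | r%:E => \sum_(i < n) modulus (x i) `^ r <= M `^ r
  | _ => forall i : nat, (i < n)%N -> modulus (x i) <= M
  end.

Lemma lnorm_leP p x (M : R) : (1 <= p)%E -> 0 <= M ->
  (lnorm p x <= M%:E)%E <-> forall n, lnorm_bound p x M n.
Proof.
case: p => [r||] //= p1 M0.
  have r0 : 0 < r by rewrite lee_fin in p1; exact: lt_le_trans p1.
  rewrite /lnorm Lnorm_counting//.
  under eq_eseriesr => k _ do rewrite /= ger0_norm ?modulus_ge0//.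
  set S := (\sum_(k <oo) _)%E.
  have S0 : (0 <= S)%E by apply: nneseries_ge0 => n _ _; rewrite lee_fin powR_ge0.
  have -> : (S `^ r^-1 <= M%:E)%E = (S <= (M `^ r)%:E)%E.
    apply/idP/idP => h.
      have := @gt0_ler_poweR _ r (ltW r0) (S `^ r^-1)%E M%:E.
      rewrite !in_itv/= !leey !andbT poweR_ge0 lee_fin M0 => /(_ isT isT h).
      by rewrite -poweRrM mulVf ?gt_eqF// poweRe1// poweR_EFin.
    have ri : 0 <= r^-1 by rewrite invr_ge0 ltW.
    have := @gt0_ler_poweR _ r^-1 ri S (M `^ r)%:E.
    rewrite !in_itv/= !leey !andbT S0 lee_fin powR_ge0 => /(_ isT isT h).
    by rewrite -powRrM divff ?gt_eqF// powRr1.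
  split=> [h n|h].
    rewrite -lee_fin; apply: le_trans h.
    apply: le_trans (nneseries_lim_ge n _); last by move=> k _; rewrite lee_fin powR_ge0.
    by rewrite big_mkord sumEFin.
  apply: lime_le.
    by apply: is_cvg_nneseries => n _ _; rewrite lee_fin powR_ge0.
  by apply: nearW => n; rewrite big_mkord sumEFin lee_fin; exact: h.
rewrite /lnorm unlock.
have -> : (0 < (@counting nat R) setT)%E = true.
  by rewrite /counting asboolF ?ltry//; exact: infinite_nat.
(* A set of counting measure zero is empty, so a bound almost everywhere is a bound everywhere. *)
split=> [/ess_sup_inf.ess_supP h n i _|h].
  case: h => A [mA A0 /(_ i)] /= Ai; rewrite leNgt; apply/negP => Mi.
  have : A i by apply: Ai; rewrite ger0_norm ?modulus_ge0// lee_fin; apply/negP; rewrite -ltNge.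
  move: A0; rewrite /= /counting; case: ifPn => [/asboolP fA|//].
  move=> [/eqP]; rewrite pnatr_eq0 finmap.cardfs_eq0 => /eqP A0 iA.
  by move: (fset_set_set0 fA A0) iA => ->.
apply/ess_sup_inf.ess_supP; apply: aeW => i /=.
by rewrite ger0_norm ?modulus_ge0// lee_fin (h i.+1).
Qed.

End Lnorms.

Section FiniteSupport.
Context {R : realType} (F : scalar_field).
Local Notation K := (scalars R F).
Implicit Types (x y u v : nat -> K) (p : \bar R).

Definition supp_lt N x := forall n : nat, (N <= n)%N -> x n = 0.

Lemma lnorm_bound_supp p x (M : R) N n : (1 <= p)%E -> 0 <= M -> supp_lt N x ->
  lnorm_bound p x M N -> lnorm_bound p x M n.
Proof.
move=> p1 M0 xN; case: p p1 => [r||] //= p1.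
  have r0 : 0 < r by rewrite lee_fin in p1; exact: lt_le_trans p1.
  move=> h; apply: le_trans h.
  have mono a b : (a <= b)%N -> \sum_(i < a) modulus (x i) `^ r <= \sum_(i < b) modulus (x i) `^ r.
    move=> ab; rewrite -!(big_mkord xpredT (fun i => modulus (x i) `^ r)).
    rewrite (big_cat_nat (leq0n _) ab)//= lerDl; apply: sumr_ge0 => i _; exact: powR_ge0.
  have [nN|Nn] := leqP n N; first exact: mono.
  rewrite -!(big_mkord xpredT (fun i => modulus (x i) `^ r)).
  rewrite (big_cat_nat (leq0n _) (ltnW Nn))//= [X in _ + X](_ : _ = 0) ?addr0//.
  rewrite big_nat big1// => i /andP[Ni _].
  by rewrite xN// modulus0 powR0 ?gt_eqF.
move=> h i _; have [Ni|iN] := leqP N i; last exact: h.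
by rewrite xN// modulus0.
Qed.

Lemma lnorm_supp_le p x (M : R) N : (1 <= p)%E -> 0 <= M -> supp_lt N x ->
  lnorm_bound p x M N -> (lnorm p x <= M%:E)%E.
Proof.
move=> p1 M0 xN h; apply/lnorm_leP => // n.
exact: lnorm_bound_supp xN h.
Qed.

Lemma supp_seq_space p x N : (1 <= p)%E -> supp_lt N x -> seq_space p x.
Proof.
move=> p1 xN; have : (lnorm p x < +oo)%E.
  pose M := \sum_(i < N) modulus (x i).
  have M0 : 0 <= M by apply: sumr_ge0 => i _; exact: modulus_ge0.
  apply: (@le_lt_trans _ _ M%:E); last exact: ltry.
  apply: (lnorm_supp_le p1 M0 xN); case: p p1 => [r||] //= p1.
    by apply: sum_powR_le => // i; exact: modulus_ge0.
  move=> i iN; apply: (@sumr_ge_term _ _ predT (fun i : 'I_N => modulus (x i)) (Ordinal iN)) => // j.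
  exact: modulus_ge0.
rewrite /seq_space; case: p p1 => //= _ _.
apply: cvg_near_cst; exists N => // n /= Nn.
by rewrite xN// modulus0.
Qed.

Lemma lnorm_lim_le (q : \bar R) (Q M : R) x : 0 < Q -> (1 <= q)%E -> (Q%:E <= q)%E -> 0 <= M ->
  (forall n, \sum_(i < n) modulus (x i) `^ Q <= M `^ Q) -> (lnorm q x <= M%:E)%E.
Proof.
move=> Q0 q1 Qq M0 h; apply/lnorm_leP => // n.
case: q q1 Qq => [r||] //= q1 Qq.
  have QE : r = Q * (r / Q) by field; rewrite gt_eqF.
  have rQ : 1 <= r / Q by rewrite ler_pdivlMr// mul1r -lee_fin.
  rewrite QE; under eq_bigr do rewrite powRrM.
  apply: (@le_trans _ _ ((\sum_(i < n) modulus (x i) `^ Q) `^ (r / Q))).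
    by apply: sum_powR_le => // i; exact: powR_ge0.
  rewrite [M `^ _]powRrM; apply: le_powR (h n); first by rewrite (le_trans _ rQ).
  by apply: sumr_ge0 => i _; exact: powR_ge0.
move=> i ltin; rewrite leNgt; apply/negP => Mx.
have := h i.+1; rewrite big_ord_recr/=; apply/negP; rewrite -ltNge.
apply: (@lt_le_trans _ _ (modulus (x i) `^ Q)).
  by apply: gt0_ltr_powR; rewrite ?nnegrE ?modulus_ge0.
by rewrite lerDr; apply: sumr_ge0 => j _; exact: powR_ge0.
Qed.

Lemma seq_space_lty p x : p != +oo%E -> seq_space p x -> (lnorm p x < +oo)%E.
Proof. by case: p. Qed.

Definition truncate N x : nat -> K := fun n => if (n < N)%N then x n else 0.

(** One coordinate is added in the shape a u + v that [multilinear_on] expects. *)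
Lemma truncateS N x : truncate N.+1 x =
  (fun n => x N * unit_seq F N n + truncate N x n).
Proof.
apply/funext => n; rewrite /truncate /unit_seq ltnS leq_eqVlt.
have [->|nN] /= := eqVneq n N; first by rewrite ltnn addr0 mulr1.
by rewrite mulr0 add0r.
Qed.

Lemma truncate_supp N x : supp_lt N x -> truncate N x = x.
Proof.
move=> xN; apply/funext => n; rewrite /truncate; case: ltnP => // Nn.
by rewrite xN.
Qed.

Lemma supp_truncate N n x : supp_lt N x -> supp_lt N (truncate n x).
Proof. by move=> xN k Nk; rewrite /truncate xN//; case: ifP. Qed.

Lemma supp_unit N n : (n < N)%N -> supp_lt N (unit_seq F n : nat -> K).
Proof. by move=> nN k Nk; rewrite /unit_seq gtn_eqF//; exact: leq_trans Nk. Qed.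

End FiniteSupport.

(** * Expansion of a multilinear operator in unit vectors *)

Section Expansion.
Context {R : realType} (F : scalar_field) (m : nat).
Local Notation K := (scalars R F).
Variables (p : 'I_m -> \bar R) (A : ('I_m -> nat -> K) -> (nat -> K)).
Hypothesis p1 : forall j, (1 <= p j)%E.
Hypothesis multiA : multilinear_on p A.
Implicit Types (x y : 'I_m -> nat -> K).

Lemma dfwithE x (j k : 'I_m) (u : nat -> K) :
  dfwith x j u k = if k == j then u else x k.
Proof.
have [->|kj] := eqVneq k j; first by rewrite dfwithin.
by rewrite dfwithout// eq_sym.
Qed.

Lemma dfwith_id x j : dfwith x j (x j) = x.
Proof. by apply/funext => k; rewrite dfwithE; case: eqP => // ->. Qed.

Variable N : nat.

Definition expansion x n : K :=
  \sum_(i : {ffun 'I_m -> 'I_N}) (\prod_k x k (i k)) * A (fun k => unit_seq F (i k)) n.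

Lemma expansion_linear x j a (u v : nat -> K) n :
  expansion (dfwith x j (fun n => a * u n + v n)) n =
  a * expansion (dfwith x j u) n + expansion (dfwith x j v) n.
Proof.
rewrite /expansion mulr_sumr -big_split/=; apply: eq_bigr => i _.
have E (w : nat -> K) : \prod_k dfwith x j w k (i k) = w (i j) * \prod_(k | k != j) x k (i k).
  rewrite (bigD1 j)//= dfwithE eqxx; congr (_ * _).
  by apply: eq_bigr => k /negbTE kj; rewrite dfwithE kj.
by rewrite !E; ring.
Qed.

Lemma expansion_unit (i : {ffun 'I_m -> 'I_N}) n :
  expansion (fun k => unit_seq F (i k)) n = A (fun k => unit_seq F (i k)) n.
Proof.
rewrite /expansion (bigD1 i)//= [X in X + _](_ : _ = A (fun k => unit_seq F (i k)) n).
  rewrite big1 ?addr0// => i' i'i.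
  have [k ik] : exists k, i' k != i k.
    apply/existsP; apply: contraNT i'i; rewrite negb_exists => /forallP h.
    by apply/eqP/ffunP => k; have := h k; rewrite negbK => /eqP.
  by rewrite (bigD1 k)//= /unit_seq val_eqE (negbTE ik) !mul0r.
by rewrite big1 ?mul1r// => k _; rewrite /unit_seq eqxx.
Qed.

(** The difference D of the two sides is linear in each variable and vanishes on unit vectors. The
    induction is on the number of slots not known to hold a unit vector, and within a slot on the
    length of the truncation. *)
Lemma multilinear_expansion x n : (forall k, supp_lt N (x k)) -> A x n = expansion x n.
Proof.
pose D y := A y n - expansion y n.
have prodsp y : (forall k, supp_lt N (y k)) -> prod_space p y.
  by move=> yN k; exact: supp_seq_space (yN k).
have suppdf y j u : (forall k, supp_lt N (y k)) -> supp_lt N u ->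
    forall k, supp_lt N (dfwith y j u k).
  by move=> yN uN k; rewrite dfwithE; case: eqP.
have Dlin y j a (u v : nat -> K) : (forall k, supp_lt N (y k)) -> supp_lt N u -> supp_lt N v ->
    D (dfwith y j (fun n => a * u n + v n)) = a * D (dfwith y j u) + D (dfwith y j v).
  move=> yN uN vN; rewrite /D multiA ?expansion_linear; last 3 first.
  - exact: prodsp.
  - exact: supp_seq_space uN.
  - exact: supp_seq_space vN.
  by ring.
suff D0 : forall (S : {set 'I_m}) y, (forall k, supp_lt N (y k)) ->
    (forall k, k \notin S -> exists i : 'I_N, y k = unit_seq F i) -> D y = 0.
  move=> xN; apply/eqP; rewrite -subr_eq0; apply/eqP.
  by apply: (D0 (finset.setTfor 'I_m)) => // k; rewrite inE.
move=> S; have [c] := ubnP #|S|; elim: c S => // c IH S Sc y yN yS.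
have [S0|[j jS]] := finset.set_0Vmem S.
  have /fin_all_exists[i iE] : forall k, exists i : 'I_N, y k = unit_seq F i.
    by move=> k; apply: yS; rewrite S0 inE.
  have -> : y = fun k => unit_seq F ([ffun k => i k] k).
    by apply/funext => k; rewrite ffunE.
  by rewrite /D expansion_unit subrr.
have Sj : (#|S :\ j| < c)%N by rewrite (finset.cardsD1 j S) jS ltnS in Sc.
have D00 : D (dfwith y j (fun=> 0)) = 0.
  have := Dlin y j 1 (fun=> 0) (fun=> 0) yN (fun _ _ => erefl) (fun _ _ => erefl).
  rewrite /= mulr0 addr0.
  by move=> /eqP; rewrite mul1r -subr_eq subrr eq_sym => /eqP.
have -> : y = dfwith y j (truncate N (y j)) by rewrite truncate_supp ?dfwith_id.
have : (N <= N)%N by [].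
(* Only the truncation length is generalised; the bound N on the supports stays, and M < N makes M
   an index in 'I_N. *)
move: {1 3}N => M; elim: M => [|M IHM] MN.
  by rewrite -[RHS]D00; congr (D (dfwith _ _ _)).
rewrite truncateS Dlin//; last 2 first.
- exact: supp_unit.
- exact: supp_truncate.
rewrite IHM ?(ltnW MN)// addr0 (IH _ Sj) ?mulr0//.
  by apply: suppdf => //; exact: supp_unit.
move=> k; rewrite !inE negb_and negbK dfwithE => /orP[kj|kS].
  by rewrite kj; exists (Ordinal MN).
by case: eqP => _; [exists (Ordinal MN)|exact: yS].
Qed.

End Expansion.

(** * The upper bound *)

Section InvExp.
Context {R : realType}.
Implicit Types (p : \bar R).

Lemma inv_exp_fin (r : R) : 1 <= r -> inv_exp r%:E = r^-1.
Proof. by move=> r1; rewrite /inv_exp inver gt_eqF// (lt_le_trans _ r1). Qed.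

Lemma inv_exp_pinfty : inv_exp +oo%E = 0 :> R.
Proof. by rewrite /inv_exp invey. Qed.

Lemma inv_exp_ge0 p : (1 <= p)%E -> 0 <= inv_exp p.
Proof.
case: p => [r|_|//]; last by rewrite inv_exp_pinfty.
rewrite lee_fin => r1; rewrite inv_exp_fin// invr_ge0; exact: le_trans r1.
Qed.

Lemma powR_add_le (x y t : R) : 0 <= x -> 0 <= y -> 0 <= t ->
  (x + y) `^ t <= 2 `^ t * (x `^ t + y `^ t).
Proof.
move=> x0 y0 t0.
wlog xy : x y x0 y0 / x <= y => [h|].
  have [xy|yx] := leP x y; first exact: h.
  by rewrite addrC [X in _ <= _ * X]addrC; apply: h => //; exact: ltW.
apply: (@le_trans _ _ ((2 * y) `^ t)).
  by apply: le_powR => //; [exact: addr_ge0|lra].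
rewrite powRM// ler_wpM2l ?powR_ge0// lerDr; exact: powR_ge0.
Qed.

End InvExp.

Section Upper.
Context {R : realType} (F : scalar_field) (m : nat).
Local Notation K := (scalars R F).
Variables (p : 'I_m -> \bar R) (A : ('I_m -> nat -> K) -> (nat -> K)) (s : R).
Hypothesis p1 : forall j, (1 <= p j)%E.
Hypothesis s1 : 1 <= s.
Hypothesis multiA : multilinear_on p A.

Definition entry N (i : {ffun 'I_m -> 'I_N}) : nat -> K :=
  A (fun k => unit_seq F (i k)).

Lemma signed_root_ball N (pk : \bar R) (w : 'I_N -> R) (sg : 'I_N -> bool) :
  (1 <= pk)%E -> simplex w ->
  let x : nat -> K := fun n => oapp (fun i : 'I_N =>
    of_real F ((-1) ^+ sg i * w i `^ inv_exp pk)) 0 (insub n) in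
  supp_lt N x /\ (lnorm pk x <= 1)%E.
Proof.
move=> pk1 [w0 w1] x.
have xN : supp_lt N x by move=> n Nn; rewrite /x insubF// ltnNge Nn.
have xi (i : 'I_N) : modulus (x i) = w i `^ inv_exp pk.
  by rewrite /x valK/= modulus_of_real normrM normr_sign mul1r ger0_norm ?powR_ge0.
split=> //; apply: (lnorm_supp_le pk1 ler01 xN).
clearbody x; case: pk pk1 xi => [r||] //= pk1 xi.
  rewrite lee_fin in pk1; have r0 : 0 < r by exact: lt_le_trans pk1.
  under eq_bigr do rewrite xi inv_exp_fin// -powRrM mulVf ?gt_eqF// powRr1//.
  by rewrite powR1.
move=> i iN; have := xi (Ordinal iN); rewrite /= => ->.
by rewrite inv_exp_pinfty powRr0.
Qed.

(** The test vectors are real, so taking parts commutes with the expansion of A; complex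
    coefficients are thereby reduced to real arrays. *)
Lemma array_ball (b : bool) N J (M : R) : 0 < M -> (opnorm p s%:E A <= M%:E)%E ->
  forall (w : 'I_m -> 'I_N -> R) (sg : 'I_m -> 'I_N -> bool),
  (forall k, simplex (w k)) ->
  \sum_(j < J) `|\sum_(i : {ffun 'I_m -> 'I_N}) part b (entry i j) / M *
    \prod_k ((-1) ^+ sg k (i k) * w k (i k) `^ inv_exp (p k))| `^ s <= 1.
Proof.
move=> M0 AM w sg sw.
pose x k : nat -> K := fun n => oapp (fun i : 'I_N =>
    of_real F ((-1) ^+ sg k i * w k i `^ inv_exp (p k))) 0 (insub n).
have xb k : supp_lt N (x k) /\ (lnorm (p k) (x k) <= 1)%E.
  exact: signed_root_ball.
have Ax : (lnorm s%:E (A x) <= M%:E)%E.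
  apply: le_trans AM; apply: ereal_sup_ubound; exists x => //; split.
    by move=> k; apply: supp_seq_space (xb k).1.
  by move=> k; exact: (xb k).2.
have s1E : (1 <= s%:E)%E by rewrite lee_fin.
have /= h := (lnorm_leP (A x) s1E (ltW M0)).1 Ax J.
have s0 : 0 < s by exact: lt_le_trans s1.
apply: (@le_trans _ _ (\sum_(j < J) modulus (A x j) `^ s / M `^ s)); last first.
  by rewrite -mulr_suml ler_pdivrMr ?powR_gt0// mul1r.
apply: ler_sum => j _.
rewrite -powRV ?(ltW M0)// -powRM ?modulus_ge0 ?invr_ge0 ?(ltW M0)//.
apply: le_powR => //; first exact: ltW.
have -> : \sum_(i : {ffun 'I_m -> 'I_N}) part b (entry i j) / M *
    \prod_k ((-1) ^+ sg k (i k) * w k (i k) `^ inv_exp (p k)) = part b (A x j) / M.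
  rewrite (multilinear_expansion p1 multiA (N := N)) => [|k]; last exact: (xb k).1.
  rewrite part_sum mulr_suml; apply: eq_bigr => i _.
  have -> : \prod_k x k (i k) =
      of_real F (\prod_k ((-1) ^+ sg k (i k) * w k (i k) `^ inv_exp (p k))).
    by rewrite of_real_prod; apply: eq_bigr => k _; rewrite /x valK.
  by rewrite part_of_realM mulrC mulrA.
rewrite normrM (ger0_norm (_ : 0 <= M^-1)) ?invr_ge0 ?(ltW M0)//.
by rewrite ler_wpM2r ?invr_ge0 ?(ltW M0)// part_le_modulus.
Qed.

Variables (Q rho : R).
Hypothesis m0 : (0 < m)%N.
Hypothesis sQ : (s < 2 /\ s <= Q <= 2) \/ (2 <= s /\ Q = s).
Hypothesis rho0 : 0 < rho.
Let be := 2^-1 + s^-1 - (Num.min Q 2)^-1 - \sum_k inv_exp (p k).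
Hypothesis be0 : 0 < be.
Hypothesis hrho : m%:R / rho <= be + (m%:R - 1) * Num.min 2^-1 be.

(** The three powers of 2 pay for splitting the scalars into parts: twice through [powR_add_le],
    once because two parts are added. *)
Definition upper_cst : R :=
  2 * 2 `^ rho^-1 * 2 `^ Q^-1 * kh_cst 'I_m.

Lemma upper_cst_gt0 : 0 < upper_cst.
Proof. by rewrite !mulr_gt0 ?powR_gt0// kh_cst_gt0. Qed.

Let Q0 : 0 < Q.
Proof.
case: sQ => [[_ /andP[sQ' _]]|[_ ->]]; last exact: lt_le_trans s1.
exact: lt_le_trans (lt_le_trans ltr01 s1) sQ'.
Qed.

Lemma part_sum_bound b N J (M : R) : 0 < M -> (opnorm p s%:E A <= M%:E)%E ->
  \sum_(i : {ffun 'I_m -> 'I_N}) (\sum_(j < J) `|part b (entry i j)| `^ Q) `^ (rho / Q)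
  <= (M * kh_cst 'I_m) `^ rho.
Proof.
move=> M0 AM; have k0 : 0 < kh_cst 'I_m :> R by exact: kh_cst_gt0.
have Mk : 0 < M * kh_cst 'I_m by rewrite mulr_gt0.
have := @finite_upper R _ _ _ _ s (fun k => inv_exp (p k)) s1
  (fun k => inv_exp_ge0 (p1 k)) (@array_ball b N J M M0 AM) Q rho.
rewrite card_ord => /(_ m0 sQ rho0 be0 hrho) h.
rewrite -[leRHS]mulr1 -ler_pdivrMl ?powR_gt0//; apply: le_trans h.
rewrite mulr_sumr le_eqVlt; apply/orP; left; apply/eqP; apply: eq_bigr => i _.
have E : (M * kh_cst 'I_m) `^ rho = ((M * kh_cst 'I_m) `^ Q) `^ (rho / Q).
  by rewrite -powRrM [Q * _]mulrCA divff ?gt_eqF// mulr1.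
have sg0 : 0 <= \sum_(j < J) `|part b (entry i j)| `^ Q.
  by apply: sumr_ge0 => j _; exact: powR_ge0.
rewrite E -powRV ?powR_ge0// -powRM ?invr_ge0 ?powR_ge0//; congr (_ `^ _).
rewrite mulr_sumr; apply: eq_bigr => j _.
rewrite -powRV ?(ltW Mk)// -powRM ?invr_ge0 ?(ltW Mk)//; congr (_ `^ _).
rewrite -mulrA -invfM normrM mulrC; congr (_ * _).
by rewrite ger0_norm// invr_ge0 ltW.
Qed.

Lemma coef_sum_bound N J (M : R) : 0 < M -> (opnorm p s%:E A <= M%:E)%E ->
  \sum_(i : {ffun 'I_m -> 'I_N}) (\sum_(j < J) modulus (entry i j) `^ Q) `^ (rho / Q)
  <= (upper_cst * M) `^ rho.
Proof.
move=> M0 AM; have k0 : 0 < kh_cst 'I_m :> R by exact: kh_cst_gt0.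
pose G b (i : {ffun 'I_m -> 'I_N}) := \sum_(j < J) `|part b (entry i j)| `^ Q.
have G0 b i : 0 <= G b i by apply: sumr_ge0 => j _; exact: powR_ge0.
have rQ : 0 <= rho / Q by rewrite divr_ge0 ?ltW.
have key i : (\sum_(j < J) modulus (entry i j) `^ Q) `^ (rho / Q) <=
    2 `^ rho * 2 `^ (rho / Q) * (G false i `^ (rho / Q) + G true i `^ (rho / Q)).
  apply: (@le_trans _ _ ((2 `^ Q * (G false i + G true i)) `^ (rho / Q))).
    apply: le_powR => //; first by apply: sumr_ge0 => j _; exact: powR_ge0.
    rewrite -big_split/= mulr_sumr; apply: ler_sum => j _.
    apply: le_trans (powR_add_le _ _ _); rewrite ?(ltW Q0)//.
    apply: le_powR; rewrite ?modulus_ge0 ?(ltW Q0)//; exact: modulus_le_parts.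
  rewrite powRM ?powR_ge0 ?addr_ge0// -powRrM.
  have -> : Q * (rho / Q) = rho by rewrite mulrCA divff ?gt_eqF// mulr1.
  rewrite -mulrA ler_wpM2l ?powR_ge0//; exact: powR_add_le.
apply: le_trans (ler_sum _ (fun i _ => key i)) _.
rewrite -mulr_sumr big_split/=.
have h b := @part_sum_bound b N J M M0 AM.
apply: (@le_trans _ _ (2 `^ rho * 2 `^ (rho / Q) * ((M * kh_cst 'I_m) `^ rho + (M * kh_cst 'I_m) `^ rho))).
  by rewrite ler_wpM2l ?mulr_ge0 ?powR_ge0// lerD// h.
have [k0' M0'] : 0 <= kh_cst 'I_m :> R /\ 0 <= M by rewrite !ltW.
rewrite /upper_cst le_eqVlt; apply/orP; left; apply/eqP.
rewrite !powRM ?mulr_ge0 ?powR_ge0// -!powRrM mulVf ?gt_eqF// powRr1//.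
by rewrite (mulrC Q^-1); ring.
Qed.

End Upper.

(** * Exhaustion of the index set by finite boxes *)

Section Boxes.
Context {R : realType} (m : nat).

Definition box_emb N (i : {ffun 'I_m -> 'I_N}) : {ffun 'I_m -> nat} :=
  [ffun k => val (i k)].

Lemma box_emb_inj N : injective (@box_emb N).
Proof.
move=> i i' h; apply/ffunP => k; apply: val_inj.
by have /ffunP/(_ k) := h; rewrite !ffunE.
Qed.

Lemma sum_box N (f : {ffun 'I_m -> nat} -> \bar R) :
  (\sum_(i \in @box_emb N @` setT) f i = \sum_(i : {ffun 'I_m -> 'I_N}) f (box_emb i))%E.
Proof.
rewrite fsbig_image; last by move=> i i' _ _; exact: box_emb_inj.
have -> : [set: {ffun 'I_m -> 'I_N}]%classic = [set` xpredT]%classic.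
  by apply/seteqP; split.
rewrite -(bigfs _ (r := index_enum _))//; first exact: index_enum_uniq.
by move=> i _; rewrite mem_index_enum.
Qed.

Lemma sub_box (X : set {ffun 'I_m -> nat}) : finite_set X ->
  exists N, (X `<=` @box_emb N @` setT)%classic.
Proof.
move=> /finite_seqP[r ->].
exists (\max_(i <- r) \max_k i k).+1 => i /= ir.
have ik k : (i k < (\max_(i <- r) \max_k i k).+1)%N.
  rewrite ltnS; apply: (@leq_trans (\max_k i k)%N).
    exact: (leq_bigmax_cond (F := fun k => i k)).
  by rewrite (big_rem i)//= leq_maxl.
by exists [ffun k => Ordinal (ik k)] => //; apply/ffunP => k; rewrite !ffunE.
Qed.

Lemma esum_box_le (f : {ffun 'I_m -> nat} -> \bar R) M :
  (forall i, 0 <= f i)%E ->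
  (forall N, \sum_(i : {ffun 'I_m -> 'I_N}) f (box_emb i) <= M)%E ->
  (\esum_(i in setT) f i <= M)%E.
Proof.
move=> f0 h; apply: ge_ereal_sup => _ [X [finX _] <-].
have [N XN] := sub_box finX; apply: le_trans (h N); rewrite -sum_box.
apply: lee_fsum_nneg_subset => //.
  exact/finite_image/finite_finset.
by move=> i; rewrite !inE => /XN.
Qed.

Lemma esum_box_ge (f : {ffun 'I_m -> nat} -> \bar R) N :
  (\sum_(i : {ffun 'I_m -> 'I_N}) f (box_emb i) <= \esum_(i in setT) f i)%E.
Proof.
rewrite -sum_box; apply: ereal_sup_ubound.
exists (@box_emb N @` setT)%classic => //; split => //.
exact/finite_image/finite_finset.
Qed.

End Boxes.

Section UpperBound.
Context {R : realType} (F : scalar_field) (m : nat).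
Local Notation K := (scalars R F).
Variables (p : 'I_m -> \bar R) (A : ('I_m -> nat -> K) -> (nat -> K)) (s : R).
Hypothesis p1 : forall j, (1 <= p j)%E.
Hypothesis s1 : 1 <= s.
Hypothesis multiA : multilinear_on p A.
Hypothesis mapsA : maps_into p s%:E A.
Variables (Q rho : R) (q : \bar R).
Hypothesis m0 : (0 < m)%N.
Hypothesis sQ : (s < 2 /\ s <= Q <= 2) \/ (2 <= s /\ Q = s).
Hypothesis Qq : (Q%:E <= q)%E.
Hypothesis rho0 : 0 < rho.
Let be := 2^-1 + s^-1 - (Num.min Q 2)^-1 - \sum_k inv_exp (p k).
Hypothesis be0 : 0 < be.
Hypothesis hrho : m%:R / rho <= be + (m%:R - 1) * Num.min 2^-1 be.

Let sQ' : s <= Q.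
Proof. by case: sQ => [[_ /andP[]]|[_ ->]]. Qed.

Let Q0 : 0 < Q.
Proof. exact: lt_le_trans (lt_le_trans ltr01 s1) sQ'. Qed.

Let q1 : (1 <= q)%E.
Proof. by apply: le_trans Qq; rewrite lee_fin; apply: le_trans sQ'. Qed.

Lemma lnorm_entry_fin (i : 'I_m -> nat) :
  exists2 L : R, 0 <= L & lnorm q (A (fun k => unit_seq F (i k))) = L%:E.
Proof.
set y := A _; have : (lnorm s%:E y < +oo)%E.
  apply: (@seq_space_lty _ _ s%:E) => //; apply: mapsA => k.
  by apply: (supp_seq_space (p1 k) (N := (i k).+1)); exact: supp_unit.
have y0 r : (0 <= lnorm r y)%E by exact: Lnorm_ge0.
move: (y0 s%:E); case E : (lnorm s%:E y) => [L||]// L0 _; rewrite lee_fin in L0.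
have : (lnorm q y <= L%:E)%E.
  apply: (@lnorm_lim_le _ _ q s); rewrite ?(lt_le_trans ltr01)//.
    by apply: le_trans Qq; rewrite lee_fin.
  move=> n; have s1E : (1 <= s%:E)%E by rewrite lee_fin.
  by apply: ((lnorm_leP y s1E L0).1 _ n); rewrite E.
move: (y0 q); case: (lnorm q y) => [L'||]//.
by rewrite lee_fin => L'0 _; exists L'.
Qed.

Lemma coef_norm_le (M : R) : 0 < M -> (opnorm p s%:E A <= M%:E)%E ->
  (coef_norm q rho A <= (upper_cst m Q rho * M)%:E)%E.
Proof.
move=> M0 AM; set C := upper_cst m Q rho.
have C0 : 0 < C by exact: upper_cst_gt0.
pose L (i : {ffun 'I_m -> nat}) := fine (lnorm q (A (fun k => unit_seq F (i k)))).
have LE (i : {ffun 'I_m -> nat}) : lnorm q (A (fun k => unit_seq F (i k))) = (L i)%:E.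
  by have [l l0 E] := lnorm_entry_fin i; rewrite /L E.
have L0 i : 0 <= L i by rewrite /L fine_ge0//; exact: Lnorm_ge0.
have CM0 : 0 < C * M by rewrite mulr_gt0.
have key N : \sum_(i : {ffun 'I_m -> 'I_N}) L (box_emb i) `^ rho <= (C * M) `^ rho.
  set S := \sum_i _; set B := (C * M) `^ rho.
  have B0 : 0 < B by exact: powR_gt0.
  have S0 : 0 <= S by apply: sumr_ge0 => i _; exact: powR_ge0.
  (* For t < 1, t L is smaller than the supremum L of the truncated norms,
     hence is attained by finitely many coordinates. *)
  have step (t : R) : 0 < t < 1 -> t `^ rho * S <= B.
    move=> /andP[t0 t1].
    have HJ (i : {ffun 'I_m -> 'I_N}) : exists J, (t * L (box_emb i)) `^ Q <=
        \sum_(j < J) modulus (entry A i j) `^ Q.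
      apply: contrapT => /forallNP h.
      have h' J : \sum_(j < J) modulus (entry A i j) `^ Q < (t * L (box_emb i)) `^ Q.
        by rewrite ltNge; apply/negP/h.
      have tL : 0 <= t * L (box_emb i) by rewrite mulr_ge0// ltW.
      have := @lnorm_lim_le _ _ q Q _ (entry A i) Q0 q1 Qq tL (fun J => ltW (h' J)).
      have -> : lnorm q (entry A i) = (L (box_emb i))%:E.
        rewrite -LE /entry; congr (lnorm q (A _)).
        by apply/funext => k; rewrite ffunE.
      rewrite lee_fin => h2.
      have Li0 : L (box_emb i) = 0.
        apply/eqP; rewrite eq_le L0 andbT leNgt; apply/negP => Li0.
        by move: h2; rewrite leNgt gtr_pMl// t1.
      (* If the norm is 0, the empty truncation J = 0 already suffices. *)
      by have := h' 0%N; rewrite big_ord0 Li0 mulr0 powR0 ?ltxx// gt_eqF.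
    have /fin_all_exists[J HJ'] := HJ.
    pose J' := \max_i J i.
    apply: le_trans (coef_sum_bound p1 s1 multiA m0 sQ rho0 be0 hrho N J' M0 AM).
    rewrite mulr_sumr; apply: ler_sum => i _.
    rewrite -powRM ?(ltW t0)//.
    have -> : (t * L (box_emb i)) `^ rho = ((t * L (box_emb i)) `^ Q) `^ (rho / Q).
      by rewrite -powRrM [Q * _]mulrCA divff ?gt_eqF// mulr1.
    apply: le_powR; first by rewrite divr_ge0 ?(ltW Q0) ?(ltW rho0).
      exact: powR_ge0.
    apply: le_trans (HJ' i) _.
    have JJ' : (J i <= J')%N by exact: leq_bigmax.
    rewrite -!(big_mkord xpredT (fun j => modulus (entry A i j) `^ Q)).
    rewrite (big_cat_nat (leq0n _) JJ')//= lerDl.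
    by apply: sumr_ge0 => j _; exact: powR_ge0.
  rewrite leNgt; apply/negP => BS.
  have S_gt0 : 0 < S by exact: lt_trans BS.
  (* If B < S, this midpoint of B/S and 1 is an admissible value of t^rho for which t^rho S exceeds
     B. *)
  pose u := (B / S + 1) / 2.
  have BS1 : B / S < 1 by rewrite ltr_pdivrMr// mul1r.
  have BS0 : 0 < B / S by rewrite divr_gt0.
  have u0 : 0 < u by rewrite /u; lra.
  have u1 : u < 1 by rewrite /u; lra.
  have := step (u `^ rho^-1); rewrite powR_gt0//= -powRrM mulVf ?gt_eqF// powRr1 ?(ltW u0)//.
  have -> : u `^ rho^-1 < 1.
    apply: (@lt_le_trans _ _ (1 `^ rho^-1)); last by rewrite powR1.
    by apply: gt0_ltr_powR; rewrite ?invr_gt0 ?nnegrE ?(ltW u0).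
  move=> /(_ isT); rewrite -ler_pdivlMr// => uB.
  by move: uB; rewrite /u; lra.
have h : (\esum_(i in [set: {ffun 'I_m -> nat}])
      (lnorm q (A (fun j => unit_seq F (i j))) `^ rho) <= ((C * M) `^ rho)%:E)%E.
  apply: esum_box_le => [i|N]; first exact: poweR_ge0.
  apply: (@le_trans _ _ (\sum_(i : {ffun 'I_m -> 'I_N}) L (box_emb i) `^ rho)%:E).
    rewrite -sumEFin le_eqVlt; apply/orP; left; apply/eqP.
    by apply: eq_bigr => i _; rewrite LE poweR_EFin.
  by rewrite lee_fin.
rewrite /coef_norm.
have ri : 0 <= rho^-1 by rewrite invr_ge0 ltW.
have E : C * M = ((C * M) `^ rho) `^ rho^-1.
  by rewrite -powRrM divff ?gt_eqF// powRr1// ltW.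
rewrite E -poweR_EFin; apply: gt0_ler_poweR h => //.
  by rewrite in_itv/= leey andbT; apply: esum_ge0 => i _; exact: poweR_ge0.
by rewrite in_itv/= leey andbT lee_fin powR_ge0.
Qed.

(** The norm may vanish while [coef_norm_le] asks for a positive M, so a finite norm is approached
    from above. *)
Lemma coef_norm_opnorm : (coef_norm q rho A <= (upper_cst m Q rho)%:E * opnorm p s%:E A)%E.
Proof.
have C0 : 0 < upper_cst m Q rho by exact: upper_cst_gt0.
have : (0 <= opnorm p s%:E A)%E.
  apply: (@le_trans _ _ (lnorm s%:E (A (fun _ _ => 0)))); first exact: Lnorm_ge0.
  apply: ereal_sup_ubound; exists (fun _ _ => 0) => //; split.
    by move=> k; apply: (supp_seq_space (p1 k) (N := 0%N)).
  move=> k; apply: (@le_trans _ _ 0%E); last by rewrite lee_fin.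
  apply: (lnorm_supp_le (p1 k) (lexx 0) (N := 0%N)) => //.
  case: (p k) (p1 k) => [r||]//= r1; rewrite big_ord0 powR_ge0//.
case E : (opnorm p s%:E A) => [c||]// c0; last first.
  by rewrite gt0_muley ?lte_fin// leey.
apply/lee_addgt0Pr => e e0; rewrite lee_fin in c0.
have e'0 : 0 < e / upper_cst m Q rho by rewrite divr_gt0.
apply: le_trans (@coef_norm_le (c + e / upper_cst m Q rho) _ _) _.
- by rewrite ltr_wpDl.
- by rewrite E lee_fin lerDl ltW.
by rewrite -EFinM -EFinD lee_fin mulrDr mulrCA divff ?mulr1// gt_eqF.
Qed.

End UpperBound.

(** * Random signs *)

Section SignChoice.
Context {R : realType}.

(** For x^2 <= 1/2 use exp y <= 1/(1-y) at x and -x: the sum is at most 2/(1-x^2), hence at most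
    2(1+2x^2). For larger x already |x| <= 2x^2. *)
Lemma expR_cosh_le (x : R) : expR x + expR (- x) <= 2 * expR (2 * x ^+ 2).
Proof.
have [x2|x2] := leP (x ^+ 2) 2^-1.
  have x1 : `|x| < 1.
    rewrite -(@ltr_pXn2r _ 2)// ?nnegrE// expr1n real_normK ?num_real//.
    by apply: le_lt_trans x2 _; rewrite invf_lt1// ltr1n.
  have inv (y : R) : `|y| < 1 -> expR y <= (1 - y)^-1.
    move=> y1; have y0 : 0 < 1 - y.
      by rewrite subr_gt0; apply: le_lt_trans (ler_norm _) y1.
    rewrite -[expR y]invrK -expRN lef_pV2 ?posrE ?expR_gt0//.
    exact: expR_ge1Dx.
  have := inv x x1; have := inv (- x); rewrite normrN opprK => /(_ x1) h1 h2.
  apply: le_trans (lerD h2 h1) _.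
  have [xa xb] : 0 < 1 - x /\ 0 < 1 + x.
    by move: x1; rewrite ltr_norml => /andP[? ?]; split; lra.
  have -> : (1 - x)^-1 + (1 + x)^-1 = 2 * (1 - x ^+ 2)^-1.
    have -> : 1 - x ^+ 2 = (1 - x) * (1 + x) by ring.
    by field; rewrite !gt_eqF.
  rewrite ler_pM2l//; apply: le_trans (expR_ge1Dx _).
  rewrite invf_ple ?posrE; last 2 first.
  - by move: (sqr_ge0 x); lra.
  - by move: (sqr_ge0 x); lra.
  rewrite -div1r ler_pdivrMr; last by move: (sqr_ge0 x); lra.
  have : 0 <= x ^+ 2 * (1 - 2 * x ^+ 2) by rewrite mulr_ge0 ?sqr_ge0//; lra.
  by lra.
have xx : `|x| <= 2 * x ^+ 2.
  have : 2^-1 < `|x|.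
    rewrite -(@ltr_pXn2r _ 2)// ?nnegrE// real_normK ?num_real//.
    by apply: lt_trans x2; rewrite expr2; lra.
  rewrite -[in leRHS]real_normK ?num_real//; set y := `|x|; nra.
have h (y : R) : `|y| = `|x| -> expR y <= expR (2 * x ^+ 2).
  by move=> E; rewrite ler_expR (le_trans _ xx)// -E ler_norm.
by rewrite mulr_natl mulr2n lerD// h// normrN.
Qed.

Lemma avg_expR (I : finType) (c : I -> R) (t : R) : \sum_i c i ^+ 2 <= 1 ->
  avg (fun e : {ffun I -> bool} => expR (t * \sum_i rademacher e i * c i)) <= expR (2 * t ^+ 2).
Proof.
move=> c1; rewrite /avg ler_pdivrMr ?card_signs_gt0//.
have -> : \sum_(e : {ffun I -> bool}) expR (t * \sum_i rademacher e i * c i) =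
    \prod_i \sum_(b : bool) expR (t * ((-1) ^+ b * c i)).
  rewrite bigA_distr_bigA; apply: eq_bigr => e _.
  by rewrite mulr_sumr expR_sum.
have -> : #|{: {ffun I -> bool}}|%:R = \prod_(i : I) 2 :> R.
  by rewrite prodr_const card_ffun card_bool natrX.
have : expR (2 * \sum_i (t * c i) ^+ 2) <= expR (2 * t ^+ 2).
  rewrite ler_expR ler_pM2l//; under eq_bigr do rewrite exprMn.
  by rewrite -mulr_sumr ler_piMr ?sqr_ge0.
have P0 : 0 <= \prod_(i : I) 2 :> R by apply: prodr_ge0 => i _; exact: ler0n.
move=> /(ler_wpM2r P0); apply: le_trans.
rewrite mulr_sumr expR_sum -big_split/=; apply: ler_prod => i _.
have := expR_cosh_le (t * c i); rewrite [X in X <= _ -> _]addrC (mulrC 2 (expR _)) => h.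
rewrite big_bool/= expr1 expr0 mul1r mulN1r mulrN h andbT.
by rewrite addr_ge0 ?expR_ge0.
Qed.

(** Union bound: Z adds the exponentials of t X_v and -t X_v over all v, and its mean is at most 2
    |V| exp(2 t^2) <= exp(3 t^2). Signs with Z at most this value give t |X_v| <= 3 t^2 for all
    v. *)
Lemma sign_choice (I V : finType) (c : V -> I -> R) (t : R) :
  0 < t -> 2 * #|V|%:R <= expR (t ^+ 2) ->
  (forall v, \sum_i c v i ^+ 2 <= 1) ->
  exists e : {ffun I -> bool}, forall v, `|\sum_i rademacher e i * c v i| <= 3 * t.
Proof.
move=> t0 Vt c1; pose X v (e : {ffun I -> bool}) : R := \sum_i rademacher e i * c v i.
pose Z e := \sum_v (expR (t * X v e) + expR (- t * X v e)).
have Zavg : avg Z <= expR (3 * t ^+ 2).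
  rewrite /Z avg_sum.
  apply: (@le_trans _ _ (\sum_(v : V) 2 * expR (2 * t ^+ 2))).
    apply: ler_sum => v _; rewrite avgD mulr_natl mulr2n.
    rewrite lerD ?avg_expR//; apply: le_trans (avg_expR (- t) (c1 v)) _.
    by rewrite sqrrN.
  rewrite sumr_const -[_ *+ _]mulr_natl mulrA (mulrC _ 2).
  have -> : 3 * t ^+ 2 = t ^+ 2 + 2 * t ^+ 2 by ring.
  by rewrite expRD ler_wpM2r ?expR_ge0.
have [e Ze] : exists e, Z e <= expR (3 * t ^+ 2).
  apply: contrapT => /forallNP h.
  have h' e : expR (3 * t ^+ 2) < Z e by rewrite ltNge; apply/negP/h.
  move: Zavg; apply/negP; rewrite -ltNge /avg ltr_pdivlMr ?card_signs_gt0//.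
  rewrite mulr_natr -sumr_const; apply: ltr_sum => //.
  by apply/hasP; exists [ffun=> true] => //; rewrite mem_index_enum.
exists e => v.
have Xv y : (y = X v e \/ y = - X v e) -> y <= 3 * t.
  move=> yE; rewrite -(@ler_pM2l _ t)//.
  have -> : t * (3 * t) = 3 * t ^+ 2 by ring.
  rewrite -ler_expR; apply: le_trans Ze.
  apply: (@le_trans _ _ (expR (t * X v e) + expR (- t * X v e))).
    case: yE => ->; first by rewrite lerDl expR_ge0.
    by rewrite mulrN -mulNr lerDr expR_ge0.
  apply: (@sumr_ge_term _ _ predT (fun v => expR (t * X v e) + expR (- t * X v e))) => // v'.
rewrite ler_norml lerNl; apply/andP; split; apply: Xv; [right|left] => //.
Qed.

End SignChoice.

Section Grid.
Context {R : realType} (F : scalar_field).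
Local Notation K := (scalars R F).

Lemma modulus_sqr (x : K) : modulus x ^+ 2 = part false x ^+ 2 + part true x ^+ 2.
Proof.
move: x; rewrite /modulus /part; case: F => [x|[a c]] /=.
  by rewrite expr0n addr0 real_normK ?num_real.
by rewrite sqr_sqrtr// addr_ge0 ?sqr_ge0.
Qed.

Lemma part_sub_of_parts b (z : K) x y :
  `|part b (z - of_parts F x y)| <= `|part b z - (if b then y else x)|.
Proof.
rewrite partD partN; move: z; rewrite /part /of_parts.
by case: F => [z|z]; case: b => //=; rewrite subr0 normr0.
Qed.

(* Points of the square [-1, 1]^2 with coordinates in (1/N)Z, as signs and
   absolute values. *)
Definition grid N : finType := ((bool * 'I_N.+1) * (bool * 'I_N.+1))%type.

Definition coord N (g : bool * 'I_N.+1) : R := (-1) ^+ g.1 * ((g.2 : nat)%:R / N%:R).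

Definition grid_val N (g : grid N) : K := of_parts F (coord g.1) (coord g.2).

(** Rounding is towards zero, so that rounded vectors stay in the l_2 ball. *)
Lemma coord_approx N (r : R) : (0 < N)%N -> `|r| <= 1 ->
  exists2 g : bool * 'I_N.+1, `|coord g| <= `|r| & `|r - coord g| <= N%:R^-1.
Proof.
move=> N0 r1; have N0' : 0 < N%:R :> R by rewrite ltr0n.
have rN0 : 0 <= `|r| * N%:R by rewrite mulr_ge0.
have /andP[k1 k2] := truncn_itv rN0.
set k := Num.truncn _ in k1 k2.
have kN : (k < N.+1)%N.
  rewrite ltnS -(ler_nat R); apply: le_trans k1 _.
  by rewrite ler_piMl ?ler0n.
have k1' : k%:R / N%:R <= `|r| by rewrite ler_pdivrMr.
exists (r < 0, Ordinal kN); rewrite /coord/=.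
  by rewrite normrM normr_sign mul1r ger0_norm// divr_ge0.
rewrite {1}[r]realEsign ?num_real// -mulrBr normrM normr_sign mul1r.
rewrite ger0_norm ?subr_ge0// lerBlDl.
have -> : k%:R / N%:R + N%:R^-1 = k.+1%:R / N%:R :> R by rewrite -natr1 mulrDl mul1r.
by rewrite ler_pdivlMr// ltW.
Qed.

Lemma grid_approx N (z : K) : (0 < N)%N -> modulus z <= 1 ->
  exists2 g : grid N, modulus (grid_val g) <= modulus z &
    modulus (z - grid_val g) <= 2 / N%:R.
Proof.
move=> N0 z1.
have [g0 g01 g02] := coord_approx N0 (le_trans (part_le_modulus false z) z1).
have [g1 g11 g12] := coord_approx N0 (le_trans (part_le_modulus true z) z1).
exists (g0, g1).
  rewrite -ler_sqr ?nnegrE ?modulus_ge0// !modulus_sqr.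
  have sq (x y : R) : `|x| <= `|y| -> x ^+ 2 <= y ^+ 2 :> R.
    by move=> xy; rewrite -[x ^+ 2]real_normK ?num_real// -[y ^+ 2]real_normK ?num_real// ler_sqr ?nnegrE.
  rewrite lerD// sq// /grid_val; apply: le_trans (part_of_parts _ _ _ _) _ => //=.
apply: le_trans (modulus_le_parts _) _; rewrite mulr_natl mulr2n lerD//.
  exact: le_trans (part_sub_of_parts _ _ _ _) g02.
exact: le_trans (part_sub_of_parts _ _ _ _) g12.
Qed.

End Grid.

(** * Random multilinear forms of small norm on l_2 *)

Section RandomForm.
Context {R : realType} (F : scalar_field).
Local Notation K := (scalars R F).

(** Telescoping: the factors are exchanged one at a time. *)
Lemma modulus_prod_sub (I : finType) (a b : I -> K) (M e : R) :
  1 <= M -> 0 <= e -> (forall k, modulus (a k) <= M) -> (forall k, modulus (b k) <= M) ->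
  (forall k, modulus (a k - b k) <= e) ->
  modulus (\prod_k a k - \prod_k b k) <= #|I|%:R * M ^+ #|I| * e.
Proof.
move=> M1 e0 aM bM ab; have M0 : 0 <= M by exact: le_trans M1.
rewrite -[\prod_k a k]big_enum -[\prod_k b k]big_enum cardE /=; elim: (enum I) => [|k r IH].
  by rewrite !big_nil subrr modulus0 !mul0r.
have Q : modulus (\prod_(j <- r) b j) <= M ^+ size r.
  elim: {IH} r => [|j r IHr]; first by rewrite big_nil modulus1 expr0.
  by rewrite big_cons modulusM exprS ler_pM// modulus_ge0.
rewrite !big_cons /=; set P := \prod_(j <- r) a j in IH *.
set S := \prod_(j <- r) b j in IH Q *; set n := size r in IH Q *.
have -> : a k * P - b k * S = a k * (P - S) + (a k - b k) * S by ring.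
apply: le_trans (modulusD _ _) _; rewrite !modulusM.
apply: (@le_trans _ _ (M * (n%:R * M ^+ n * e) + e * M ^+ n)).
  by rewrite lerD// ler_pM ?modulus_ge0.
have -> : n.+1%:R * M ^+ n.+1 * e = M * (n%:R * M ^+ n * e) + M * (e * M ^+ n).
  by rewrite -natr1 exprS; ring.
by rewrite lerD2l ler_peMl// mulr_ge0// exprn_ge0.
Qed.

Lemma sum_inj_le (I Kx T : finType) (pi : I -> {ffun Kx -> T}) (f : Kx -> T -> R) :
  injective pi -> (forall k l, 0 <= f k l) ->
  \sum_i \prod_k f k (pi i k) <= \prod_k \sum_l f k l.
Proof.
move=> pi_inj f0; rewrite bigA_distr_bigA/=.
rewrite (bigID (fun h => h \in [set pi i | i in I]%SET))/=.
rewrite big_imset/=; last by move=> i i' _ _; exact: pi_inj.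
rewrite lerDl; apply: sumr_ge0 => h _; exact: prodr_ge0.
Qed.

Definition nrm2 n (x : 'I_n -> K) : R := Num.sqrt (\sum_i modulus (x i) ^+ 2).

Lemma nrm2_ge0 n (x : 'I_n -> K) : 0 <= nrm2 x. Proof. exact: sqrtr_ge0. Qed.

Lemma nrm2_sqr n (x : 'I_n -> K) : nrm2 x ^+ 2 = \sum_i modulus (x i) ^+ 2.
Proof. by rewrite sqr_sqrtr// sumr_ge0// => i _; exact: sqr_ge0. Qed.

Lemma nrm2_ge n (x : 'I_n -> K) i : modulus (x i) <= nrm2 x.
Proof.
rewrite -ler_sqr ?nnegrE ?modulus_ge0 ?nrm2_ge0// nrm2_sqr.
by apply: (@sumr_ge_term _ _ predT (fun i => modulus (x i) ^+ 2)) => // j; exact: sqr_ge0.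
Qed.

Definition random_form (I Kx : finType) n (pi : I -> {ffun Kx -> 'I_n})
    (e : {ffun I -> bool}) (x : Kx -> 'I_n -> K) : K :=
  \sum_i of_real F (rademacher e i) * \prod_k x k (pi i k).

(** [sign_choice] over all families of grid vectors and both parts of the value; the numerical
    hypothesis bounds their number. In 7 t, each part contributes 3 t and the rounding error 1 <=
    t. *)
Lemma random_form_unit (I Kx : finType) n (pi : I -> {ffun Kx -> 'I_n}) (t : R) :
  injective pi -> (0 < n)%N -> 1 <= t ->
  4 * (2 * (2 * #|Kx| * n ^ #|Kx| + 2))%:R ^+ (2 * (#|Kx| * n)) <= expR (t ^+ 2) ->
  exists e : {ffun I -> bool}, forall x, (forall k, nrm2 (x k) <= 1) ->
    modulus (random_form pi e x) <= 7 * t.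
Proof.
move=> pi_inj n0 t1 tV; set d := #|Kx| in tV *.
have t0 : 0 < t by exact: lt_le_trans t1.
(* With this mesh, rounding to the grid changes the form by at most 1. *)
pose N := (2 * d * n ^ d).+1.
pose V : finType := ({ffun Kx * 'I_n -> grid N} * bool)%type.
pose xv (v : V) k l : K := grid_val F (v.1 (k, l)).
(* Grid families outside the balls get zero coefficients, so that the bound on the sum of squares
   holds for every v. *)
pose c (v : V) i : R := if [forall k, nrm2 (xv v k) <= 1]
  then part v.2 (\prod_k xv v k (pi i k)) else 0.
have cardV : 2 * #|V|%:R <= expR (t ^+ 2).
  apply: le_trans tV.
  have -> : #|V| = ((2 * (2 * d * n ^ d + 2)) ^ (2 * (d * n)) * 2)%N.
    rewrite card_prod card_bool card_ffun !card_prod card_bool !card_ord.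
    have -> : (2 * N.+1 * (2 * N.+1) = (2 * (2 * d * n ^ d + 2)) ^ 2)%N.
      by rewrite expnS expn1 /N addn2.
    by rewrite -expnM.
  by rewrite natrM natrX; lra.
have c1 v : \sum_i c v i ^+ 2 <= 1.
  rewrite /c; case: (boolP [forall k, nrm2 (xv v k) <= 1]) => [/forallP h|_]; last first.
    by rewrite big1// => i _; rewrite expr0n.
  apply: (@le_trans _ _ (\sum_i \prod_k modulus (xv v k (pi i k)) ^+ 2)).
    apply: ler_sum => i _; rewrite prodrXl -modulus_prod -real_normK ?num_real//.
    by rewrite ler_sqr ?nnegrE ?modulus_ge0// part_le_modulus.
  apply: le_trans (sum_inj_le (f := fun k l => modulus (xv v k l) ^+ 2) pi_inj _) _.
    by move=> k l; exact: sqr_ge0.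
  apply: prodr_ile1 => k _; rewrite -nrm2_sqr sqr_ge0 expr_le1//; [exact: h|exact: nrm2_ge0].
have [e He] := sign_choice t0 cardV c1.
exists e => x x1.
have x1' k l : modulus (x k l) <= 1 by exact: le_trans (nrm2_ge _ _) (x1 k).
have /choice[g gP] : forall kl : Kx * 'I_n, exists g : grid N,
    modulus (grid_val F g) <= modulus (x kl.1 kl.2) /\
    modulus (x kl.1 kl.2 - grid_val F g) <= 2 / N%:R.
  by move=> [k l]; have [g g1 g2] := grid_approx (isT : (0 < N)%N) (x1' k l); exists g.
pose y k l : K := grid_val F (g (k, l)).
have y1 k : nrm2 (y k) <= 1.
  apply: le_trans (x1 k); apply: ler_wsqrtr; apply: ler_sum => l _.
  by rewrite ler_sqr ?nnegrE ?modulus_ge0// (gP (k, l)).1.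
have yT b : `|part b (random_form pi e y)| <= 3 * t.
  have := He ([ffun kl => g kl], b).
  rewrite /random_form part_sum; apply: le_trans.
  rewrite le_eqVlt; apply/orP; left; apply/eqP; congr `|_|.
  apply: eq_bigr => i _; rewrite part_of_realM; congr (_ * _); rewrite /c.
  have E k l : xv ([ffun kl => g kl], b) k l = y k l by rewrite /xv/= ffunE.
  rewrite ifT; first by congr (part _ _); apply: eq_bigr => k _; rewrite E.
  apply/forallP => k; apply: le_trans (y1 k); rewrite /nrm2.
  by under eq_bigr do rewrite E.
have yT' : modulus (random_form pi e y) <= 6 * t.
  by apply: le_trans (modulus_le_parts _) _; have := yT false; have := yT true; lra.
have err : modulus (random_form pi e x - random_form pi e y) <= 1.
  rewrite /random_form -sumrB; apply: le_trans (modulus_sum _ _ _) _.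
  have Ei i : modulus (of_real F (rademacher e i) * \prod_k x k (pi i k) -
      of_real F (rademacher e i) * \prod_k y k (pi i k)) <= d%:R * (2 / N%:R).
    rewrite -mulrBr modulusM modulus_of_real normr_sign mul1r.
    have := @modulus_prod_sub Kx (fun k => x k (pi i k)) (fun k => y k (pi i k)) 1 (2 / N%:R).
    rewrite expr1n mulr1; apply => //.
    - by move=> k; exact: le_trans (nrm2_ge _ _) (y1 k).
    - by move=> k; exact: (gP (k, pi i k)).2.
  apply: le_trans (ler_sum _ (fun i _ => Ei i)) _.
  rewrite sumr_const -[_ *+ _]mulr_natl.
  have cI : (#|I| <= n ^ d)%N.
    by have := leq_card pi pi_inj; rewrite card_ffun card_ord.
  have -> : #|I|%:R * (d%:R * (2 / N%:R)) = (2 * d * #|I|)%:R / N%:R :> R by rewrite !natrM; ring.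
  rewrite ler_pdivrMr ?ltr0n// mul1r ler_nat /N.
  by apply: leqW; rewrite leq_mul2l cI orbT.
have -> : random_form pi e x = (random_form pi e x - random_form pi e y) + random_form pi e y.
  by rewrite subrK.
by apply: le_trans (modulusD _ _) _; lra.
Qed.

Lemma random_form_homog (I Kx : finType) n (pi : I -> {ffun Kx -> 'I_n})
    (e : {ffun I -> bool}) (C : R) :
  (forall x, (forall k, nrm2 (x k) <= 1) -> modulus (random_form pi e x) <= C) ->
  forall x, modulus (random_form pi e x) <= C * \prod_k nrm2 (x k).
Proof.
move=> H x.
have [/existsP[k /eqP xk0]|] := boolP [exists k, nrm2 (x k) == 0].
  rewrite (_ : random_form pi e x = 0) ?modulus0; last first.
    apply: big1 => i _; rewrite (bigD1 k)//= (_ : x k (pi i k) = 0) ?mul0r ?mulr0//.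
    by apply: modulus_eq0; apply/eqP; rewrite eq_le modulus_ge0 andbT -xk0 nrm2_ge.
  by rewrite (bigD1 k)//= xk0 mul0r mulr0.
rewrite negb_exists => /forallP xn0.
have x_gt0 k : 0 < nrm2 (x k) by rewrite lt0r xn0 nrm2_ge0.
pose y k l := of_real F (nrm2 (x k))^-1 * x k l.
have y1 k : nrm2 (y k) <= 1.
  rewrite -(@ler_pXn2r _ 2)// ?nnegrE ?nrm2_ge0// expr1n nrm2_sqr.
  under eq_bigr do rewrite modulusM modulus_of_real exprMn.
  rewrite -mulr_sumr -nrm2_sqr -exprMn ger0_norm ?invr_ge0 ?nrm2_ge0//.
  by rewrite mulVf// expr1n.
have -> : random_form pi e x = of_real F (\prod_k nrm2 (x k)) * random_form pi e y.
  rewrite mulr_sumr; apply: eq_bigr => i _.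
  rewrite mulrCA; congr (_ * _); rewrite of_real_prod -big_split/=.
  apply: eq_bigr => k _; rewrite /y mulrA -of_realM divff// of_real1 mul1r//.
have P0 : 0 <= \prod_k nrm2 (x k) by apply: prodr_ge0 => k _; exact: nrm2_ge0.
rewrite modulusM modulus_of_real ger0_norm// mulrC ler_wpM2r//.
exact: H.
Qed.

(** The logarithm of the number of grid points is of order n log n, hence t^2 must be as well; t =
    sqrt(E) n^(1/2+dl) leaves room for the logarithm. *)
Theorem random_form_bound (Kx : finType) (dl : R) : 0 < dl ->
  exists2 C : R, 0 < C & forall n (I : finType) (pi : I -> {ffun Kx -> 'I_n}),
    (0 < n)%N -> injective pi ->
    exists e : {ffun I -> bool}, forall x,
      modulus (random_form pi e x) <= C * n%:R `^ (2^-1 + dl) * \prod_k nrm2 (x k).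
Proof.
move=> dl0; set d := #|Kx|.
(* D n^d dominates the base 2(2 d n^d + 2). In E the summand 4 absorbs the leading factor 4, and the
   rest the power with exponent 2 d n. *)
pose D : R := (4 * d + 4)%:R; pose E := 4 + 2 * d%:R * (D + d%:R / (2 * dl)).
have D0 : 0 <= D by exact: ler0n.
have E4 : 4 <= E.
  by rewrite lerDl !mulr_ge0// ?ler0n// addr_ge0// divr_ge0 ?ler0n// mulr_ge0// ltW.
have E0 : 0 <= E by exact: le_trans E4.
exists (7 * Num.sqrt E); first by rewrite mulr_gt0// sqrtr_gt0; exact: lt_le_trans E4.
move=> n I pi n0 pi_inj.
have n1 : 1 <= n%:R :> R by rewrite ler1n.
have n0' : 0 < n%:R :> R by rewrite ltr0n.
have pn1 (a : R) : 0 <= a -> 1 <= n%:R `^ a.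
  by move=> a0; apply: le_trans (ler_powR n1 a0); rewrite powRr0.
pose t := Num.sqrt E * n%:R `^ (2^-1 + dl).
have dl0' : 0 <= 2^-1 + dl by rewrite addr_ge0// ltW.
have t1 : 1 <= t.
  rewrite /t -[leLHS]mulr1 ler_pM ?pn1//.
  rewrite -(@ler_pXn2r _ 2)// ?nnegrE ?sqrtr_ge0// sqr_sqrtr// expr1n.
  by apply: le_trans E4; rewrite ler1n.
have tE : t ^+ 2 = E * n%:R `^ (1 + 2 * dl).
  rewrite exprMn sqr_sqrtr//; congr (_ * _).
  rewrite -powR_mulrn ?powR_ge0// -powRrM; congr (_ `^ _).
  by rewrite mulrDl mulVf// mulrC.
suff h : 4 * (2 * (2 * d * n ^ d + 2))%:R ^+ (2 * (d * n)) <= expR (t ^+ 2).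
  have [e He] := random_form_unit pi_inj n0 t1 h.
  exists e => x; have := random_form_homog He x.
  by rewrite /t !mulrA.
set y := n%:R `^ (2 * dl).
have y1 : 1 <= y by apply: pn1; rewrite mulr_ge0// ltW.
(* That is, log n <= n^(2 dl) / (2 dl). *)
have nE : n%:R <= expR (y / (2 * dl)).
  have yE : y <= expR y by apply: le_trans (expR_ge1Dx y); rewrite lerDr.
  have -> : n%:R = y `^ (2 * dl)^-1.
    by rewrite -powRrM divff ?powRr1// gt_eqF// mulr_gt0.
  apply: le_trans (le_powR _ _ yE) _; rewrite ?invr_ge0 ?mulr_ge0 ?(ltW dl0)//.
    by exact: le_trans y1.
  by rewrite /powR gt_eqF ?expR_gt0// expRK mulrC.
have base : (2 * (2 * d * n ^ d + 2))%:R <= expR ((D + d%:R / (2 * dl)) * y) :> R.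
  apply: (@le_trans _ _ (D * n%:R ^+ d)).
    rewrite -natrX -natrM ler_nat.
    have n1' : (1 <= n ^ d)%N by rewrite expn_gt0 n0.
    by rewrite mulnDl mulnDr; apply: leq_add; [rewrite !mulnA | rewrite leq_pmulr].
  rewrite mulrDl expRD; apply: ler_pM; rewrite ?exprn_ge0//.
    apply: le_trans (expR_ge1Dx _); apply: (@le_trans _ _ (D * y)); last by rewrite lerDr.
    by rewrite ler_peMr.
  have -> : d%:R / (2 * dl) * y = d%:R * (y / (2 * dl)) by rewrite mulrAC mulrA.
  rewrite expRM_natl; apply: lerXn2r => //; rewrite nnegrE ?expR_ge0//.
have tt : t ^+ 2 = 4 * n%:R `^ (1 + 2 * dl) + (2 * (d * n))%:R * ((D + d%:R / (2 * dl)) * y).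
  rewrite tE /E powRD; last by rewrite (gt_eqF n0') implybT.
  rewrite powRr1 ?ltW// -/y !natrM; ring.
rewrite tt expRD; apply: ler_pM; rewrite ?exprn_ge0//.
  apply: le_trans (expR_ge1Dx _); have := pn1 (1 + 2 * dl).
  rewrite addr_ge0 ?mulr_ge0 ?(ltW dl0)// => /(_ isT); lra.
by rewrite expRM_natl; apply: lerXn2r => //; rewrite nnegrE ?expR_ge0.
Qed.

End RandomForm.

(** * Test operators *)

Section TestOperator.
Context {R : realType} (F : scalar_field) (m n : nat) (I : finType).
Local Notation K := (scalars R F).
Variables (al : I -> {ffun 'I_m -> 'I_n}) (be : I -> 'I_n) (e : {ffun I -> bool}).
Implicit Types (x y : 'I_m -> nat -> K).

(* The i-th monomial has input indices [al i] and output index [be i]. *)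
Definition test_op x : nat -> K := fun j =>
  \sum_(i | val (be i) == j) of_real F (rademacher e i) * \prod_k x k (al i k).

Lemma test_op_supp x : supp_lt n (test_op x).
Proof.
move=> j nj; apply: big1 => i /eqP ij; move: nj; rewrite -ij leqNgt.
by rewrite ltn_ord.
Qed.

Lemma test_op_multilinear (p : 'I_m -> \bar R) : multilinear_on p test_op.
Proof.
move=> x j a u v _ _ _; apply/funext => l.
rewrite /test_op mulr_sumr -big_split/=; apply: eq_bigr => i _.
have E (w : nat -> K) : \prod_k dfwith x j w k (al i k) =
    w (al i j) * \prod_(k | k != j) x k (al i k).
  rewrite (bigD1 j)//= dfwithE eqxx; congr (_ * _).
  by apply: eq_bigr => k /negbTE kj; rewrite dfwithE kj.
by rewrite !E; ring.
Qed.

Lemma test_op_maps_into (p : 'I_m -> \bar R) (s : \bar R) :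
  (1 <= s)%E -> maps_into p s test_op.
Proof. by move=> s1 x _; apply: supp_seq_space s1 _; exact: test_op_supp. Qed.

Lemma lnorm_coord (p : \bar R) (x : nat -> K) (M : R) i : (1 <= p)%E -> 0 <= M ->
  (lnorm p x <= M%:E)%E -> modulus (x i) <= M.
Proof.
move=> p1 M0 /(lnorm_leP x p1 M0)/(_ i.+1); case: p p1 => [r||]//= p1; last exact.
rewrite lee_fin in p1; have r0 : 0 < r by exact: lt_le_trans p1.
rewrite big_ord_recr/= => h; rewrite leNgt; apply/negP => Mi.
have : modulus (x i) `^ r <= M `^ r.
  by apply: le_trans h; rewrite lerDr; apply: sumr_ge0 => j _; exact: powR_ge0.
by apply/negP; rewrite -ltNge; apply: gt0_ltr_powR; rewrite ?nnegrE ?modulus_ge0.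
Qed.

Lemma lnorm_le_coord (s : \bar R) (x : nat -> K) (M : R) : (1 <= s)%E -> 0 <= M ->
  (0 < n)%N -> supp_lt n x -> (forall j, modulus (x j) <= M) ->
  (lnorm s x <= (n%:R * M)%:E)%E.
Proof.
move=> s1 M0 n0 xn xM.
have n1 : 1 <= n%:R :> R by rewrite ler1n.
apply: (lnorm_supp_le s1 _ xn); first by rewrite mulr_ge0.
case: s s1 => [r||]//= s1; last by move=> i _; apply: le_trans (xM i) _; rewrite ler_peMl.
rewrite lee_fin in s1; have r0 : 0 <= r by exact: le_trans s1.
apply: (@le_trans _ _ (\sum_(i < n) M `^ r)).
  by apply: ler_sum => i _; apply: le_powR => //; exact: modulus_ge0.
rewrite sumr_const card_ord -[_ *+ _]mulr_natl powRM// ler_wpM2r ?powR_ge0//.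
exact: le1r_powR.
Qed.

Lemma test_op_continuous (p : 'I_m -> \bar R) (s : \bar R) :
  (forall k, 1 <= p k)%E -> (1 <= s)%E -> (0 < n)%N -> continuous_on p s test_op.
Proof.
move=> p1 s1 n0 x _ eps eps0.
pose M : R := 1 + \sum_k \sum_(i < n) modulus (x k i).
have S0 : 0 <= \sum_k \sum_(i < n) modulus (x k i).
  by apply: sumr_ge0 => k _; apply: sumr_ge0 => i _; exact: modulus_ge0.
have M1 : 1 <= M by rewrite lerDl.
have xM k (i : 'I_n) : 1 + modulus (x k i) <= M.
  rewrite lerD2l (bigD1 k)//= (bigD1 i)//= -addrA lerDl addr_ge0 ?sumr_ge0// => *.
    exact: modulus_ge0.
  by apply: sumr_ge0 => *; exact: modulus_ge0.
(* A crude Lipschitz constant where the relevant coordinates are at most M; the summand 1 makes it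
   positive. *)
pose C : R := n%:R * (#|I|%:R * (#|'I_m|%:R * M ^+ #|'I_m|)) + 1.
have C0' : 0 <= n%:R * (#|I|%:R * (#|'I_m|%:R * M ^+ #|'I_m|)).
  by rewrite !mulr_ge0// exprn_ge0// (le_trans ler01).
have C0 : 0 < C by rewrite ltr_wpDl.
pose dl := Num.min 1 (eps / (2 * C)).
have dl0 : 0 < dl by rewrite lt_min ltr01 divr_gt0// mulr_gt0.
exists dl => // y _ xy.
have dl1 : dl <= 1 by rewrite ge_min lexx.
have yx k i : modulus (y k i - x k i) <= dl.
  exact: (lnorm_coord i (p1 k) (ltW dl0) (ltW (xy k))).
have yM k (i : 'I_n) : modulus (y k i) <= M.
  apply: le_trans (xM k i); rewrite -[y k i](subrK (x k i)).
  by apply: le_trans (modulusD _ _) _; rewrite lerD2r (le_trans (yx k i)).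
have xM' k (i : 'I_n) : modulus (x k i) <= M by apply: le_trans (xM k i); rewrite lerDr.
apply: (@le_lt_trans _ _ (n%:R * (#|I|%:R * (#|'I_m|%:R * M ^+ #|'I_m| * dl)))%:E).
  apply: lnorm_le_coord => //.
  - by rewrite !mulr_ge0 ?exprn_ge0 ?(ltW dl0)// (le_trans ler01).
  - by move=> j nj; rewrite !test_op_supp// subrr.
  move=> j; rewrite /test_op -sumrB; apply: le_trans (modulus_sum _ _ _) _.
  have tI i : modulus (of_real F (rademacher e i) * \prod_k y k (al i k) -
       of_real F (rademacher e i) * \prod_k x k (al i k)) <= #|'I_m|%:R * M ^+ #|'I_m| * dl.
    rewrite -mulrBr modulusM modulus_of_real normr_sign mul1r.
    exact: (modulus_prod_sub (a := fun k => y k (al i k)) (b := fun k => x k (al i k)) M1 (ltW dl0)).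
  apply: (@le_trans _ _ (\sum_(i : I) #|'I_m|%:R * M ^+ #|'I_m| * dl)); last first.
    by rewrite sumr_const -[_ *+ _]mulr_natl.
  rewrite big_mkcond; apply: ler_sum => i _; case: ifP => _; first exact: tI.
  by rewrite !mulr_ge0 ?exprn_ge0 ?(ltW dl0)// (le_trans ler01).
rewrite lte_fin.
apply: (@le_lt_trans _ _ (C * dl)).
  by rewrite !mulrA ler_wpM2r ?(ltW dl0)// -!mulrA lerDl.
apply: (@le_lt_trans _ _ (C * (eps / (2 * C)))).
  by rewrite ler_pM2l// ge_min lexx orbT.
have -> : C * (eps / (2 * C)) = eps / 2 by field; rewrite gt_eqF.
by rewrite ltr_pdivrMr//; lra.
Qed.

Lemma test_op_continuous_multilinear (p : 'I_m -> \bar R) (s : \bar R) :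
  (forall k, 1 <= p k)%E -> (1 <= s)%E -> (0 < n)%N ->
  continuous_multilinear p s test_op.
Proof.
move=> p1 s1 n0; split.
- exact: test_op_maps_into.
- exact: test_op_multilinear.
- exact: test_op_continuous.
Qed.

Lemma test_op_opnorm (p : 'I_m -> \bar R) (s B : R) :
  (forall k, 1 <= p k)%E -> 1 <= s -> 0 <= B ->
  (forall x, (forall k, lnorm_bound (p k) (x k) 1 n) ->
     \sum_(j < n) modulus (test_op x j) `^ s <= B `^ s) ->
  (opnorm p s%:E test_op <= B%:E)%E.
Proof.
move=> p1 s1 B0 H; apply: ge_ereal_sup => _ [x [_ x1] <-].
have s1E : (1 <= s%:E)%E by rewrite lee_fin.
apply: (lnorm_supp_le s1E B0 (test_op_supp x)) => /=; apply: H => k.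
exact: ((lnorm_leP (x k) (p1 k) ler01).1 (x1 k) n).
Qed.

Hypothesis ab_inj : injective (fun i => (al i, be i)).

Lemma test_op_unit i :
  modulus (test_op (fun k => unit_seq F (al i k)) (be i)) = 1.
Proof.
rewrite /test_op (bigD1 i)//= [X in _ + X]big1 ?addr0; last first.
  move=> i' /andP[/eqP/val_inj bi' i'i].
  have [k ik] : exists k, al i' k != al i k.
    apply/existsP; apply: contraNT i'i; rewrite negb_exists => /forallP h.
    apply/eqP; apply: ab_inj; congr pair => //; apply/ffunP => k.
    by have := h k; rewrite negbK => /eqP.
  by rewrite (bigD1 k)//= /unit_seq val_eqE (negbTE ik) mul0r mulr0.
rewrite modulusM modulus_of_real normr_sign mul1r big1 ?modulus1// => k _.
by rewrite /unit_seq eqxx.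
Qed.

(** Every monomial with input h gives a coordinate of modulus 1, at outputs that differ by
    [ab_inj]. *)
Lemma lnorm_unit_ge (q : \bar R) (h : {ffun 'I_m -> 'I_n}) (D : nat) (L : R) :
  (1 <= q)%E -> (0 < D)%N -> (D <= #|[set i | al i == h]%SET|)%N -> 0 <= L ->
  (lnorm q (test_op (fun k => unit_seq F (h k))) <= L%:E)%E ->
  D%:R `^ inv_exp q <= L.
Proof.
move=> q1 D0 DS L0 /(lnorm_leP _ q1 L0)/(_ n).
set y := test_op _; have yi i : i \in [set i | al i == h]%SET -> modulus (y (be i)) = 1.
  by rewrite inE => /eqP ih; rewrite /y -ih test_op_unit.
case: q q1 => [r||]//= q1 HL.
  rewrite lee_fin in q1; have r0 : 0 < r by exact: lt_le_trans q1.
  rewrite inv_exp_fin//.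
  have DL : D%:R <= L `^ r.
    apply: le_trans HL; apply: (@le_trans _ _ #|[set i | al i == h]%SET|%:R).
      by rewrite ler_nat.
    rewrite -sum1_card natr_sum.
    rewrite (bigID (fun j => j \in [set be i | i in [set i | al i == h]%SET]%SET))/=.
    rewrite big_imset/=; last first.
      move=> i i'; rewrite !inE => /eqP ih /eqP i'h bi; apply: ab_inj.
      by rewrite ih i'h bi.
    apply: ler_wpDr; first by apply: sumr_ge0 => j _; exact: powR_ge0.
    by apply: ler_sum => i ih; rewrite yi// powR1.
  apply: (@le_trans _ _ ((L `^ r) `^ r^-1)).
    by apply: le_powR => //; rewrite invr_ge0 ltW.
  by rewrite -powRrM divff ?gt_eqF// powRr1.
rewrite inv_exp_pinfty powRr0.
have /card_gt0P[i ih] : (0 < #|[set i | al i == h]%SET|)%N by exact: leq_trans DS.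
by rewrite -(yi i ih); exact: HL.
Qed.

(** Each entry listed by [ga] has l_q norm at least D^(1/q), which bounds the coefficient norm from
    below; B bounds the operator norm from above. *)
Lemma test_op_coef (p : 'I_m -> \bar R) (s B C rho : R) (q : \bar R) (T : finType)
    (ga : T -> {ffun 'I_m -> 'I_n}) (D : nat) :
  (forall k, 1 <= p k)%E -> 1 <= s -> (s%:E <= q)%E -> 0 <= B -> 0 < C -> 0 < rho ->
  injective ga -> (0 < D)%N -> (forall t, D <= #|[set i | al i == ga t]%SET|)%N ->
  (opnorm p s%:E test_op <= B%:E)%E ->
  (coef_norm q rho test_op <= C%:E * opnorm p s%:E test_op)%E ->
  #|T|%:R `^ rho^-1 * D%:R `^ inv_exp q <= C * B.
Proof.
move=> p1 s1 sq B0 C0 rho0 ga_inj D0 DS opB coefC.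
have q1 : (1 <= q)%E by apply: le_trans sq; rewrite lee_fin.
have {coefC opB} : (coef_norm q rho test_op <= (C * B)%:E)%E.
  by apply: le_trans coefC _; rewrite EFinM lee_pmul2l// lte_fin.
have CB0 : 0 <= C * B by rewrite mulr_ge0// ltW.
rewrite /coef_norm; set S := (\esum_(i in _) _)%E => SCB.
have S0 : (0 <= S)%E by apply: esum_ge0 => i _; exact: poweR_ge0.
have {SCB} : (S <= ((C * B) `^ rho)%:E)%E.
  have := @gt0_ler_poweR _ rho (ltW rho0) (S `^ rho^-1)%E (C * B)%:E.
  rewrite !in_itv/= !leey !andbT poweR_ge0 lee_fin CB0 => /(_ isT isT SCB).
  by rewrite -poweRrM mulVf ?gt_eqF// poweRe1// poweR_EFin.
move=> /(le_trans (esum_box_ge _ n)).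
pose l (i : {ffun 'I_m -> 'I_n}) := lnorm q (test_op (fun k => unit_seq F (i k))).
have -> : (\sum_(i : {ffun 'I_m -> 'I_n})
   lnorm q (test_op (fun j => unit_seq F (box_emb i j))) `^ rho =
   \sum_(i : {ffun 'I_m -> 'I_n}) l i `^ rho)%E.
  apply: eq_bigr => i _; rewrite /l; congr ((lnorm q (test_op _)) `^ _)%E.
  by apply/funext => k; rewrite ffunE.
have lfin i : exists2 L : R, 0 <= L & l i = L%:E.
  have l0 : (0 <= l i)%E by exact: Lnorm_ge0.
  have : (l i < +oo)%E.
    pose M := \sum_(j < n) modulus (test_op (fun k => unit_seq F (i k)) j).
    have M0 : 0 <= M by apply: sumr_ge0 => j _; exact: modulus_ge0.
    apply: (@le_lt_trans _ _ M%:E); last exact: ltry.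
    apply: (lnorm_supp_le q1 M0 (test_op_supp _)); case: q q1 {sq S S0 l l0} => [r||]//= q1.
      by apply: sum_powR_le => // j; exact: modulus_ge0.
    move=> j jn; apply: (@sumr_ge_term _ _ predT (fun j : 'I_n =>
      modulus (test_op (fun k => unit_seq F (i k)) j)) (Ordinal jn)) => // ?.
    exact: modulus_ge0.
  by case: (l i) l0 => [L||]//; rewrite lee_fin => L0 _; exists L.
have /choice[L LP] : forall i, exists L : R, 0 <= L /\ l i = L%:E.
  by move=> i; have [L L0 lL] := lfin i; exists L.
have -> : (\sum_(i : {ffun 'I_m -> 'I_n}) l i `^ rho = (\sum_(i : {ffun 'I_m -> 'I_n}) L i `^ rho)%:E)%E.
  by rewrite -sumEFin; apply: eq_bigr => i _; rewrite (LP i).2 poweR_EFin.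
rewrite lee_fin => LCB.
have : #|T|%:R * (D%:R `^ inv_exp q) `^ rho <= (C * B) `^ rho.
  apply: le_trans LCB.
  rewrite (bigID (fun h => h \in [set ga t | t in T]%SET))/=.
  rewrite big_imset/=; last by move=> t t' _ _; exact: ga_inj.
  apply: ler_wpDr; first by apply: sumr_ge0 => h _; exact: powR_ge0.
  rewrite mulr_natl -sumr_const; apply: ler_sum => t _.
  apply: le_powR; [exact: ltW|exact: powR_ge0|].
  have [L0 lL] := LP (ga t).
  by apply: (lnorm_unit_ge q1 D0 (DS t) L0); rewrite -lL.
move=> /(@le_powR _ _ _ rho^-1).
rewrite invr_ge0 mulr_ge0 ?powR_ge0// => /(_ (ltW rho0) isT).
rewrite powRM ?powR_ge0// -[X in _ * X]powRrM -[X in _ <= X]powRrM.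
by rewrite divff ?gt_eqF// !powRr1// powR_ge0.
Qed.

End TestOperator.

(** * Necessity of the exponent *)

Section Hoelder.
Context {R : realType}.

(** The missing weight is put on the value 1. *)
Lemma weighted_amgm_sub (I : finType) (w a : I -> R) :
  (forall i, 0 <= w i) -> \sum_i w i <= 1 -> (forall i, 0 <= a i) ->
  \prod_i a i `^ w i <= \sum_i w i * a i + (1 - \sum_i w i).
Proof.
move=> w0 w1 a0; set W := \sum_i w i in w1 *.
have W0 : 0 <= W by exact: sumr_ge0.
have [W00|Wn0] := eqVneq W 0.
  have wi0 i : w i = 0.
    by apply/eqP; rewrite eq_le w0 andbT -W00 (sumr_ge_term (P := predT)).
  rewrite W00 subr0 big1 => [|i _]; last by rewrite wi0 powRr0.
  by rewrite lerDr sumr_ge0// => i _; rewrite mulr_ge0.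
have W_gt0 : 0 < W by rewrite lt0r Wn0.
have h : \prod_i a i `^ (w i / W) <= \sum_i (w i / W) * a i.
  apply: weighted_amgm => // [i|]; first by rewrite divr_ge0.
  by rewrite -mulr_suml divff.
have -> : \prod_i a i `^ w i = (\prod_i a i `^ (w i / W)) `^ W.
  rewrite powR_prod; last by move=> i; exact: powR_ge0.
  by apply: eq_bigr => i _; rewrite -powRrM divfK.
have P0 : 0 <= \prod_i a i `^ (w i / W) by apply: prodr_ge0 => i _; exact: powR_ge0.
apply: (@le_trans _ _ (W * \prod_i a i `^ (w i / W) + (1 - W) * 1)).
  have := @powR_young R _ 1 W P0 ler01; rewrite W0 w1 powR1 mulr1.
  by move=> /(_ isT).
rewrite mulr1 lerD2r.
have -> : \sum_i w i * a i = W * (\sum_i (w i / W) * a i).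
  by rewrite mulr_sumr; apply: eq_bigr => i _; rewrite mulrA mulrCA divff ?mulr1.
by rewrite ler_pM2l.
Qed.

Definition in_ball (n : nat) (p : \bar R) (u : 'I_n -> R) : Prop :=
  match p with
  | r%:E => \sum_i u i `^ r <= 1
  | _ => forall i, u i <= 1
  end.

(** Hoelder's inequality for several factors and the constant 1, whose share of the exponent gives
    the power of n. The factor n in n v_k normalises the mean over i to at most 1 before the
    arithmetic-geometric inequality. *)
Lemma hoelder_family (I : finType) n (p : I -> \bar R) (u : I -> 'I_n -> R) (t : R) :
  (0 < n)%N -> 0 < t -> (forall k, 1 <= p k)%E -> (forall k i, 0 <= u k i) ->
  (forall k, in_ball (p k) (u k)) -> t * \sum_k inv_exp (p k) <= 1 ->
  \sum_i (\prod_k u k i) `^ t <= n%:R `^ (1 - t * \sum_k inv_exp (p k)).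
Proof.
move=> n0 t0 p1 u0 ub; set S := \sum_k inv_exp (p k) => tS.
have n0' : 0 < n%:R :> R by rewrite ltr0n.
(* For p k = +oo the exponent [w k] below is 0, so a default value will do. *)
pose v k i := if p k is r%:E then u k i `^ r else 1.
have v0 k i : 0 <= v k i by rewrite /v; case: (p k) => // r; exact: powR_ge0.
pose w k := t * inv_exp (p k).
have w0 k : 0 <= w k by rewrite mulr_ge0 ?(ltW t0)//; exact: inv_exp_ge0.
have wS : \sum_k w k = t * S by rewrite mulr_sumr.
have pt i : n%:R `^ (t * S) * (\prod_k u k i) `^ t <= \sum_k w k * (n%:R * v k i) + (1 - t * S).
  have nv k : 0 <= n%:R * v k i by rewrite mulr_ge0.
  have := weighted_amgm_sub w0 _ nv; rewrite wS => /(_ tS); apply: le_trans.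
  rewrite powR_prod//.
  have -> : n%:R `^ (t * S) = \prod_k n%:R `^ w k.
    rewrite -wS; elim/big_rec2 : _ => [|k y1 y2 _ <-]; first by rewrite powRr0.
    by rewrite powRD// (gt_eqF n0') implybT.
  rewrite -big_split/=; apply: ler_prod => k _.
  rewrite mulr_ge0 ?powR_ge0//= powRM// ler_wpM2l ?powR_ge0//.
  rewrite /v /w; have := p1 k; have := ub k; case: (p k) => [r||]//=.
    move=> _; rewrite lee_fin => r1; rewrite inv_exp_fin// -powRrM mulrCA divff ?mulr1//.
    by rewrite gt_eqF// (lt_le_trans ltr01).
  by move=> u1 _; rewrite inv_exp_pinfty mulr0 powRr0 powR_le1// ltW.
rewrite powRB ?(gt_eqF n0') ?implybT// powRr1 ?(ltW n0')// ler_pdivlMr ?powR_gt0//.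
rewrite mulrC mulr_sumr; apply: le_trans (ler_sum _ (fun i _ => pt i)) _.
rewrite big_split/= sumr_const card_ord exchange_big/=.
have h k : \sum_i w k * (n%:R * v k i) <= n%:R * w k.
  rewrite -mulr_sumr -mulr_sumr mulrCA ler_pM2l//.
  rewrite /v /w; have := w0 k; rewrite /w; have := ub k; have := p1 k.
  case: (p k) => [r||]//= _; first by move=> u1 wk0; rewrite ler_piMr.
  by move=> _ _; rewrite inv_exp_pinfty mulr0 mul0r.
apply: (@le_trans _ _ (n%:R * (t * S) + (1 - t * S) *+ n)).
  by rewrite lerD2r -wS mulr_sumr; apply: ler_sum => k _; exact: h.
by rewrite -[(1 - t * S) *+ n]mulr_natl -mulrDr addrC subrK mulr1.
Qed.

Lemma exponent_le (a b C : R) :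
  (forall n : nat, (0 < n)%N -> n%:R `^ a <= C * n%:R `^ b) -> a <= b.
Proof.
move=> H; rewrite leNgt; apply/negP => ba.
have d0 : 0 < a - b by rewrite subr_gt0.
have C0 : 0 <= C.
  by have := H 1%N isT; rewrite !powR1 mulr1; apply: le_trans.
pose n := (Num.truncn ((C + 1) `^ (a - b)^-1)).+1.
have Cn : C + 1 <= n%:R `^ (a - b).
  have h : (C + 1) `^ (a - b)^-1 <= n%:R.
    by rewrite ltW// truncnS_gt.
  have := le_powR (ltW d0) (powR_ge0 _ _) h.
  by rewrite -powRrM mulVf ?gt_eqF// powRr1// addr_ge0.
have n0 : 0 < n%:R :> R by rewrite ltr0n.
have := H n isT; apply/negP; rewrite -ltNge.
have -> : n%:R `^ a = n%:R `^ (a - b) * n%:R `^ b :> R.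
  by rewrite -powRD ?subrK// (gt_eqF n0) implybT.
rewrite ltr_pM2r ?powR_gt0//; apply: lt_le_trans Cn; rewrite ltrDl//.
Qed.

End Hoelder.

Section Norms.
Context {R : realType} (F : scalar_field).
Local Notation K := (scalars R F).

Lemma of_realD : {morph (@of_real R F) : x y / x + y}.
Proof.
rewrite /of_real; case: F => //= x y.
by apply/eqP; rewrite eq_complex/= addr0 !eqxx.
Qed.

Lemma nrm2_dual n (b : 'I_n -> K) (G : R) : 0 <= G ->
  (forall y : 'I_n -> K, modulus (\sum_j y j * b j) <= G * nrm2 y) -> nrm2 b <= G.
Proof.
move=> G0 H; have [->//|b0] := eqVneq (nrm2 b) 0.
have b_gt0 : 0 < nrm2 b by rewrite lt0r b0 nrm2_ge0.
have := H (fun j => conjugate (b j)).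
have -> : nrm2 (fun j => conjugate (b j)) = nrm2 b.
  by congr Num.sqrt; apply: eq_bigr => j _; rewrite modulus_conjugate.
have -> : \sum_j conjugate (b j) * b j = of_real F (nrm2 b ^+ 2).
  rewrite nrm2_sqr (big_morph _ of_realD (of_real0 F)); apply: eq_bigr => j _.
  by rewrite mulrC mulr_conjugate.
rewrite modulus_of_real ger0_norm ?sqr_ge0// expr2.
by rewrite ler_pM2r.
Qed.

Lemma nrm2_hoelder (I : finType) n (p : I -> \bar R) (x : I -> 'I_n -> K) :
  (0 < n)%N -> (forall k, 1 <= p k)%E ->
  (forall k, in_ball (p k) (fun i => modulus (x k i))) ->
  \sum_k inv_exp (p k) <= 2^-1 ->
  nrm2 (fun i => \prod_k x k i) <= n%:R `^ (2^-1 - \sum_k inv_exp (p k)).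
Proof.
move=> n0 p1 xb; set S := \sum_k _ => S2.
have S2' : 2 * S <= 1 by lra.
have := hoelder_family n0 (ltr0n R 2) p1 (fun k i => modulus_ge0 (x k i)) xb S2'.
rewrite -/S => h.
rewrite -(@ler_pXn2r _ 2)// ?nnegrE ?nrm2_ge0 ?powR_ge0// nrm2_sqr.
rewrite -(powR_mulrn 2) ?powR_ge0// -powRrM mulrBl mulVf// (mulrC S).
apply: le_trans h; rewrite le_eqVlt; apply/orP; left; apply/eqP.
by apply: eq_bigr => i _; rewrite modulus_prod powR_mulrn// prodr_ge0// => k _; exact: modulus_ge0.
Qed.

Lemma nrm2_ball n (p : \bar R) (x : 'I_n -> K) :
  (0 < n)%N -> (1 <= p)%E -> in_ball p (fun i => modulus (x i)) ->
  inv_exp p <= 2^-1 -> nrm2 x <= n%:R `^ (2^-1 - inv_exp p).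
Proof.
move=> n0 p1 xb p2.
have := @nrm2_hoelder 'I_1 n (fun=> p) (fun=> x) n0 (fun=> p1) (fun=> xb).
rewrite big_ord1 => /(_ p2); apply: le_trans; rewrite le_eqVlt; apply/orP; left; apply/eqP.
by congr Num.sqrt; apply: eq_bigr => i _; rewrite big_ord1.
Qed.

(** [hoelder_family] for two factors: u in the ball of l_p0, and b normalised in l_2. *)
Lemma weighted_nrm2 n (p0 : \bar R) (s : R) (u : 'I_n -> R) (b : 'I_n -> K) :
  (0 < n)%N -> 1 <= s -> (1 <= p0)%E -> (forall i, 0 <= u i) -> in_ball p0 u ->
  inv_exp p0 + 2^-1 <= s^-1 ->
  \sum_i (u i * modulus (b i)) `^ s <= (n%:R `^ (s^-1 - inv_exp p0 - 2^-1) * nrm2 b) `^ s.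
Proof.
move=> n0 s1 p01 u0 ub ps; have s0 : 0 < s by exact: lt_le_trans s1.
have [b0|bn0] := eqVneq (nrm2 b) 0.
  rewrite big1 ?powR_ge0// => i _.
  rewrite (_ : modulus (b i) = 0) ?mulr0 ?powR0 ?gt_eqF//.
  by apply/eqP; rewrite eq_le modulus_ge0 andbT -b0 nrm2_ge.
have b_gt0 : 0 < nrm2 b by rewrite lt0r bn0 nrm2_ge0.
pose p c : \bar R := if c then p0 else 2%:E.
pose v c i := if c then u i else modulus (b i) / nrm2 b.
have p1 c : (1 <= p c)%E by case: c => //=; rewrite lee_fin ler1n.
have v0 c i : 0 <= v c i by case: c => //=; rewrite divr_ge0 ?modulus_ge0 ?nrm2_ge0.
have vb c : in_ball (p c) (v c).
  case: c => //=.
  under eq_bigr do rewrite powR_mulrn ?divr_ge0 ?modulus_ge0 ?nrm2_ge0// expr_div_n.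
  by rewrite -mulr_suml -nrm2_sqr divff// expf_neq0.
have sumE : \sum_c inv_exp (p c) = inv_exp p0 + 2^-1.
  by rewrite big_bool/= inv_exp_fin// ler1n.
have tS : s * \sum_c inv_exp (p c) <= 1.
  by rewrite sumE -ler_pdivlMl// mulr1.
have := hoelder_family n0 s0 p1 v0 vb tS; rewrite sumE => h.
rewrite powRM ?powR_ge0 ?nrm2_ge0// -powRrM.
have -> : (s^-1 - inv_exp p0 - 2^-1) * s = 1 - s * (inv_exp p0 + 2^-1).
  by rewrite -addrA -opprD mulrBl mulVf ?gt_eqF// (mulrC s).
rewrite -ler_pdivrMr ?powR_gt0//; apply: le_trans h.
rewrite mulr_suml le_eqVlt; apply/orP; left; apply/eqP; apply: eq_bigr => i _.
rewrite big_bool/= mulrA [RHS]powRM ?mulr_ge0 ?invr_ge0 ?modulus_ge0 ?nrm2_ge0//.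
by rewrite powRV// nrm2_ge0.
Qed.

Lemma sum_le_nrm2 n (s : R) (b : 'I_n -> K) : (0 < n)%N -> 1 <= s -> s <= 2 ->
  \sum_i modulus (b i) `^ s <= (n%:R `^ (s^-1 - 2^-1) * nrm2 b) `^ s.
Proof.
move=> n0 s1 s2; have s0 : 0 < s by exact: lt_le_trans s1.
have := @weighted_nrm2 n +oo%E s (fun=> 1) b n0 s1 (leey _) (fun=> ler01) (fun=> lexx _).
rewrite inv_exp_pinfty add0r subr0 lef_pV2 ?posrE// => /(_ s2).
by under eq_bigr do rewrite mul1r.
Qed.

Lemma lnorm_bound_in_ball p (x : nat -> K) n :
  lnorm_bound p x 1 n -> in_ball p (fun i : 'I_n => modulus (x i)).
Proof.
case: p => [r||] /=; first by rewrite powR1.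
  by move=> h i; exact: h.
by move=> h i; exact: h.
Qed.

End Norms.

(** * Diagonal test operators *)

Section LowerTests.
Context {R : realType} (F : scalar_field) (m : nat).
Local Notation K := (scalars R F).
Variables (p : 'I_m -> \bar R) (s rho C : R) (q : \bar R).
Hypothesis p1 : forall k, (1 <= p k)%E.
Hypothesis s1 : 1 <= s.
Hypothesis sq : (s%:E <= q)%E.
Hypothesis rho0 : 0 < rho.
Hypothesis C0 : 0 < C.
Hypothesis H : forall A : ('I_m -> nat -> K) -> (nat -> K),
  continuous_multilinear p s%:E A ->
  (coef_norm q rho A <= C%:E * opnorm p s%:E A)%E.
Let tau := \sum_k inv_exp (p k).

Let s0 : 0 < s. Proof. exact: lt_le_trans s1. Qed.

(** Pairing with y turns the output into one more input, so that bounds for scalar forms apply. *)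
Lemma test_op_sum_dual n (I : finType) (al : I -> {ffun 'I_m -> 'I_n}) (be : I -> 'I_n)
    (e : {ffun I -> bool}) (x : 'I_m -> nat -> K) (y : 'I_n -> K) :
  \sum_j y j * test_op al be e x j =
  \sum_i of_real F (rademacher e i) * (y (be i) * \prod_k x k (al i k)).
Proof.
rewrite [RHS](partition_big be predT)//=; apply: eq_bigr => j _.
rewrite /test_op mulr_sumr; apply: eq_big => [i|i /eqP/val_inj ->]; first by rewrite val_eqE.
by rewrite mulrCA.
Qed.

Lemma test_ineq n (I T : finType) (al : I -> {ffun 'I_m -> 'I_n}) (be : I -> 'I_n)
    (e : {ffun I -> bool}) (ga : T -> {ffun 'I_m -> 'I_n}) (D : nat) (B : R) :
  (0 < n)%N -> injective (fun i => (al i, be i)) -> injective ga -> (0 < D)%N ->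
  (forall t, D <= #|[set i | al i == ga t]%SET|)%N -> 0 <= B ->
  (forall x : 'I_m -> nat -> K,
     (forall k, in_ball (p k) (fun i : 'I_n => modulus (x k i))) ->
     \sum_(j < n) modulus (test_op al be e x j) `^ s <= B `^ s) ->
  #|T|%:R `^ rho^-1 * D%:R `^ inv_exp q <= C * B.
Proof.
move=> n0 ab_inj ga_inj D0 DS B0 hB.
have s1E : (1 <= s%:E)%E by rewrite lee_fin.
apply: (test_op_coef (F := F) (e := e) (p := p) ab_inj p1 s1 sq B0 C0 rho0 ga_inj D0 DS).
  apply: test_op_opnorm => // x xb; apply: hB => k.
  exact: lnorm_bound_in_ball (xb k).
by apply: H; exact: test_op_continuous_multilinear.
Qed.

(** Test A(x)_j = prod_k x_k(j) for j < n: it has n entries of norm 1, and norm at most n^(1/s -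
    tau) by Hoelder. *)
Lemma lower_diag : (0 < m)%N -> s * tau <= 1 -> rho^-1 <= s^-1 - tau.
Proof.
move=> m0 st; apply: (@exponent_le _ _ _ C) => n n0.
pose k0 : 'I_m := Ordinal m0.
pose al (i : 'I_n) : {ffun 'I_m -> 'I_n} := [ffun=> i].
have al_inj : injective al.
  by move=> i i' /ffunP/(_ k0); rewrite !ffunE.
pose e : {ffun 'I_n -> bool} := [ffun=> false].
have := @test_ineq n 'I_n 'I_n al id e al 1 (n%:R `^ (s^-1 - tau)) n0.
rewrite card_ord powR1 mulr1; apply => //.
- by move=> i i' [].
- move=> t; apply/card_gt0P; exists t; by rewrite inE.
move=> x xb.
have E (j : 'I_n) : modulus (test_op al id e x j) = \prod_k modulus (x k j).
  rewrite /test_op (bigD1 j)//= [X in _ + X]big1 ?addr0 => [|i /andP[/eqP/val_inj ->]]; last by rewrite eqxx.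
  rewrite modulusM modulus_of_real normr_sign mul1r modulus_prod.
  by apply: eq_bigr => k _; rewrite ffunE.
under eq_bigr do rewrite E.
have := hoelder_family n0 s0 p1 (fun k i => modulus_ge0 (x k i)) xb st.
by rewrite -powRrM mulrBl mulVf ?gt_eqF// (mulrC tau).
Qed.

(** Test A(x)_j = sum_i +-prod_k x_k(i): it has n entries of norm n^(1/q). The product lies in l_2
    with norm at most n^(1/2 - tau), the random matrix costs n^(1/2 + dl) up to a constant, and the
    return from l_2 to l_s costs n^(1/s - 1/2). *)
Lemma lower_diag_random : (0 < m)%N -> s <= 2 -> tau <= 2^-1 ->
  rho^-1 + inv_exp q <= s^-1 + 2^-1 - tau.
Proof.
move=> m0 s2 tau2; apply/ler_addgt0Pr => dl dl0.
have [B B0 HB] := @random_form_bound R F bool dl dl0.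
apply: (@exponent_le _ _ _ (C * B)) => n n0.
pose k0 : 'I_m := Ordinal m0.
pose pi (i : 'I_n * 'I_n) : {ffun bool -> 'I_n} := [ffun b => if b then i.1 else i.2].
have pi_inj : injective pi.
  move=> [i j] [i' j'] /ffunP h; have := h true; have := h false.
  by rewrite !ffunE /= => -> ->.
have [e He] := HB n _ pi n0 pi_inj.
pose al (i : 'I_n * 'I_n) : {ffun 'I_m -> 'I_n} := [ffun=> i.1].
pose ga (i : 'I_n) : {ffun 'I_m -> 'I_n} := [ffun=> i].
have n0' : 0 < n%:R :> R by rewrite ltr0n.
have nD (a b : R) : n%:R `^ (a + b) = n%:R `^ a * n%:R `^ b :> R.
  by rewrite powRD// (gt_eqF n0') implybT.
have := @test_ineq n ('I_n * 'I_n)%type 'I_n al snd e ga n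
  (n%:R `^ (s^-1 - 2^-1) * (B * n%:R `^ (2^-1 + dl) * n%:R `^ (2^-1 - tau))) n0.
rewrite card_ord -nD => h.
have -> : C * B * n%:R `^ (s^-1 + 2^-1 - tau + dl) =
  C * (n%:R `^ (s^-1 - 2^-1) * (B * n%:R `^ (2^-1 + dl) * n%:R `^ (2^-1 - tau))).
  have -> : s^-1 + 2^-1 - tau + dl = (s^-1 - 2^-1) + ((2^-1 + dl) + (2^-1 - tau)) by lra.
  by rewrite !nD; ring.
apply: h.
- by move=> [i j] [i' j'] [] /ffunP/(_ k0); rewrite !ffunE /= => -> ->.
- by move=> i i' /ffunP/(_ k0); rewrite !ffunE.
- exact: n0.
- move=> t; rewrite -[X in (X <= _)%N]card_ord -(card_imset _ (f := fun j : 'I_n => (t, j))); last by move=> j j' [].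
  apply: subset_leq_card; apply/fintype.subsetP => _ /imsetP[j _ ->].
  by rewrite inE; apply/eqP/ffunP => k; rewrite !ffunE.
- by rewrite !mulr_ge0 ?powR_ge0// ltW.
move=> x xb; set b := test_op _ _ _ _.
apply: le_trans (sum_le_nrm2 (fun j => b j) n0 s1 s2) _.
apply: le_powR; [exact: ltW|by rewrite mulr_ge0 ?powR_ge0 ?nrm2_ge0|].
rewrite ler_wpM2l ?powR_ge0//.
apply: nrm2_dual => [|y]; first by rewrite !mulr_ge0 ?powR_ge0// ltW.
rewrite test_op_sum_dual.
pose X (c : bool) (l : 'I_n) : K := if c then \prod_k x k l else y l.
have -> : \sum_i of_real F (rademacher e i) * (y i.2 * \prod_k x k (al i k)) = random_form pi e X.
  apply: eq_bigr => i _; rewrite big_bool/= !ffunE /= [in RHS](mulrC (\prod_k _)).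
  by congr (_ * (_ * _)); apply: eq_bigr => k _; rewrite ffunE.
apply: le_trans (He X) _; rewrite big_bool/= mulrA.
rewrite ler_wpM2r ?nrm2_ge0// ler_wpM2l ?mulr_ge0 ?powR_ge0 ?(ltW B0)//.
exact: (nrm2_hoelder n0 p1 xb tau2).
Qed.

End LowerTests.

(** * Test operators with a random sign for every multi-index *)

Section LowerRandom.
Context {R : realType} (F : scalar_field) (m : nat).
Local Notation K := (scalars R F).
Variables (p : 'I_m -> \bar R) (s rho C : R) (q : \bar R).
Hypothesis p1 : forall k, (1 <= p k)%E.
Hypothesis s1 : 1 <= s.
Hypothesis sq : (s%:E <= q)%E.
Hypothesis rho0 : 0 < rho.
Hypothesis C0 : 0 < C.
Hypothesis H : forall A : ('I_m -> nat -> K) -> (nat -> K),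
  continuous_multilinear p s%:E A ->
  (coef_norm q rho A <= C%:E * opnorm p s%:E A)%E.
Hypothesis p2 : forall k, inv_exp (p k) <= 2^-1.
Let tau := \sum_k inv_exp (p k).

Let s0 : 0 < s. Proof. exact: lt_le_trans s1. Qed.

Let prod_nrm2_le n (P : pred 'I_m) (x : 'I_m -> 'I_n -> K) : (0 < n)%N ->
  (forall k, in_ball (p k) (fun i => modulus (x k i))) ->
  \prod_(k | P k) nrm2 (x k) <= n%:R `^ (\sum_(k | P k) (2^-1 - inv_exp (p k))).
Proof.
move=> n0 xb; have n0' : 0 < n%:R :> R by rewrite ltr0n.
apply: (@le_trans _ _ (\prod_(k | P k) n%:R `^ (2^-1 - inv_exp (p k)))).
  by apply: ler_prod => k _; rewrite nrm2_ge0 nrm2_ball.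
rewrite le_eqVlt; apply/orP; left; apply/eqP.
elim/big_rec2 : _ => [|k y1 y2 _ ->]; first by rewrite powRr0.
by rewrite [RHS]powRD// (gt_eqF n0') implybT.
Qed.

Let card_box n : #|{: {ffun 'I_m -> 'I_n}}|%:R `^ rho^-1 = n%:R `^ (m%:R / rho) :> R.
Proof. by rewrite card_ffun !card_ord natrX -powR_mulrn// -powRrM. Qed.

(** All n^m entries have norm n^(1/q). The random (m+1)-form on l_2 costs n^(1/2 + dl) up to a
    constant, the passages from l_(p_k) to l_2 cost n^(m/2 - tau) together, and that from l_2 to l_s
    costs n^(1/s - 1/2). *)
Lemma lower_random : s <= 2 ->
  m%:R / rho + inv_exp q <= s^-1 + m%:R / 2 - tau.
Proof.
move=> s2; apply/ler_addgt0Pr => dl dl0.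
have [B B0 HB] := @random_form_bound R F 'I_m.+1 dl dl0.
apply: (@exponent_le _ _ _ (C * B)) => n n0.
pose pi (i : {ffun 'I_m -> 'I_n} * 'I_n) : {ffun 'I_m.+1 -> 'I_n} :=
  [ffun k => if unlift ord0 k is Some k' then i.1 k' else i.2].
have pi_inj : injective pi.
  move=> [i j] [i' j'] /ffunP h; congr pair.
    by apply/ffunP => k; have := h (lift ord0 k); rewrite !ffunE liftK.
  by have := h ord0; rewrite !ffunE unlift_none.
have [e He] := HB n _ pi n0 pi_inj.
have n0' : 0 < n%:R :> R by rewrite ltr0n.
have nD (a b : R) : n%:R `^ (a + b) = n%:R `^ a * n%:R `^ b :> R.
  by rewrite powRD// (gt_eqF n0') implybT.
have := @test_ineq _ _ _ _ _ _ _ _ p1 s1 sq rho0 C0 H n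
  ({ffun 'I_m -> 'I_n} * 'I_n)%type {ffun 'I_m -> 'I_n} fst snd e id n
  (n%:R `^ (s^-1 - 2^-1) * (B * n%:R `^ (2^-1 + dl) * n%:R `^ (m%:R / 2 - tau))) n0.
rewrite card_box -nD => h.
have -> : C * B * n%:R `^ (s^-1 + m%:R / 2 - tau + dl) =
  C * (n%:R `^ (s^-1 - 2^-1) * (B * n%:R `^ (2^-1 + dl) * n%:R `^ (m%:R / 2 - tau))).
  have -> : s^-1 + m%:R / 2 - tau + dl = (s^-1 - 2^-1) + ((2^-1 + dl) + (m%:R / 2 - tau)) by lra.
  by rewrite !nD; ring.
apply: h => //.
- by move=> [i j] [i' j'] [] /= -> ->.
- move=> t; rewrite -[X in (X <= _)%N]card_ord -(card_imset _ (f := fun j : 'I_n => (t, j))); last by move=> j j' [].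
  apply: subset_leq_card; apply/fintype.subsetP => _ /imsetP[j _ ->].
  by rewrite inE.
- by rewrite !mulr_ge0 ?powR_ge0// ltW.
move=> x xb; set b := test_op _ _ _ _.
apply: le_trans (sum_le_nrm2 (fun j => b j) n0 s1 s2) _.
apply: le_powR; [exact: ltW|by rewrite mulr_ge0 ?powR_ge0 ?nrm2_ge0|].
rewrite ler_wpM2l ?powR_ge0//.
apply: nrm2_dual => [|y]; first by rewrite !mulr_ge0 ?powR_ge0// ltW.
rewrite test_op_sum_dual.
pose X (k : 'I_m.+1) (l : 'I_n) : K := if unlift ord0 k is Some k' then x k' l else y l.
have -> : \sum_i of_real F (rademacher e i) * (y i.2 * \prod_k x k (i.1 k)) = random_form pi e X.
  apply: eq_bigr => i _; rewrite big_ord_recl /X unlift_none !ffunE unlift_none.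
  by congr (_ * (_ * _)); apply: eq_bigr => k _; rewrite liftK !ffunE liftK.
apply: le_trans (He X) _; rewrite big_ord_recl -mulrA -mulrA [nrm2 _ * _]mulrC.
rewrite !mulrA.
have -> : nrm2 (X ord0) = nrm2 y by rewrite /X unlift_none.
rewrite ler_wpM2r ?nrm2_ge0// ler_wpM2l ?mulr_ge0 ?powR_ge0 ?(ltW B0)//.
have -> : \prod_(k < m) nrm2 (X (lift ord0 k)) = \prod_k nrm2 (fun l : 'I_n => x k l).
  by apply: eq_bigr => k _; rewrite /X liftK.
apply: le_trans (prod_nrm2_le predT n0 xb) _.
rewrite le_eqVlt; apply/orP; left; apply/eqP; congr (_ `^ _).
by rewrite sumrB sumr_const card_ord -[_ *+ _]mulr_natl.
Qed.

(** The output index repeats the input index of k0, so A(x)_j is x_k0(j) times a form b_j in the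
    other variables. The hypothesis is what Hoelder's inequality from l_(p_k0) and l_2 into l_s
    requires. *)
Lemma lower_random_diag (k0 : 'I_m) : inv_exp (p k0) + 2^-1 <= s^-1 ->
  m%:R / rho <= s^-1 - tau + (m%:R - 1) / 2.
Proof.
move=> pk0; apply/ler_addgt0Pr => dl dl0.
have [B B0 HB] := @random_form_bound R F 'I_m dl dl0.
apply: (@exponent_le _ _ _ (C * B)) => n n0.
have [e He] := HB n {ffun 'I_m -> 'I_n} id n0 (@inj_id _).
have n0' : 0 < n%:R :> R by rewrite ltr0n.
have nD (a b : R) : n%:R `^ (a + b) = n%:R `^ a * n%:R `^ b :> R.
  by rewrite powRD// (gt_eqF n0') implybT.
pose E := \sum_(k | k != k0) (2^-1 - inv_exp (p k)).
have EE : E = (m%:R - 1) / 2 - (tau - inv_exp (p k0)).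
  rewrite /E sumrB /tau (bigD1 k0 (P := predT))//= [X in _ - (X - _)]addrC addrK.
  congr (_ - _); rewrite -[LHS](addKr (2^-1)) -(bigD1 k0 (P := predT) (F := fun=> 2^-1))//=.
  by rewrite sumr_const card_ord -[_ *+ _]mulr_natl; lra.
have := @test_ineq _ _ _ _ _ _ _ _ p1 s1 sq rho0 C0 H n
  {ffun 'I_m -> 'I_n} {ffun 'I_m -> 'I_n} id (fun i => i k0) e id 1
  (n%:R `^ (s^-1 - inv_exp (p k0) - 2^-1) * (B * n%:R `^ (2^-1 + dl) * n%:R `^ E)) n0.
rewrite card_box powR1 mulr1 => h.
have -> : C * B * n%:R `^ (s^-1 - tau + (m%:R - 1) / 2 + dl) =
  C * (n%:R `^ (s^-1 - inv_exp (p k0) - 2^-1) * (B * n%:R `^ (2^-1 + dl) * n%:R `^ E)).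
  have -> : s^-1 - tau + (m%:R - 1) / 2 + dl = (s^-1 - inv_exp (p k0) - 2^-1) + ((2^-1 + dl) + E).
    by rewrite EE; lra.
  by rewrite !nD; ring.
apply: h => //.
- by move=> i i' [].
- by move=> t; apply/card_gt0P; exists t; rewrite inE.
- by rewrite !mulr_ge0 ?powR_ge0// ltW.
move=> x xb.
pose b (j : 'I_n) : K := \sum_(i : {ffun 'I_m -> 'I_n} | i k0 == j)
  of_real F (rademacher e i) * \prod_(k | k != k0) x k (i k).
have xbE (j : 'I_n) : modulus (test_op id (fun i : {ffun 'I_m -> 'I_n} => i k0) e x j) = modulus (x k0 j) * modulus (b j).
  rewrite -modulusM /b mulr_sumr; congr modulus; apply: eq_big => [i|i /eqP/val_inj <-].
    by rewrite val_eqE.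
  by rewrite (bigD1 k0)//= mulrCA.
under eq_bigr do rewrite xbE.
apply: le_trans (weighted_nrm2 b n0 s1 (p1 k0) (fun i => modulus_ge0 (x k0 i)) (xb k0) pk0) _.
apply: le_powR; [exact: ltW|by rewrite mulr_ge0 ?powR_ge0 ?nrm2_ge0|].
rewrite ler_wpM2l ?powR_ge0//.
apply: nrm2_dual => [|y]; first by rewrite !mulr_ge0 ?powR_ge0// ltW.
(* The dual vector y takes the slot freed by x_k0. *)
pose X (k : 'I_m) (l : 'I_n) : K := if k == k0 then y l else x k l.
have -> : \sum_j y j * b j = random_form id e X.
  rewrite /random_form (partition_big (fun i : {ffun 'I_m -> 'I_n} => i k0) predT)//=.
  apply: eq_bigr => j _; rewrite /b mulr_sumr; apply: eq_bigr => i /eqP ij.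
  rewrite mulrCA; congr (_ * _); rewrite [RHS](bigD1 k0)//= /X eqxx ij; congr (_ * _).
  by apply: eq_bigr => k /negbTE ->.
apply: le_trans (He X) _; rewrite (bigD1 k0)//= [nrm2 _ * _]mulrC mulrA.
have -> : nrm2 (X k0) = nrm2 y by rewrite /X eqxx.
rewrite ler_wpM2r ?nrm2_ge0// ler_wpM2l ?mulr_ge0 ?powR_ge0 ?(ltW B0)//.
have -> : \prod_(k < m | k != k0) nrm2 (X k) = \prod_(k < m | k != k0) nrm2 (fun l : 'I_n => x k l).
  by apply: eq_bigr => k /negbTE kk0; rewrite /X kk0.
exact: (prod_nrm2_le (fun k => k != k0) n0 xb).
Qed.

End LowerRandom.

(** * Equivalence of (1) and (2) *)

Theorem theorem1p1 (R : realType) (F : scalar_field) (m : nat)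
    (p : 'I_m -> \bar R) (s q : \bar R) (rho : R) :
  (0 < m)%N ->
  (forall j, (1 <= p j)%E) ->
  (1 <= s)%E -> (s <= q)%E ->
  0 < rho ->
  (2%:E <= q)%E \/ (q < 2%:E)%E /\ \sum_(j < m) inv_exp (p j) < 2^-1 ->
  forall lambda : R,
  lambda^-1 = 2^-1 + inv_exp s - inv_exp (Order.min q 2%:E)
              - \sum_(j < m) inv_exp (p j) ->
  0 < lambda^-1 ->
  (exists2 C : R, 0 < C &
     forall A : ('I_m -> nat -> scalars R F) -> (nat -> scalars R F),
       continuous_multilinear p s A ->
       (coef_norm q rho A <= C%:E * opnorm p s A)%E)
  <->
  m%:R / rho <= lambda^-1
    + (m%:R - 1) * inv_exp (Order.max lambda%:E (Order.max s 2%:E)).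
Proof.
move=> m0 p1 s1 sq rho0 hq lambda lamE lam0.
set tau := \sum_(j < m) inv_exp (p j) in hq lamE *.
have tau0 : 0 <= tau by apply: sumr_ge0 => k _; exact: inv_exp_ge0.
have inv2 : inv_exp 2%:E = 2^-1 :> R by rewrite inv_exp_fin// ler1n.
case: s s1 sq lamE => [s||]// s1 sq lamE; last first.
  (* For s = +oo also q = +oo, and 1/lambda would be -tau <= 0. *)
  exfalso; move: lam0; rewrite lamE.
  have -> : q = +oo%E by apply/eqP; rewrite -leye_eq.
  by rewrite inv_exp_pinfty min_r ?leey// inv2; lra.
rewrite lee_fin in s1; have s0 : 0 < s by exact: lt_le_trans s1.
rewrite (inv_exp_fin s1) in lamE.
have lambda0 : 0 < lambda by rewrite -invr_gt0.
(* Replacing q by Q <= q increases the coefficient norm and leaves min(q, 2)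
   unchanged. *)
have [Q sQ [Qq QE]] : exists2 Q : R, (s < 2 /\ s <= Q <= 2) \/ (2 <= s /\ Q = s) &
    (Q%:E <= q)%E /\ inv_exp (Order.min q 2%:E) = (Num.min Q 2)^-1.
  have [q2|q2] := leP 2%:E q.
    have /orP[s2|s2] : (s < 2) || (2 <= s) by case: ltP.
      by exists 2; [left; rewrite s2 (ltW s2) lexx|rewrite minxx inv2].
    by exists s; [right|rewrite (min_idPr s2) inv2].
  case: q q2 sq {hq lamE} => [q||]// q2 sq; rewrite !lte_fin !lee_fin in q2 sq.
  exists q; first by left; rewrite (le_lt_trans sq q2) sq ltW.
  by rewrite lexx inv_exp_fin ?(le_trans s1)// (min_idPl (ltW q2)).
rewrite QE in lamE.
have Qmin2 : 2^-1 <= (Num.min Q 2)^-1.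
  have Q0 : 0 < Q by case: sQ => [[_ /andP[sQ _]]|[_ ->//]]; exact: lt_le_trans sQ.
  by rewrite lef_pV2 ?posrE ?lt_min ?Q0 ?ltr0n// ge_min lexx orbT.
have slam : s <= lambda by rewrite -lef_pV2 ?posrE//; lra.
have -> : inv_exp (Order.max lambda%:E (Order.max s%:E 2%:E)) = Num.min 2^-1 lambda^-1.
  have -> : Order.max lambda%:E (Order.max s%:E 2%:E) = (Num.max lambda 2)%:E :> \bar R.
    by rewrite maxA -!EFin_max (max_idPl slam).
  rewrite inv_exp_fin; last by rewrite le_max ler1n orbT.
  have [l2|l2] := leP lambda 2; last first.
    by rewrite min_r// lef_pV2 ?posrE// ltW.
  by rewrite min_l ?lef_pV2 ?posrE.
split=> [[C C0 H]|hrho].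
  have tk k : inv_exp (p k) <= tau.
    by apply: (@sumr_ge_term _ _ predT (fun k => inv_exp (p k))) => // j; exact: inv_exp_ge0.
  have s1' : s^-1 <= 1 by rewrite invf_le1.
  (* If lambda >= 2, condition (2) reads 1/rho <= 1/lambda, so test operators with n entries are
     enough; otherwise all n^m entries are used. *)
  have [lam2|lam2] := leP lambda^-1 2^-1.
    suff rl : rho^-1 <= lambda^-1.
      have -> : lambda^-1 + (m%:R - 1) * lambda^-1 = m%:R * lambda^-1 by ring.
      by rewrite ler_wpM2l.
    case: hq => [q2|[q2 tau2]].
      have E : lambda^-1 = s^-1 - tau by rewrite lamE -QE min_r// inv2; lra.
      rewrite E; apply: (lower_diag p1 s1 sq rho0 C0 H m0).
      by rewrite mulrC -ler_pdivlMr// div1r -/tau; lra.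
    have s2 : s <= 2 by rewrite -lee_fin; exact: le_trans sq (ltW q2).
    (* The assumption tau < 1/2 enters here: the product of the inputs is estimated in l_2. *)
    have := lower_diag_random p1 s1 sq rho0 C0 H m0 s2 (ltW tau2).
    by rewrite lamE -QE min_l ?(ltW q2)//; rewrite -/tau; lra.
  case: hq => [q2|[q2 tau2]].
    have E : lambda^-1 = s^-1 - tau by rewrite lamE -QE min_r// inv2; lra.
    have p2 k : inv_exp (p k) <= 2^-1 by have := tk k; lra.
    have := lower_random_diag p1 s1 sq rho0 C0 H p2 (k0 := Ordinal m0).
    (* From 1/s - tau > 1/2 and 1/p_k <= tau, so any variable can serve as k0. *)
    have -> : inv_exp (p (Ordinal m0)) + 2^-1 <= s^-1 by have := tk (Ordinal m0); lra.
    by move=> /(_ isT); rewrite -/tau -E.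
  have s2 : s <= 2 by rewrite -lee_fin; exact: le_trans sq (ltW q2).
  have p2 k : inv_exp (p k) <= 2^-1 by have := tk k; lra.
  have := lower_random p1 s1 sq rho0 C0 H p2 s2.
  by rewrite lamE -QE min_l ?(ltW q2)//; rewrite -/tau; lra.
exists (upper_cst m Q rho); first exact: upper_cst_gt0.
move=> A [mapsA multiA _].
apply: (coef_norm_opnorm p1 s1 multiA mapsA m0 sQ Qq rho0).
  by rewrite -/tau -lamE.
by rewrite -/tau -lamE.
Qed.
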